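(* Let $E$ be a directed graph. The assignment $$v\mapsto [v\otimes e_{1,1}]_{\mathcal{D}}\quad (v\in E^0),\qquad q_S\mapsto\Big[\Big(w-\sum_{e\in S}ee^*\Big)\otimes e_{1,1}\Big]_{\mathcal{D}}$$ (where $S$ is a nonempty finite subset of $wE^1$ with $w$ an infinite emitter) induces an isomorphism of monoids from $M_E$ to $\mathcal{V}^*(L_{\mathbb{Z}}(E),\mathcal{D}_{\mathbb{Z}}(E))$. Moreover, for any field $\mathsf{k}$, the map $\beta_E:\mathcal{V}^*(L_{\mathbb{Z}}(E),\mathcal{D}_{\mathbb{Z}}(E))\to\mathcal{V}(L_{\mathsf{k}}(E))$ which sends $[p]_{\mathcal{D}}$ to $[\iota_E(p)]$ is an isomorphism of monoids.
   Context: **Graphs and Leavitt path algebras.** A directed graph $E=(E^0,E^1,r,s)$ has vertices $E^0$, edges $E^1$, range and source maps $r,s$; $vE^1=\{e\in E^1:s(e)=v\}$. A vertex $v$ is regular if $vE^1$ is finite and nonempty, and an infinite emitter if $vE^1$ is infinite. A path is a vertex (length $0$) or a finite word $e_1\cdots e_n$ of edges with $r(e_i)=s(e_{i+1})$. For a commutative unital ring $R$, $L_R(E)$ is the universal $R$-algebra generated by $v\in E^0$ (pairwise orthogonal idempotents) and $e,e^*$ for $e\in E^1$ with relations $s(e)e=e=er(e)$, $r(e)e^*=e^*=e^*s(e)$, $e^*f=\delta_{e,f}r(e)$, and $v=\sum_{e\in vE^1}ee^*$ for regular $v$. For a path $\mu=e_1\cdots e_n$, $\mu^*=e_n^*\cdots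 e_1^*$ (and $v^*=v$). The diagonal is $\mathcal{D}_R(E)=\operatorname{span}_R\{\mu\mu^*:\mu\text{ a path in }E\}$, a commutative subring. $L_{\mathbb{Z}}(E)$ is a $*$-ring with the $\mathbb{Z}$-linear involution $\mu\nu^*\mapsto\nu\mu^*$. A projection in a $*$-ring is an element $p=p^*=p^2$. **The monoid $\mathcal{V}^*(A,D)$.** Let $A$ be a $*$-ring and $D$ a $*$-subring. $\mathsf{M}_{\mathbb{N}}(A)$ is the $*$-ring of $\mathbb{N}\times\mathbb{N}$ matrices over $A$ with finitely many nonzero entries; $a\otimes e_{i,j}$ is the matrix with $a$ in entry $(i,j)$ and zeros elsewhere. $D^s\subseteq\mathsf{M}_{\mathbb{N}}(A)$ is the $*$-subring of diagonal matrices with entries in $D$. For projections $p,q\in D^s$, write $p\sim q$ if there is $v\in\mathsf{M}_{\mathbb{N}}(A)$ with $vD^sv^*\subseteq D^s$, $v^*D^sv\subseteq D^s$, $v^*v=p$, $vv^*=q$; this is an equivalence relation, with classes $[p]_{D^s}$. $\mathcal{V}^*(A,D)$ is the set of classes of projections in $D^s$, an abelian monoid under $[p]_{D^s}+[q]_{D^s}=[p\oplus q]_{D^s}$, where for $p=\sum_{k=1}^m p_k\otimes e_{k,k}$ and $q=\sum_{k=1}^n q_k\otimes e_{k,k}$, $p\oplus q=\sum_{k=1}^m p_k\otimes e_{k,k}+\sum_{k=1}^n q_k\otimes e_{m+k,m+k}$. For $A=L_{\mathbb{Z}}(E)$ and $D=\mathcal{D}_{\mathbb{Z}}(E)$, classes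 are written $[p]_{\mathcal{D}}$. **The monoid $M_E$.** $M_E$ is the abelian monoid generated by the vertices $v\in E^0$ and symbols $q_S$, where $S$ runs through all nonempty finite subsets of $vE^1$ for infinite emitters $v$, subject to the relations: (i) $v=\sum_{e\in vE^1}r(e)$ for all regular $v$; (ii) $v=\sum_{e\in S}r(e)+q_S$ for every infinite emitter $v$ and nonempty finite $S\subseteq vE^1$; (iii) $q_{S_1}=q_{S_2}+\sum_{e\in S_2\setminus S_1}r(e)$ for all nonempty finite subsets $S_1\subseteq S_2\subseteq vE^1$, $v$ an infinite emitter. **The monoid $\mathcal{V}(L_{\mathsf{k}}(E))$ and $\iota_E$.** $\mathcal{V}(B)$ is the abelian monoid of Murray–von Neumann equivalence classes $[p]$ of idempotents in $\mathsf{M}_{\mathbb{N}}(B)$ ($p\sim q$ iff $p=uv$, $q=vu$ for some $u,v\in\mathsf{M}_{\mathbb{N}}(B)$) with orthogonal sum. $\iota_E:L_{\mathbb{Z}}(E)\to L_{\mathsf{k}}(E)$ is the canonical ring homomorphism that is the identity on $E^0$ and $E^1$ (and $e^*\mapsto e^*$), applied entrywise to matrices. *)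

(* Defs.v *)
From HB Require Import structures.
From mathcomp Require Import all_boot all_order all_algebra finmap.
From mathcomp Require Import boolp classical_sets functions cardinality fsbigop.

Set Implicit Arguments.
Unset Strict Implicit.
Unset Printing Implicit Defensive.

Import GRing.Theory.
Local Open Scope classical_set_scope.
Local Open Scope ring_scope.

Reserved Notation "x ** y" (at level 40, left associativity).
Reserved Notation "a '\otimes' 'e_(' i , j )" (at level 35, i, j at level 99,
  format "a  '\otimes'  'e_(' i ,  j )").

Record equivalence_Prop (T : Type) (e : T -> T -> Prop) : Prop := EquivalenceProp {
  eqp_refl : forall x, e x x;
  eqp_sym : forall x y, e x y -> e y x;
  eqp_trans : forall x y z, e x y -> e y z -> e x z
}.

Section Quotient.
Local Open Scope quotient_scope.
Variables (T : Type) (e : T -> T -> Prop) (eP : equivalence_Prop e).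

Definition quot_rel : rel {classic T} := fun x y => `[< e x y >].

Lemma quot_rel_equiv : equiv_class_of quot_rel.
Proof.
split.
- by move=> x; apply/asboolP/(eqp_refl eP).
- by move=> x y; apply/asboolP/asboolP; apply: (eqp_sym eP).
- by move=> y x z /asboolP xy /asboolP yz; apply/asboolP/(eqp_trans eP xy yz).
Qed.

Definition quot_equiv : equiv_rel {classic T} := EquivRelPack quot_rel_equiv.

Definition quot : Type := {eq_quot quot_equiv}.
HB.instance Definition _ := Choice.copy quot {eq_quot quot_equiv}.

Definition qclass (x : T) : quot := \pi_({eq_quot quot_equiv}) (x : {classic T}).
Definition qrepr (q : quot) : T := repr (q : {eq_quot quot_equiv}).

Lemma qreprK q : qclass (qrepr q) = q.
Proof. exact: (reprK (q : {eq_quot quot_equiv})). Qed.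

Lemma qclassP x y : qclass x = qclass y <-> e x y.
Proof.
split; first by move/(@eqmodP _ quot_equiv) => /asboolP.
by move=> exy; apply/(@eqmodP _ quot_equiv)/asboolP.
Qed.

Lemma qrepr_class x : e (qrepr (qclass x)) x.
Proof. by apply/qclassP; rewrite qreprK. Qed.

Lemma quotW (P : quot -> Prop) : (forall x, P (qclass x)) -> forall q, P q.
Proof. by move=> h q; rewrite -(qreprK q); apply: h. Qed.

End Quotient.

HB.mixin Record Zmodule_isNonUnitalRing A of GRing.Zmodule A := {
  numul : A -> A -> A;
  numulA : associative numul;
  numulDl : left_distributive numul +%R;
  numulDr : right_distributive numul +%R
}.

#[short(type="nonUnitalRingType")]
HB.structure Definition NonUnitalRing :=
  { A of GRing.Zmodule A & Zmodule_isNonUnitalRing A }.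

Notation "x ** y" := (numul x y) : ring_scope.

HB.mixin Record NonUnitalRing_isStarRing A of NonUnitalRing A := {
  star : A -> A;
  starK : involutive star;
  starD : {morph star : x y / x + y};
  starM : forall x y, star (x ** y) = star y ** star x
}.

#[short(type="starRingType")]
HB.structure Definition StarRing :=
  { A of NonUnitalRing A & NonUnitalRing_isStarRing A }.

Section NonUnitalTheory.
Variable A : nonUnitalRingType.
Implicit Types x y : A.

Lemma numul0r x : 0 ** x = 0.
Proof. by apply: (addrI (0 ** x)); rewrite -numulDl !addr0. Qed.
Lemma numulr0 x : x ** 0 = 0.
Proof. by apply: (addrI (x ** 0)); rewrite -numulDr !addr0. Qed.
Lemma numulNr x y : (- x) ** y = - (x ** y).
Proof. by apply: (addrI (x ** y)); rewrite -numulDl !subrr numul0r. Qed.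
Lemma numulrN x y : x ** (- y) = - (x ** y).
Proof. by apply: (addrI (x ** y)); rewrite -numulDr !subrr numulr0. Qed.
Lemma numul_suml I (r : seq I) P (F : I -> A) x :
  (\sum_(i <- r | P i) F i) ** x = \sum_(i <- r | P i) F i ** x.
Proof. by apply: (big_morph (fun y => y ** x)) => [y z|]; rewrite ?numulDl ?numul0r. Qed.
Lemma numul_sumr I (r : seq I) P (F : I -> A) x :
  x ** (\sum_(i <- r | P i) F i) = \sum_(i <- r | P i) x ** F i.
Proof. by apply: (big_morph (numul x)) => [y z|]; rewrite ?numulDr ?numulr0. Qed.

End NonUnitalTheory.

Section StarTheory.
Variable A : starRingType.
Implicit Types x y : A.

Lemma star0 : star 0 = 0 :> A.
Proof. by apply: (addrI (star 0)); rewrite -starD !addr0. Qed.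
Lemma starN x : star (- x) = - star x.
Proof. by apply: (addrI (star x)); rewrite -starD !subrr star0. Qed.
Lemma star_sum I (r : seq I) P (F : I -> A) :
  star (\sum_(i <- r | P i) F i) = \sum_(i <- r | P i) star (F i).
Proof. by apply: (big_morph star) => [y z|]; rewrite ?starD ?star0. Qed.

End StarTheory.

Definition is_projection (A : starRingType) (p : A) := star p = p /\ p ** p = p.
Definition is_idempotent (A : nonUnitalRingType) (p : A) := p ** p = p.

Record starSubring (A : starRingType) := StarSubring {
  starSubring_set :> A -> Prop;
  ssub0 : starSubring_set 0;
  ssubB : forall x y, starSubring_set x -> starSubring_set y -> starSubring_set (x - y);
  ssubM : forall x y, starSubring_set x -> starSubring_set y -> starSubring_set (x ** y);
  ssub_star : forall x, starSubring_set x -> starSubring_set (star x)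
}.

Lemma ssubD (A : starRingType) (D : starSubring A) x y : D x -> D y -> D (x + y).
Proof.
move=> Dx Dy; rewrite -[y]opprK -[- y]sub0r.
by do !apply: ssubB => //; apply: ssub0.
Qed.

(* Rows and columns are numbered from 0, so e_{1,1} in 1-based indexing is [e_(0, 0)]. *)
Record finmx (A : zmodType) := FinMx {
  finmx_fun :> nat -> nat -> A;
  finmxP : exists n, forall i j, (n <= i)%N || (n <= j)%N -> finmx_fun i j = 0
}.
HB.instance Definition _ (A : zmodType) := gen_eqMixin (finmx A).
HB.instance Definition _ (A : zmodType) := gen_choiceMixin (finmx A).

Section FinMxZmod.
Variable A : zmodType.
Implicit Types a b c : finmx A.

Lemma finmx_eq a b : (forall i j, a i j = b i j) -> a = b.
Proof.
case: a b => [a aP] [b bP] /= ab.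
have eab : a = b by apply/funext => i; apply/funext => j.
by subst b; congr FinMx; apply: Prop_irrelevance.
Qed.

Definition bounded_by (m : nat) (a : finmx A) :=
  forall i j, (m <= i)%N || (m <= j)%N -> a i j = 0.

Lemma bounded_byW m n a : (m <= n)%N -> bounded_by m a -> bounded_by n a.
Proof.
move=> mn am i j /orP[] h; apply: am; apply/orP; [left|right]; exact: leq_trans h.
Qed.

Lemma bounded2 a b : exists n, bounded_by n a /\ bounded_by n b.
Proof.
have [n an] := finmxP a; have [m bm] := finmxP b; exists (maxn n m).
by split; [apply: bounded_byW an; rewrite leq_maxl|apply: bounded_byW bm; rewrite leq_maxr].
Qed.

Definition finmx_bound a : nat := sval (cid (finmxP a)).
Lemma finmx_boundP a : bounded_by (finmx_bound a) a.
Proof. exact: (svalP (cid (finmxP a))). Qed.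

Lemma finmx0_subproof : exists n, forall i j : nat, (n <= i)%N || (n <= j)%N -> 0 = 0 :> A.
Proof. by exists 0%N. Qed.
Definition finmx0 : finmx A := FinMx finmx0_subproof.

Lemma finmxN_subproof a :
  exists n, forall i j, (n <= i)%N || (n <= j)%N -> - a i j = 0.
Proof. by have [n an] := finmxP a; exists n => i j /an ->; rewrite oppr0. Qed.
Definition finmxN a : finmx A := FinMx (finmxN_subproof a).

Lemma finmxD_subproof a b :
  exists n, forall i j, (n <= i)%N || (n <= j)%N -> a i j + b i j = 0.
Proof.
have [n [an bn]] := bounded2 a b.
by exists n => i j ij; rewrite an// bn// addr0.
Qed.
Definition finmxD a b : finmx A := FinMx (finmxD_subproof a b).

Lemma finmxDA : associative finmxD.
Proof. by move=> a b c; apply: finmx_eq => i j /=; rewrite addrA. Qed.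
Lemma finmxDC : commutative finmxD.
Proof. by move=> a b; apply: finmx_eq => i j /=; rewrite addrC. Qed.
Lemma finmx0D : left_id finmx0 finmxD.
Proof. by move=> a; apply: finmx_eq => i j /=; rewrite add0r. Qed.
Lemma finmxND : left_inverse finmx0 finmxN finmxD.
Proof. by move=> a; apply: finmx_eq => i j /=; rewrite addNr. Qed.

HB.instance Definition _ := GRing.isZmodule.Build (finmx A) finmxDA finmxDC finmx0D finmxND.

Lemma finmxDE a b i j : (a + b) i j = a i j + b i j. Proof. by []. Qed.
Lemma finmxNE a i j : (- a) i j = - a i j. Proof. by []. Qed.
Lemma finmx0E i j : (0 : finmx A) i j = 0. Proof. by []. Qed.

Lemma tens_subproof (x : A) (i j : nat) :
  exists n, forall k l, (n <= k)%N || (n <= l)%N ->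
    (if (k == i) && (l == j) then x else 0) = 0.
Proof.
exists (maxn i j).+1 => k l; case: andP => // -[/eqP-> /eqP->].
by rewrite !ltnNge leq_maxl leq_maxr.
Qed.
Definition tens (x : A) (i j : nat) : finmx A := FinMx (tens_subproof x i j).

(* [shr k] and [shc k] push a matrix [k] rows down, resp. [k] columns right;
   [ur k] and [uc k] delete the first [k] rows, resp. columns. *)
Lemma shr_subproof k a : exists n, forall i j, (n <= i)%N || (n <= j)%N ->
  (if (k <= i)%N then a (i - k)%N j else 0) = 0.
Proof.
have [n an] := finmxP a; exists (k + n)%N => i j ij.
case: ifP => // ki; apply: an; case/orP: ij => ij; apply/orP; [left|right].
  by rewrite leq_subRL.
exact: leq_trans (leq_addl _ _) ij.
Qed.
Definition shr k a : finmx A := FinMx (shr_subproof k a).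

Lemma shc_subproof k a : exists n, forall i j, (n <= i)%N || (n <= j)%N ->
  (if (k <= j)%N then a i (j - k)%N else 0) = 0.
Proof.
have [n an] := finmxP a; exists (k + n)%N => i j ij.
case: ifP => // ki; apply: an; case/orP: ij => ij; apply/orP; [left|right].
  exact: leq_trans (leq_addl _ _) ij.
by rewrite leq_subRL.
Qed.
Definition shc k a : finmx A := FinMx (shc_subproof k a).

Lemma ur_subproof k a : exists n, forall i j, (n <= i)%N || (n <= j)%N -> a (k + i)%N j = 0.
Proof.
have [n an] := finmxP a; exists n => i j ij; apply: an.
by case/orP: ij => ij; apply/orP; [left; apply: leq_trans (leq_addl _ _)|right].
Qed.
Definition ur k a : finmx A := FinMx (ur_subproof k a).

Lemma uc_subproof k a : exists n, forall i j, (n <= i)%N || (n <= j)%N -> a i (k + j)%N = 0.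
Proof.
have [n an] := finmxP a; exists n => i j ij; apply: an.
by case/orP: ij => ij; apply/orP; [left|right; apply: leq_trans (leq_addl _ _)].
Qed.
Definition uc k a : finmx A := FinMx (uc_subproof k a).

Definition block_sum (m n : nat) a b : finmx A := a + shr m (shc n b).

(* The orthogonal sum p (+) q, meant for [p] bounded by [m]: [q] is moved to the
   diagonal positions m, m+1, ... *)
Definition osum (m : nat) (p q : finmx A) : finmx A := block_sum m m p q.

Lemma tensE x i j k l : tens x i j k l = if (k == i) && (l == j) then x else 0.
Proof. by []. Qed.
Lemma shrE k a i j : shr k a i j = if (k <= i)%N then a (i - k)%N j else 0.
Proof. by []. Qed.
Lemma shcE k a i j : shc k a i j = if (k <= j)%N then a i (j - k)%N else 0.
Proof. by []. Qed.
Lemma urE k a i j : ur k a i j = a (k + i)%N j. Proof. by []. Qed.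
Lemma ucE k a i j : uc k a i j = a i (k + j)%N. Proof. by []. Qed.

Lemma shrD k : {morph shr k : a b / a + b}.
Proof. by move=> a b; apply: finmx_eq => i j /=; case: ifP; rewrite ?addr0. Qed.
Lemma shcD k : {morph shc k : a b / a + b}.
Proof. by move=> a b; apply: finmx_eq => i j /=; case: ifP; rewrite ?addr0. Qed.
Lemma shr0 a : shr 0 a = a.
Proof. by apply: finmx_eq => i j /=; rewrite subn0. Qed.
Lemma shc0 a : shc 0 a = a.
Proof. by apply: finmx_eq => i j /=; rewrite subn0. Qed.
Lemma shr_shr k l a : shr k (shr l a) = shr (k + l) a.
Proof.
apply: finmx_eq => i j /=; case: (leqP k i) => ki.
  by rewrite leq_subRL// subnDA.
by rewrite ifF//; apply/negbTE; rewrite -ltnNge (leq_trans ki)// leq_addr.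
Qed.
Lemma shc_shc k l a : shc k (shc l a) = shc (k + l) a.
Proof.
apply: finmx_eq => i j /=; case: (leqP k j) => ki.
  by rewrite leq_subRL// subnDA.
by rewrite ifF//; apply/negbTE; rewrite -ltnNge (leq_trans ki)// leq_addr.
Qed.
Lemma shrc k l a : shr k (shc l a) = shc l (shr k a).
Proof. by apply: finmx_eq => i j /=; case: ifP; case: ifP. Qed.
Lemma ur_shr k a : ur k (shr k a) = a.
Proof. by apply: finmx_eq => i j /=; rewrite leq_addr addKn. Qed.
Lemma uc_shc k a : uc k (shc k a) = a.
Proof. by apply: finmx_eq => i j /=; rewrite leq_addr addKn. Qed.
Lemma ur_shc k l a : ur k (shc l a) = shc l (ur k a).
Proof. by apply: finmx_eq. Qed.
Lemma uc_shr k l a : uc k (shr l a) = shr l (uc k a).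
Proof. by apply: finmx_eq. Qed.
Lemma shr_0 k : shr k 0 = 0.
Proof. by apply: finmx_eq => i j /=; case: ifP. Qed.
Lemma shc_0 k : shc k 0 = 0.
Proof. by apply: finmx_eq => i j /=; case: ifP. Qed.
Lemma bounded_ur m a : bounded_by m a -> ur m a = 0.
Proof. by move=> am; apply: finmx_eq => i j /=; rewrite am// leq_addr. Qed.
Lemma bounded_uc m a : bounded_by m a -> uc m a = 0.
Proof. by move=> am; apply: finmx_eq => i j /=; rewrite am// leq_addr orbT. Qed.

Lemma bounded_osum m n a b :
  bounded_by m a -> bounded_by n b -> bounded_by (m + n) (osum m a b).
Proof.
move=> am bn i j ij; rewrite /osum /block_sum finmxDE /=.
rewrite am ?add0r; last first.
  by case/orP: ij => ij; apply/orP; [left|right]; rewrite (leq_trans _ ij)// leq_addr.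
case: (leqP m i) => // mi; case: (leqP m j) => // mj; apply: bn.
by rewrite !leq_subRL.
Qed.

Lemma osumA m n a b c : osum (m + n) (osum m a b) c = osum m a (osum n b c).
Proof.
rewrite /osum /block_sum shcD shrD addrA; congr (_ + _).
by rewrite -[shc m (shr n _)]shrc shr_shr shc_shc.
Qed.

Lemma osum0 a : osum 0 0 a = a.
Proof. by rewrite /osum /block_sum add0r shr0 shc0. Qed.

End FinMxZmod.

Arguments finmx_boundP {A} a.

Notation "a '\otimes' 'e_(' i , j )" := (tens a i j) : ring_scope.

Definition map_finmx (A B : zmodType) (f : {additive A -> B}) (a : finmx A) : finmx B :=
  FinMx (let: ex_intro n an := finmxP a in
    ex_intro (fun n => forall i j, (n <= i)%N || (n <= j)%N -> f (a i j) = 0) n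
      (fun i j ij => etrans (congr1 f (an i j ij)) (raddf0 f))).

Section FinMxRing.
Variable A : nonUnitalRingType.
Implicit Types a b c d : finmx A.

(* A finitely supported sum, since [a] has finitely many nonzero entries. *)
Definition mulfmx_fun a b (i j : nat) : A := \sum_(k \in [set: nat]) a i k ** b k j.

Lemma mulfmx_funE n a b i j :
  (forall k, (n <= k)%N -> a i k ** b k j = 0) ->
  mulfmx_fun a b i j = \sum_(k < n) a i k ** b k j.
Proof.
move=> h; rewrite /mulfmx_fun (fsbig_ord _ n (fun k => a i k ** b k j)).
apply/esym/fsbig_widen => // k [_ /= /negP]; rewrite -leqNgt; exact: h.
Qed.

Lemma mulfmx_subproof a b :
  exists n, forall i j, (n <= i)%N || (n <= j)%N -> mulfmx_fun a b i j = 0.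
Proof.
have [n [an bn]] := bounded2 a b; exists n => i j ij; rewrite (@mulfmx_funE n).
  apply: big1 => k _; case/orP: ij => ij.
    by rewrite an ?ij// numul0r.
  by rewrite [b _ _]bn ?ij ?orbT// numulr0.
by move=> k nk; rewrite an ?nk ?orbT// numul0r.
Qed.

Definition mulfmx a b : finmx A := FinMx (mulfmx_subproof a b).

Lemma mulfmxEl n a b i j : bounded_by n a -> mulfmx a b i j = \sum_(k < n) a i k ** b k j.
Proof. by move=> an; apply: mulfmx_funE => k nk; rewrite an ?nk ?orbT// numul0r. Qed.
Lemma mulfmxEr n a b i j : bounded_by n b -> mulfmx a b i j = \sum_(k < n) a i k ** b k j.
Proof. by move=> bn; apply: mulfmx_funE => k nk; rewrite bn ?nk// numulr0. Qed.

Lemma mulfmxA : associative mulfmx.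
Proof.
move=> a b c; have [n [an cn]] := bounded2 a c.
apply: finmx_eq => i j; rewrite (mulfmxEl _ _ _ an) (mulfmxEr _ _ _ cn).
under eq_bigr do rewrite (mulfmxEr _ _ _ cn) numul_sumr.
rewrite exchange_big; apply: eq_bigr => k _.
by rewrite (mulfmxEl _ _ _ an) numul_suml; apply: eq_bigr => l _; rewrite numulA.
Qed.

Lemma mulfmxDl : left_distributive mulfmx +%R.
Proof.
move=> a b c; have [n cn] := finmxP c.
apply: finmx_eq => i j; rewrite finmxDE !(mulfmxEr _ _ _ cn) -big_split.
by apply: eq_bigr => k _; rewrite /= -numulDl.
Qed.

Lemma mulfmxDr : right_distributive mulfmx +%R.
Proof.
move=> c a b; have [n cn] := finmxP c.
apply: finmx_eq => i j; rewrite finmxDE !(mulfmxEl _ _ _ cn) -big_split.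
by apply: eq_bigr => k _; rewrite /= -numulDr.
Qed.

HB.instance Definition _ :=
  Zmodule_isNonUnitalRing.Build (finmx A) mulfmxA mulfmxDl mulfmxDr.

Lemma fmxMEl n a b i j : bounded_by n a -> (a ** b) i j = \sum_(k < n) a i k ** b k j.
Proof. exact: mulfmxEl. Qed.
Lemma fmxMEr n a b i j : bounded_by n b -> (a ** b) i j = \sum_(k < n) a i k ** b k j.
Proof. exact: mulfmxEr. Qed.

Lemma tensM (x y : A) i j k : x \otimes e_(i, j) ** y \otimes e_(j, k) = (x ** y) \otimes e_(i, k).
Proof.
apply: finmx_eq => r s; have [n xn] := finmxP (x \otimes e_(i, j)).
have {}xn : bounded_by (maxn n j.+1) (x \otimes e_(i, j)).
  by apply: bounded_byW xn; rewrite leq_maxl.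
have jn : (j < maxn n j.+1)%N by rewrite leq_maxr.
rewrite (fmxMEl _ _ _ xn) (bigD1 (Ordinal jn)) //= !eqxx !andbT /=.
rewrite big1 ?addr0 => [|l]; last first.
  by rewrite -val_eqE /= => /negbTE ->; rewrite andbF numul0r.
by case: eqP; case: eqP; rewrite ?numulr0 ?numul0r.
Qed.

Lemma shr_mul k a b : shr k a ** b = shr k (a ** b).
Proof.
have [n bn] := finmxP b; apply: finmx_eq => i j.
rewrite shrE !(fmxMEr _ _ _ bn); under eq_bigr do rewrite shrE.
by case: ifP => // ki; apply: big1 => l _; rewrite numul0r.
Qed.

Lemma mul_shc k a b : a ** shc k b = shc k (a ** b).
Proof.
have [n an] := finmxP a; apply: finmx_eq => i j.
rewrite shcE !(fmxMEl _ _ _ an); under eq_bigr do rewrite shcE.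
by case: ifP => // ki; apply: big1 => l _; rewrite numulr0.
Qed.

Lemma shc_mul k a b : shc k a ** b = a ** ur k b.
Proof.
have [n [an kan]] : exists n, bounded_by n a /\ bounded_by (k + n) (shc k a).
  have [n an] := finmxP a; exists n; split=> // i j ij; rewrite shcE.
  case: ifP => // ki; apply: an; case/orP: ij => ij; apply/orP; [left|right].
    exact: leq_trans (leq_addl _ _) ij.
  by rewrite leq_subRL.
apply: finmx_eq => i j; rewrite (fmxMEl _ _ _ an) (fmxMEl _ _ _ kan).
rewrite big_split_ord /= big1 ?add0r => [|l _].
  by apply: eq_bigr => l _; rewrite /= leq_addr addKn.
by rewrite /= leqNgt ltn_ord numul0r.
Qed.

Lemma mul_shr k a b : a ** shr k b = uc k a ** b.
Proof.
have [n [an kan]] : exists n, bounded_by n b /\ bounded_by (k + n) (shr k b).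
  have [n bn] := finmxP b; exists n; split=> // i j ij; rewrite shrE.
  case: ifP => // ki; apply: bn; case/orP: ij => ij; apply/orP; [left|right].
    by rewrite leq_subRL.
  exact: leq_trans (leq_addl _ _) ij.
apply: finmx_eq => i j; rewrite (fmxMEr _ _ _ an) (fmxMEr _ _ _ kan).
rewrite big_split_ord /= big1 ?add0r => [|l _].
  by apply: eq_bigr => l _; rewrite /= leq_addr addKn.
by rewrite /= leqNgt ltn_ord numulr0.
Qed.

Lemma uc_mul k a b : uc k (a ** b) = a ** uc k b.
Proof.
have [n an] := finmxP a; apply: finmx_eq => i j.
by rewrite ucE !(fmxMEl _ _ _ an).
Qed.

Lemma ur_mul k a b : ur k (a ** b) = ur k a ** b.
Proof.
have [n bn] := finmxP b; apply: finmx_eq => i j.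
by rewrite urE !(fmxMEr _ _ _ bn).
Qed.

Lemma block_sumM l m n a b a' b' : uc m a = 0 -> ur m a' = 0 ->
  block_sum l m a b ** block_sum m n a' b' = block_sum l n (a ** a') (b ** b').
Proof.
move=> am am'; rewrite /block_sum numulDl !numulDr.
rewrite mul_shr am numul0r addr0 !shr_mul shc_mul am' numulr0 shr_0 add0r.
by rewrite shc_mul ur_shr mul_shc.
Qed.

(* The matrix exchanging the two summands of [osum m p q] and [osum n q p]. *)
Definition swap_mx (m n : nat) p q : finmx A := shr n p + shc m q.

Lemma swap_mxM m n p q : bounded_by m p -> bounded_by n q ->
  (shc n p + shr m q) ** swap_mx m n p q = osum m (p ** p) (q ** q).
Proof.
move=> pm qn; rewrite /swap_mx numulDl !numulDr.
rewrite !shc_mul ur_shr ur_shc (bounded_ur qn) shc_0 numulr0 addr0.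
by rewrite mul_shr uc_shr (bounded_uc qn) shr_0 numul0r add0r shr_mul mul_shc.
Qed.

Lemma swap_mxMV m n p q : bounded_by m p -> bounded_by n q ->
  swap_mx m n p q ** (shc n p + shr m q) = osum n (q ** q) (p ** p).
Proof.
by move=> pm qn; rewrite /swap_mx [shr n p + _]addrC [shc n p + _]addrC (swap_mxM qn pm).
Qed.

Lemma idem_osum m p q : bounded_by m p -> is_idempotent p -> is_idempotent q ->
  is_idempotent (osum m p q).
Proof.
move=> pm pp qq; rewrite /is_idempotent /osum block_sumM ?bounded_uc ?bounded_ur//.
by rewrite pp qq.
Qed.

End FinMxRing.

Section FinMxStar.
Variable A : starRingType.
Implicit Types a b d : finmx A.

Lemma starfmx_subproof a : exists n, forall i j, (n <= i)%N || (n <= j)%N -> star (a j i) = 0.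
Proof. by have [n an] := finmxP a; exists n => i j; rewrite orbC => /an ->; rewrite star0. Qed.
Definition starfmx a : finmx A := FinMx (starfmx_subproof a).

Lemma starfmxK : involutive starfmx.
Proof. by move=> a; apply: finmx_eq => i j /=; rewrite starK. Qed.
Lemma starfmxD : {morph starfmx : a b / a + b}.
Proof. by move=> a b; apply: finmx_eq => i j /=; rewrite starD. Qed.
Lemma starfmxM a b : starfmx (a ** b) = starfmx b ** starfmx a.
Proof.
have [n an] := finmxP a; have an' : bounded_by n (starfmx a).
  by move=> i j /=; rewrite orbC => /an ->; rewrite star0.
apply: finmx_eq => i j; rewrite (fmxMEr _ _ _ an').
rewrite [LHS](_ : _ = star ((a ** b) j i)) // (fmxMEl _ _ _ an).
by rewrite star_sum; apply: eq_bigr => k _; rewrite starM.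
Qed.

HB.instance Definition _ :=
  NonUnitalRing_isStarRing.Build (finmx A) starfmxK starfmxD starfmxM.

Lemma star_shr k a : star (shr k a) = shc k (star a).
Proof. by apply: finmx_eq => i j /=; case: ifP; rewrite ?star0. Qed.
Lemma star_shc k a : star (shc k a) = shr k (star a).
Proof. by apply: finmx_eq => i j /=; case: ifP; rewrite ?star0. Qed.
Lemma star_block_sum m n a b : star (block_sum m n a b) = block_sum n m (star a) (star b).
Proof. by rewrite /block_sum starD star_shr star_shc shrc. Qed.
Lemma star_tens (x : A) i j : star (x \otimes e_(i, j)) = (star x) \otimes e_(j, i).
Proof. by apply: finmx_eq => k l /=; rewrite andbC; case: ifP; rewrite ?star0. Qed.
Lemma star_uc k a : star (uc k a) = ur k (star a).
Proof. by apply: finmx_eq. Qed.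

End FinMxStar.

Section Vstar.
Variables (A : starRingType) (D : starSubring A).
Implicit Types a b d p q v w : finmx A.

Definition diagD_set : set (finmx A) :=
  [set a | (forall i j : nat, i != j -> a i j = 0) /\ forall i : nat, D (a i i)].

Lemma diag_mulE a b i j : (forall i j : nat, i != j -> a i j = 0) -> (a ** b) i j = a i i ** b i j.
Proof.
move=> da; have [n an] := finmxP a.
rewrite (@fmxMEl _ (maxn n i.+1)); last by apply: bounded_byW an; rewrite leq_maxl.
have ni : (i < maxn n i.+1)%N by rewrite leq_maxr.
rewrite (bigD1 (Ordinal ni)) //= big1 ?addr0// => k.
by rewrite -val_eqE /= eq_sym => /da ->; rewrite numul0r.
Qed.

Lemma diagD_mul a b : diagD_set a -> diagD_set b -> diagD_set (a ** b).
Proof.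
move=> [da Da] [db Db]; split=> [i j ij|i]; rewrite diag_mulE//.
  by rewrite db// numulr0.
exact: ssubM.
Qed.

Lemma diagD_0 : diagD_set 0.
Proof. by split=> // i; apply: ssub0. Qed.
Lemma diagD_B a b : diagD_set a -> diagD_set b -> diagD_set (a - b).
Proof.
move=> [da Da] [db Db]; split=> [i j ij|i]; rewrite finmxDE finmxNE.
  by rewrite da// db// subrr.
exact: ssubB.
Qed.
Lemma diagD_star a : diagD_set a -> diagD_set (star a).
Proof.
move=> [da Da]; split=> [i j ij|i] /=; last exact: ssub_star.
by rewrite da ?star0// eq_sym.
Qed.

Definition diagD : starSubring (finmx A) :=
  StarSubring diagD_0 diagD_B diagD_mul diagD_star.

Definition Vstar_sim p q : Prop := exists v,
  [/\ forall d, diagD d -> diagD (v ** d ** star v),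
      forall d, diagD d -> diagD (star v ** d ** v),
      star v ** v = p & v ** star v = q].

Record dproj := DProj {
  dproj_mx :> finmx A;
  dproj_diag : diagD dproj_mx;
  dproj_proj : is_projection dproj_mx
}.

Lemma Vstar_sim_equiv : equivalence_Prop (fun p q : dproj => Vstar_sim p q).
Proof.
split.
- case=> p Dp [sp pp] /=; exists p; rewrite sp pp; split=> // d Dd;
    by apply: ssubM => //; apply: ssubM.
- by move=> p q [v [h1 h2 h3 h4]]; exists (star v); rewrite starK.
- case=> p Dp [sp pp] [q Dq [sq qq]] [r Dr [sr rr]] /=.
  move=> [v [v1 v2 v3 v4]] [w [w1 w2 w3 w4]]; exists (w ** v); rewrite starM; split.
  + move=> d /v1/w1; by rewrite !numulA.
  + move=> d /w2/v2; by rewrite !numulA.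
  + by rewrite numulA -(numulA (star v)) w3 -v4 numulA v3 -numulA v3.
  + by rewrite numulA -(numulA w) v4 -w3 numulA w4 -numulA w4.
Qed.

Definition Vstar : Type := quot Vstar_sim_equiv.
HB.instance Definition _ := Choice.copy Vstar (quot Vstar_sim_equiv).

Definition Vstar_class (p : dproj) : Vstar := qclass Vstar_sim_equiv p.

Lemma diagD_sh m a : diagD a -> diagD (shr m (shc m a)).
Proof.
case=> da Da; split=> [i j ij|i] /=; last first.
  by case: ifP => mi; [rewrite mi; apply: Da|apply: ssub0].
case: ifP => // mi; case: ifP => // mj; apply: da.
by apply: contra ij => /eqP h; rewrite -(subnK mi) h subnK.
Qed.

Lemma diagD_u m a : diagD a -> diagD (uc m (ur m a)).
Proof. by case=> da Da; split=> [i j ij|i] /=; [apply: da; rewrite eqn_add2l|]. Qed.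

Lemma diagD_osum m a b : diagD a -> diagD b -> diagD (osum m a b).
Proof. by move=> Da Db; apply: ssubD => //; apply: diagD_sh. Qed.

Lemma proj_osum m p q : bounded_by m p -> is_projection p -> is_projection q ->
  is_projection (osum m p q).
Proof.
move=> pm [sp pp] [sq qq]; split; first by rewrite star_block_sum sp sq.
exact: idem_osum.
Qed.

Definition dproj_osum m (p q : dproj) (pm : bounded_by m p) : dproj :=
  DProj (diagD_osum m (dproj_diag p) (dproj_diag q))
        (proj_osum pm (dproj_proj p) (dproj_proj q)).

Lemma uc_diag m v d : diagD d -> uc m v = 0 -> uc m (v ** d) = 0.
Proof.
move=> [dd _] vm; rewrite uc_mul; apply: finmx_eq => i j.
have [n vn] := finmxP v; rewrite (fmxMEl _ _ _ vn) big1 // => k _ /=.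
have [kmj|kmj] := eqVneq (k : nat) (m + j)%N; last by rewrite dd ?numulr0.
by have /(congr1 (fun a : finmx A => a i j)) /= := vm; rewrite -kmj => ->; rewrite numul0r.
Qed.

Lemma block_conj m m' v w d : diagD d -> uc m v = 0 ->
  diagD (v ** d ** star v) ->
  diagD (w ** uc m (ur m d) ** star w) ->
  diagD (block_sum m' m v w ** d ** star (block_sum m' m v w)).
Proof.
move=> Dd vm Dv Dw; rewrite star_block_sum /block_sum numulDl.
have e1 : v ** d ** (star v + shr m (shc m' (star w))) = v ** d ** star v.
  by rewrite numulDr mul_shr uc_diag// numul0r addr0.
have e2 : shr m' (shc m w) ** d ** (star v + shr m (shc m' (star w))) =
   shr m' (shc m' (w ** uc m (ur m d) ** star w)).
  rewrite !shr_mul shc_mul numulDr mul_shr uc_mul mul_shc; congr shr.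
  rewrite -numulA -ur_mul; set x := ur m (d ** star v).
  suff -> : x = 0 by rewrite numulr0 add0r.
  rewrite /x -[d ** _]starK starM starK -star_uc uc_diag ?star0//.
  exact: ssub_star.
by rewrite numulDl e1 e2; apply: ssubD => //; apply: diagD_sh.
Qed.

Lemma Vstar_osum_sim m m' (p q p' q' : dproj) (pm : bounded_by m p) (pm' : bounded_by m' p') :
  Vstar_sim p p' -> Vstar_sim q q' ->
  Vstar_sim (osum m p q) (osum m' p' q').
Proof.
move: p p' q q' pm pm' => [p Dp [sp pp]] [p' Dp' [sp' pp']] [q Dq _] [q' Dq' _] /= pm pm'.
move=> [v [v1 v2 v3 v4]] [w [w1 w2 w3 w4]].
pose u := p' ** v ** p.
have su : star u = p ** star v ** p' by rewrite /u !starM sp sp' numulA.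
have e3 : star v ** p' ** v = p by rewrite -v4 numulA v3 -numulA v3.
have e4 : v ** p ** star v = p' by rewrite -v3 numulA v4 -numulA v4.
have u3 : star u ** u = p.
  rewrite su /u !numulA -(numulA _ p' p') pp'.
  by rewrite -(numulA p (star v)) -(numulA p _ v) e3 !pp.
have u4 : u ** star u = p'.
  rewrite su /u !numulA -(numulA _ p p) pp.
  by rewrite -(numulA p' v) -(numulA p' _ (star v)) e4 !pp'.
have um : uc m u = 0 by rewrite /u uc_mul (bounded_uc pm) numulr0.
have um' : ur m' u = 0 by rewrite /u -numulA ur_mul (bounded_ur pm') numul0r.
have usm : ur m (star u) = 0 by rewrite -star_uc um star0.
have usm' : uc m' (star u) = 0 by rewrite -[uc _ _]starK star_uc starK um' star0.
have u1 d : diagD d -> diagD (u ** d ** star u).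
  move=> Dd; have -> : u ** d ** star u = p' ** (v ** (p ** d ** p) ** star v) ** p'.
    by rewrite su /u !numulA.
  apply: (ssubM _ Dp'); apply: (ssubM Dp'); apply: v1; exact: (ssubM (ssubM Dp Dd) Dp).
have u2 d : diagD d -> diagD (star u ** d ** u).
  move=> Dd; have -> : star u ** d ** u = p ** (star v ** (p' ** d ** p') ** v) ** p.
    by rewrite su /u !numulA.
  apply: (ssubM _ Dp); apply: (ssubM Dp); apply: v2; exact: (ssubM (ssubM Dp' Dd) Dp').
exists (block_sum m' m u w); split.
- move=> d Dd; apply: block_conj => //; first exact: u1.
  by apply: w1; apply: diagD_u.
- move=> d Dd; rewrite -{2}[block_sum m' m u w]starK star_block_sum.
  apply: block_conj => //; rewrite starK; first exact: u2.
  by apply: w2; apply: diagD_u.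
- by rewrite star_block_sum block_sumM// u3 w3.
- by rewrite star_block_sum block_sumM// u4 w4.
Qed.

Lemma swap_conj m n p q d : diagD d -> diagD p -> diagD q ->
  bounded_by m p -> bounded_by n q ->
  diagD (swap_mx m n p q ** d ** (shc n p + shr m q)).
Proof.
move=> Dd Dp Dq pm qn; rewrite /swap_mx !(numulDl, numulDr).
rewrite !shr_mul !mul_shc.
have -> : p ** d ** shr m q = 0 by rewrite mul_shr uc_diag ?bounded_uc// numul0r.
have -> : shc m q ** d ** p = 0.
  rewrite -numulA shc_mul; suff -> : ur m (d ** p) = 0 by rewrite numulr0.
  rewrite -[d ** p]starK starM -star_uc uc_diag ?star0//; first exact: ssub_star.
  rewrite -[uc _ _]starK star_uc starK bounded_ur ?star0//.
rewrite shc_0 shr_0 add0r addr0 shc_mul mul_shr uc_mul.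
apply: ssubD; first by apply: diagD_sh; exact: (ssubM (ssubM Dp Dd) Dp).
exact: (ssubM (ssubM Dq (diagD_u m Dd)) Dq).
Qed.

Lemma Vstar_osumC_sim m n (p q : dproj) : bounded_by m p -> bounded_by n q ->
  Vstar_sim (osum m p q) (osum n q p).
Proof.
move: p q => [p Dp [sp pp]] [q Dq [sq qq]] /= pm qn; exists (swap_mx m n p q).
have ss : star (swap_mx m n p q) = shc n p + shr m q.
  by rewrite /swap_mx starD star_shr star_shc sp sq.
split; rewrite ?ss.
- by move=> d Dd; apply: swap_conj.
- move=> d Dd; rewrite /swap_mx [shr n p + _]addrC [shc n p + _]addrC.
  exact: (swap_conj Dd Dq Dp qn pm).
- by rewrite swap_mxM// pp qq.
- by rewrite swap_mxMV// pp qq.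
Qed.

Lemma diagD_proj0 : is_projection (0 : finmx A).
Proof. by split; rewrite ?star0 ?numulr0. Qed.
Definition dproj0 : dproj := DProj diagD_0 diagD_proj0.

Definition Vstar_zero : Vstar := Vstar_class dproj0.
(* [finmx_bound p] is one arbitrary bound for [p]; by [Vstar_classD] below, every
   bound and all representatives give the same sum. *)
Definition Vstar_add (x y : Vstar) : Vstar :=
  let p := qrepr x in Vstar_class (dproj_osum (qrepr y) (finmx_boundP p)).

Lemma Vstar_addE m (p q : dproj) (pm : bounded_by m p) :
  Vstar_add (Vstar_class p) (Vstar_class q) = Vstar_class (dproj_osum q pm).
Proof.
apply/qclassP; apply: Vstar_osum_sim => //; first exact: finmx_boundP.
  exact: (qrepr_class Vstar_sim_equiv p).
exact: (qrepr_class Vstar_sim_equiv q).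
Qed.

Lemma dproj_eq (p q : dproj) : p = q :> finmx A -> p = q.
Proof.
case: p q => [p p1 p2] [q q1 q2] /= pq; subst q.
by congr DProj; apply: Prop_irrelevance.
Qed.

Lemma Vstar_addA : associative Vstar_add.
Proof.
elim/quotW => p; elim/quotW => q; elim/quotW => r; rewrite -!/(Vstar_class _).
rewrite (Vstar_addE r (finmx_boundP q)) (Vstar_addE _ (finmx_boundP p)).
rewrite (Vstar_addE q (finmx_boundP p)).
have pqm := bounded_osum (finmx_boundP p) (finmx_boundP q).
rewrite (@Vstar_addE _ (dproj_osum q (finmx_boundP p)) r pqm).
by congr Vstar_class; apply: dproj_eq; rewrite /= osumA.
Qed.

Lemma Vstar_addC : commutative Vstar_add.
Proof.
elim/quotW => p; elim/quotW => q; rewrite -!/(Vstar_class _).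
rewrite (Vstar_addE _ (finmx_boundP p)) (Vstar_addE _ (finmx_boundP q)).
by apply/qclassP; apply: Vstar_osumC_sim; apply: finmx_boundP.
Qed.

Lemma bounded_dproj0 : bounded_by 0 dproj0. Proof. by []. Qed.

Lemma Vstar_add0 : left_id Vstar_zero Vstar_add.
Proof.
elim/quotW => p; rewrite -!/(Vstar_class _) (Vstar_addE p bounded_dproj0).
by congr Vstar_class; apply: dproj_eq; rewrite /= osum0.
Qed.

HB.instance Definition _ := GRing.isNmodule.Build Vstar Vstar_addA Vstar_addC Vstar_add0.

Lemma Vstar_classD m (p q : dproj) (pm : bounded_by m p) :
  Vstar_class p + Vstar_class q = Vstar_class (dproj_osum q pm).
Proof. exact: Vstar_addE. Qed.

Lemma dproj11_diag (a : A) : D a -> diagD (a \otimes e_(0, 0)).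
Proof.
move=> Da; split=> [i j|i] /=; last by case: ifP => // _; apply: ssub0.
by case: i => [|i] //; case: j.
Qed.
Lemma dproj11_proj (a : A) : is_projection a -> is_projection (a \otimes e_(0, 0)).
Proof. by move=> [sa aa]; split; rewrite ?star_tens ?sa// tensM aa. Qed.
Definition dproj11 (a : A) (Da : D a) (pa : is_projection a) : dproj :=
  DProj (dproj11_diag Da) (dproj11_proj pa).

End Vstar.

Section V.
Variable B : nonUnitalRingType.
Implicit Types p q u v : finmx B.

Record idem := Idem {
  idem_mx :> finmx B;
  idemP : is_idempotent idem_mx
}.

Definition V_sim p q : Prop := exists u v, p = u ** v /\ q = v ** u.

Lemma V_sim_equiv : equivalence_Prop (fun p q : idem => V_sim p q).
Proof.
split.
- by case=> p pp; exists p, p; rewrite /= pp.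
- by move=> p q [u [v [h1 h2]]]; exists v, u.
- case=> p pp [q qq] [r rr] [u [v [/= pE qE]]] [x [y [/= qE' rE]]].
  exists (u ** x), (y ** v); split.
    by rewrite numulA -(numulA u) -qE' qE numulA -pE -numulA -pE pp.
  by rewrite numulA -(numulA y) -qE qE' numulA -rE -numulA -rE rr.
Qed.

Definition V : Type := quot V_sim_equiv.
HB.instance Definition _ := Choice.copy V (quot V_sim_equiv).

Definition V_class (p : idem) : V := qclass V_sim_equiv p.

Definition idem_sum m (p q : idem) (pm : bounded_by m p) : idem :=
  Idem (idem_osum pm (idemP p) (idemP q)).

Lemma V_osum_sim m m' (p q p' q' : idem) (pm : bounded_by m p) (pm' : bounded_by m' p') :
  V_sim p p' -> V_sim q q' -> V_sim (osum m p q) (osum m' p' q').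
Proof.
move: p p' q q' pm pm' => [p pp] [p' pp'] [q _] [q' _] /= pm pm'.
move=> [u [v [pE pE']]] [x [y [-> ->]]].
rewrite /is_idempotent in pp pp'.
exists (block_sum m m' (p ** u ** p') x), (block_sum m' m (p' ** v ** p) y).
rewrite !block_sumM; first last.
- by rewrite -numulA ur_mul (bounded_ur pm') numul0r.
- by rewrite uc_mul (bounded_uc pm') numulr0.
- by rewrite -numulA ur_mul (bounded_ur pm) numul0r.
- by rewrite uc_mul (bounded_uc pm) numulr0.
have pu : p ** u = u ** p' by rewrite pE pE' numulA.
have pv : p' ** v = v ** p by rewrite pE pE' numulA.
rewrite pu pv -!(numulA _ p' p') -!(numulA _ p p) pp pp'.
rewrite -[u ** p']pu -[v ** p]pv; split; congr block_sum.
  by rewrite -numulA [u ** _]numulA -pu !numulA pp -numulA -pE pp.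
by rewrite -numulA [v ** _]numulA -pv !numulA pp' -numulA -pE' pp'.
Qed.

Lemma V_osumC_sim m n (p q : idem) : bounded_by m p -> bounded_by n q ->
  V_sim (osum m p q) (osum n q p).
Proof.
move: p q => [p pp] [q qq] /= pm qn.
exists (shc n p + shr m q), (swap_mx m n p q).
by rewrite swap_mxM// swap_mxMV// pp qq.
Qed.

Lemma idem0P : is_idempotent (0 : finmx B). Proof. exact: numulr0. Qed.
Definition idem0 : idem := Idem idem0P.

Definition V_zero : V := V_class idem0.
Definition V_add (x y : V) : V :=
  let p := qrepr x in V_class (idem_sum (qrepr y) (finmx_boundP p)).

Lemma V_addE m (p q : idem) (pm : bounded_by m p) :
  V_add (V_class p) (V_class q) = V_class (idem_sum q pm).
Proof.
apply/qclassP; apply: V_osum_sim => //; first exact: finmx_boundP.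
  exact: (qrepr_class V_sim_equiv p).
exact: (qrepr_class V_sim_equiv q).
Qed.

Lemma idem_eq (p q : idem) : p = q :> finmx B -> p = q.
Proof.
case: p q => [p p1] [q q1] /= pq; subst q.
by congr Idem; apply: Prop_irrelevance.
Qed.

Lemma V_addA : associative V_add.
Proof.
elim/quotW => p; elim/quotW => q; elim/quotW => r; rewrite -!/(V_class _).
rewrite (V_addE r (finmx_boundP q)) (V_addE _ (finmx_boundP p)).
rewrite (V_addE q (finmx_boundP p)).
have pqm := bounded_osum (finmx_boundP p) (finmx_boundP q).
rewrite (@V_addE _ (idem_sum q (finmx_boundP p)) r pqm).
by congr V_class; apply: idem_eq; rewrite /= osumA.
Qed.

Lemma V_addC : commutative V_add.
Proof.
elim/quotW => p; elim/quotW => q; rewrite -!/(V_class _).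
rewrite (V_addE _ (finmx_boundP p)) (V_addE _ (finmx_boundP q)).
by apply/qclassP; apply: V_osumC_sim; apply: finmx_boundP.
Qed.

Lemma bounded_idem0 : bounded_by 0 idem0. Proof. by []. Qed.

Lemma V_add0 : left_id V_zero V_add.
Proof.
elim/quotW => p; rewrite -!/(V_class _) (V_addE p bounded_idem0).
by congr V_class; apply: idem_eq; rewrite /= osum0.
Qed.

HB.instance Definition _ := GRing.isNmodule.Build V V_addA V_addC V_add0.

Lemma V_classD m (p q : idem) (pm : bounded_by m p) :
  V_class p + V_class q = V_class (idem_sum q pm).
Proof. exact: V_addE. Qed.

End V.

(* Any type carries a [choiceType] structure classically (see [{classic T}]), so
   these carriers impose no restriction on the graph. *)
Record digraph := Digraph {
  vertex : choiceType;
  edge : choiceType;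
  src : edge -> vertex;
  rng : edge -> vertex
}.

Section Graph.
Variable E : digraph.

Definition out (v : vertex E) : set (edge E) := [set e | src e = v].
Definition regular (v : vertex E) := finite_set (out v) /\ out v !=set0.
Definition infinite_emitter (v : vertex E) := infinite_set (out v).

Definition emitter_subset (w : vertex E) (S : {fset edge E}) : Prop :=
  [/\ infinite_emitter w, S != fset0 & [set` S] `<=` out w].

Definition composable : rel (edge E) := fun e f => rng e == src f.

Inductive gpath :=
  | PVertex of vertex E
  | PEdges (e : edge E) (s : seq (edge E)) of path composable e s.

End Graph.

Inductive lpa_expr (R : comPzRingType) (E : digraph) :=
  | XVertex of vertex E
  | XEdge of edge E
  | XGhost of edge E
  | XZero
  | XAdd of lpa_expr R E & lpa_expr R E
  | XOpp of lpa_expr R E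
  | XMul of lpa_expr R E & lpa_expr R E
  | XScale of R & lpa_expr R E.

Arguments XVertex {R E}.
Arguments XEdge {R E}.
Arguments XGhost {R E}.
Arguments XZero {R E}.

Inductive lpa_eq (R : comPzRingType) (E : digraph) :
    lpa_expr R E -> lpa_expr R E -> Prop :=
  | lpa_refl x : lpa_eq x x
  | lpa_sym x y : lpa_eq x y -> lpa_eq y x
  | lpa_trans x y z : lpa_eq x y -> lpa_eq y z -> lpa_eq x z
  | lpa_congD x x' y y' : lpa_eq x x' -> lpa_eq y y' -> lpa_eq (XAdd x y) (XAdd x' y')
  | lpa_congN x x' : lpa_eq x x' -> lpa_eq (XOpp x) (XOpp x')
  | lpa_congM x x' y y' : lpa_eq x x' -> lpa_eq y y' -> lpa_eq (XMul x y) (XMul x' y')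
  | lpa_congZ c x x' : lpa_eq x x' -> lpa_eq (XScale c x) (XScale c x')
  | lpa_addA x y z : lpa_eq (XAdd x (XAdd y z)) (XAdd (XAdd x y) z)
  | lpa_addC x y : lpa_eq (XAdd x y) (XAdd y x)
  | lpa_add0 x : lpa_eq (XAdd XZero x) x
  | lpa_addN x : lpa_eq (XAdd (XOpp x) x) XZero
  | lpa_mulA x y z : lpa_eq (XMul x (XMul y z)) (XMul (XMul x y) z)
  | lpa_mulDl x y z : lpa_eq (XMul (XAdd x y) z) (XAdd (XMul x z) (XMul y z))
  | lpa_mulDr x y z : lpa_eq (XMul x (XAdd y z)) (XAdd (XMul x y) (XMul x z))
  | lpa_scaleA c d x : lpa_eq (XScale c (XScale d x)) (XScale (c * d) x)
  | lpa_scale1 x : lpa_eq (XScale 1 x) x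
  | lpa_scaleDr c x y : lpa_eq (XScale c (XAdd x y)) (XAdd (XScale c x) (XScale c y))
  | lpa_scaleDl c d x : lpa_eq (XScale (c + d) x) (XAdd (XScale c x) (XScale d x))
  | lpa_scaleMl c x y : lpa_eq (XScale c (XMul x y)) (XMul (XScale c x) y)
  | lpa_scaleMr c x y : lpa_eq (XScale c (XMul x y)) (XMul x (XScale c y))
  | lpa_vert_idem v : lpa_eq (XMul (XVertex v) (XVertex v)) (XVertex v)
  | lpa_vert_orth v w : v <> w -> lpa_eq (XMul (XVertex v) (XVertex w)) XZero
  | lpa_src_edge e : lpa_eq (XMul (XVertex (src e)) (XEdge e)) (XEdge e)
  | lpa_edge_rng e : lpa_eq (XMul (XEdge e) (XVertex (rng e))) (XEdge e)
  | lpa_rng_ghost e : lpa_eq (XMul (XVertex (rng e)) (XGhost e)) (XGhost e)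
  | lpa_ghost_src e : lpa_eq (XMul (XGhost e) (XVertex (src e))) (XGhost e)
  | lpa_CK1 e : lpa_eq (XMul (XGhost e) (XEdge e)) (XVertex (rng e))
  | lpa_CK1_orth e f : e <> f -> lpa_eq (XMul (XGhost e) (XEdge f)) XZero
  | lpa_CK2 v : regular v ->
      lpa_eq (XVertex v)
        (foldr (@XAdd R E) XZero [seq XMul (XEdge e) (XGhost e) | e <- fset_set (out v)]).

Section LPA.
Variables (R : comPzRingType) (E : digraph).
Notation expr := (lpa_expr R E).

Lemma lpa_equiv : equivalence_Prop (@lpa_eq R E).
Proof. by split; [apply: lpa_refl|apply: lpa_sym|apply: lpa_trans]. Qed.

Definition lpa : Type := quot lpa_equiv.
HB.instance Definition _ := Choice.copy lpa (quot lpa_equiv).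

Definition lpa_class (x : expr) : lpa := qclass lpa_equiv x.

Definition lpa_zero : lpa := lpa_class XZero.
Definition lpa_add (x y : lpa) := lpa_class (XAdd (qrepr x) (qrepr y)).
Definition lpa_opp (x : lpa) := lpa_class (XOpp (qrepr x)).
Definition lpa_mul (x y : lpa) := lpa_class (XMul (qrepr x) (qrepr y)).
Definition lpa_scale (c : R) (x : lpa) := lpa_class (XScale c (qrepr x)).

Lemma lpa_addE x y : lpa_add (lpa_class x) (lpa_class y) = lpa_class (XAdd x y).
Proof. by apply/qclassP; apply: lpa_congD; apply: (qrepr_class lpa_equiv). Qed.
Lemma lpa_oppE x : lpa_opp (lpa_class x) = lpa_class (XOpp x).
Proof. by apply/qclassP; apply: lpa_congN; apply: (qrepr_class lpa_equiv). Qed.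
Lemma lpa_mulE x y : lpa_mul (lpa_class x) (lpa_class y) = lpa_class (XMul x y).
Proof. by apply/qclassP; apply: lpa_congM; apply: (qrepr_class lpa_equiv). Qed.
Lemma lpa_scaleE c x : lpa_scale c (lpa_class x) = lpa_class (XScale c x).
Proof. by apply/qclassP; apply: lpa_congZ; apply: (qrepr_class lpa_equiv). Qed.

Lemma lpaW (P : lpa -> Prop) : (forall x, P (lpa_class x)) -> forall x, P x.
Proof. exact: quotW. Qed.

Lemma lpa_addrA : associative lpa_add.
Proof.
elim/lpaW => x; elim/lpaW => y; elim/lpaW => z.
by rewrite !lpa_addE; apply/qclassP/lpa_addA.
Qed.
Lemma lpa_addrC : commutative lpa_add.
Proof. by elim/lpaW => x; elim/lpaW => y; rewrite !lpa_addE; apply/qclassP/lpa_addC. Qed.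
Lemma lpa_add0r : left_id lpa_zero lpa_add.
Proof. by elim/lpaW => x; rewrite lpa_addE; apply/qclassP/lpa_add0. Qed.
Lemma lpa_addNr : left_inverse lpa_zero lpa_opp lpa_add.
Proof. by elim/lpaW => x; rewrite lpa_oppE lpa_addE; apply/qclassP/lpa_addN. Qed.

HB.instance Definition _ := GRing.isZmodule.Build lpa lpa_addrA lpa_addrC lpa_add0r lpa_addNr.

Lemma lpa_classD x y : lpa_class (XAdd x y) = lpa_class x + lpa_class y.
Proof. by rewrite -lpa_addE. Qed.
Lemma lpa_classN x : lpa_class (XOpp x) = - lpa_class x.
Proof. by rewrite -lpa_oppE. Qed.
Lemma lpa_class0 : lpa_class XZero = 0. Proof. by []. Qed.

Lemma lpa_mulrA : associative lpa_mul.
Proof.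
elim/lpaW => x; elim/lpaW => y; elim/lpaW => z.
by rewrite !lpa_mulE; apply/qclassP/lpa_mulA.
Qed.
Lemma lpa_mulrDl : left_distributive lpa_mul +%R.
Proof.
elim/lpaW => x; elim/lpaW => y; elim/lpaW => z.
by rewrite -lpa_classD !lpa_mulE -lpa_classD; apply/qclassP/lpa_mulDl.
Qed.
Lemma lpa_mulrDr : right_distributive lpa_mul +%R.
Proof.
elim/lpaW => x; elim/lpaW => y; elim/lpaW => z.
by rewrite -lpa_classD !lpa_mulE -lpa_classD; apply/qclassP/lpa_mulDr.
Qed.

HB.instance Definition _ := Zmodule_isNonUnitalRing.Build lpa lpa_mulrA lpa_mulrDl lpa_mulrDr.

Lemma lpa_classM x y : lpa_class (XMul x y) = lpa_class x ** lpa_class y.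
Proof. by rewrite -lpa_mulE. Qed.

Lemma lpa_scalerA c d x : lpa_scale c (lpa_scale d x) = lpa_scale (c * d) x.
Proof. by elim/lpaW: x => x; rewrite !lpa_scaleE; apply/qclassP/lpa_scaleA. Qed.
Lemma lpa_scale1r : left_id 1 lpa_scale.
Proof. by elim/lpaW => x; rewrite lpa_scaleE; apply/qclassP/lpa_scale1. Qed.
Lemma lpa_scalerDr : right_distributive lpa_scale +%R.
Proof.
move=> c; elim/lpaW => x; elim/lpaW => y.
by rewrite -lpa_classD !lpa_scaleE -lpa_classD; apply/qclassP/lpa_scaleDr.
Qed.
Lemma lpa_scalerDl x : {morph lpa_scale^~ x : c d / c + d}.
Proof.
move=> c d; elim/lpaW: x => x.
by rewrite !lpa_scaleE -lpa_classD; apply/qclassP/lpa_scaleDl.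
Qed.

HB.instance Definition _ :=
  GRing.Zmodule_isLmodule.Build R lpa lpa_scalerA lpa_scale1r lpa_scalerDr lpa_scalerDl.

Lemma lpa_classZ c x : lpa_class (XScale c x) = c *: lpa_class x.
Proof. by rewrite -lpa_scaleE. Qed.

Lemma lpa_scaleAl c (x y : lpa) : c *: (x ** y) = (c *: x) ** y.
Proof.
elim/lpaW: x => x; elim/lpaW: y => y.
by rewrite -lpa_classM -!lpa_classZ -lpa_classM; apply/qclassP/lpa_scaleMl.
Qed.
Lemma lpa_scaleAr c (x y : lpa) : c *: (x ** y) = x ** (c *: y).
Proof.
elim/lpaW: x => x; elim/lpaW: y => y.
by rewrite -lpa_classM -!lpa_classZ -lpa_classM; apply/qclassP/lpa_scaleMr.
Qed.

Definition Lvert (v : vertex E) : lpa := lpa_class (XVertex v).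
Definition Ledge (e : edge E) : lpa := lpa_class (XEdge e).
Definition Lghost (e : edge E) : lpa := lpa_class (XGhost e).

Lemma Lvert_idem v : Lvert v ** Lvert v = Lvert v.
Proof. by rewrite -lpa_classM; apply/qclassP/lpa_vert_idem. Qed.
Lemma Lvert_orth v w : v <> w -> Lvert v ** Lvert w = 0.
Proof. by move=> vw; rewrite -lpa_classM; apply/qclassP/lpa_vert_orth. Qed.
Lemma Lsrc_edge e : Lvert (src e) ** Ledge e = Ledge e.
Proof. by rewrite -lpa_classM; apply/qclassP/lpa_src_edge. Qed.
Lemma Ledge_rng e : Ledge e ** Lvert (rng e) = Ledge e.
Proof. by rewrite -lpa_classM; apply/qclassP/lpa_edge_rng. Qed.
Lemma Lrng_ghost e : Lvert (rng e) ** Lghost e = Lghost e.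
Proof. by rewrite -lpa_classM; apply/qclassP/lpa_rng_ghost. Qed.
Lemma Lghost_src e : Lghost e ** Lvert (src e) = Lghost e.
Proof. by rewrite -lpa_classM; apply/qclassP/lpa_ghost_src. Qed.
Lemma Lghost_edge e : Lghost e ** Ledge e = Lvert (rng e).
Proof. by rewrite -lpa_classM; apply/qclassP/lpa_CK1. Qed.
Lemma Lghost_edge_orth e f : e <> f -> Lghost e ** Ledge f = 0.
Proof. by move=> ef; rewrite -lpa_classM; apply/qclassP/lpa_CK1_orth. Qed.
Lemma lpa_class_sum (T : Type) (s : seq T) (F : T -> expr) :
  lpa_class (foldr (@XAdd R E) XZero [seq F e | e <- s]) = \sum_(e <- s) lpa_class (F e).
Proof. by elim: s => [|e s IH] /=; rewrite ?big_nil// big_cons lpa_classD IH. Qed.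
Lemma Lvert_CK2 v : regular v ->
  Lvert v = \sum_(e <- fset_set (out v)) Ledge e ** Lghost e.
Proof.
move=> rv; rewrite [LHS]((qclassP lpa_equiv _ _).2 (lpa_CK2 R rv)).
rewrite [LHS]lpa_class_sum.
by apply: eq_bigr => e _; rewrite lpa_classM.
Qed.

(* The R-linear involution, determined by v |-> v, e |-> e*, e* |-> e. *)
Fixpoint star_expr (x : expr) : expr :=
  match x with
  | XVertex v => XVertex v
  | XEdge e => XGhost e
  | XGhost e => XEdge e
  | XZero => XZero
  | XAdd x y => XAdd (star_expr x) (star_expr y)
  | XOpp x => XOpp (star_expr x)
  | XMul x y => XMul (star_expr y) (star_expr x)
  | XScale c x => XScale c (star_expr x)
  end.

Lemma star_expr_eq x y : lpa_eq x y -> lpa_eq (star_expr x) (star_expr y).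
Proof.
elim=> {x y} /=.
- by move=> x; apply: lpa_refl.
- by move=> x y _; apply: lpa_sym.
- by move=> x y z _ xy _; apply: lpa_trans.
- by move=> *; apply: lpa_congD.
- by move=> *; apply: lpa_congN.
- by move=> *; apply: lpa_congM.
- by move=> *; apply: lpa_congZ.
- by move=> *; apply: lpa_addA.
- by move=> *; apply: lpa_addC.
- by move=> *; apply: lpa_add0.
- by move=> *; apply: lpa_addN.
- by move=> *; apply/lpa_sym/lpa_mulA.
- by move=> *; apply: lpa_mulDr.
- by move=> *; apply: lpa_mulDl.
- by move=> *; apply: lpa_scaleA.
- by move=> *; apply: lpa_scale1.
- by move=> *; apply: lpa_scaleDr.
- by move=> *; apply: lpa_scaleDl.
- by move=> *; apply: lpa_scaleMr.
- by move=> *; apply: lpa_scaleMl.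
- by move=> *; apply: lpa_vert_idem.
- by move=> v w vw; apply: lpa_vert_orth => /esym.
- by move=> *; apply: lpa_ghost_src.
- by move=> *; apply: lpa_rng_ghost.
- by move=> *; apply: lpa_edge_rng.
- by move=> *; apply: lpa_src_edge.
- by move=> *; apply: lpa_CK1.
- by move=> e f ef; apply: lpa_CK1_orth => /esym.
- move=> v rv; set s := map _ _; suff -> : star_expr (foldr (@XAdd R E) XZero s) = foldr (@XAdd R E) XZero s.
    exact: lpa_CK2.
  by rewrite /s; elim: (enum_fset _) => //= e t ->.
Qed.

Definition lpa_star (x : lpa) : lpa := lpa_class (star_expr (qrepr x)).
Lemma lpa_starE x : lpa_star (lpa_class x) = lpa_class (star_expr x).
Proof. by apply/qclassP; apply: star_expr_eq; apply: (qrepr_class lpa_equiv). Qed.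

Lemma lpa_starK : involutive lpa_star.
Proof.
elim/lpaW => x; rewrite !lpa_starE; congr lpa_class.
by elim: x => //= [x -> y ->|x ->|x -> y ->|c x ->].
Qed.
Lemma lpa_starD : {morph lpa_star : x y / x + y}.
Proof. by elim/lpaW => x; elim/lpaW => y; rewrite -lpa_classD !lpa_starE -lpa_classD. Qed.
Lemma lpa_starM (x y : lpa) : lpa_star (x ** y) = lpa_star y ** lpa_star x.
Proof. by elim/lpaW: x => x; elim/lpaW: y => y; rewrite -lpa_classM !lpa_starE -lpa_classM. Qed.

HB.instance Definition _ := NonUnitalRing_isStarRing.Build lpa lpa_starK lpa_starD lpa_starM.

Lemma star_Lvert v : star (Lvert v) = Lvert v. Proof. exact: lpa_starE. Qed.
Lemma star_Ledge e : star (Ledge e) = Lghost e. Proof. exact: lpa_starE. Qed.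
Lemma star_Lghost e : star (Lghost e) = Ledge e. Proof. exact: lpa_starE. Qed.
Lemma star_scale c (x : lpa) : star (c *: x) = c *: star x.
Proof. by elim/lpaW: x => x; rewrite -lpa_classZ [LHS]lpa_starE [star _]lpa_starE -lpa_classZ. Qed.

Fixpoint Lword (e : edge E) (s : seq (edge E)) : lpa :=
  match s with [::] => Ledge e | f :: t => Ledge e ** Lword f t end.

Definition Lpath (mu : gpath E) : lpa :=
  match mu with PVertex v => Lvert v | PEdges e s _ => Lword e s end.

Definition diag_set : lpa -> Prop := fun x =>
  exists t : seq (R * gpath E),
    x = \sum_(cm <- t) cm.1 *: (Lpath cm.2 ** star (Lpath cm.2)).

Let elt (v : vertex E) (s : seq (edge E)) : lpa :=
  match s with [::] => Lvert v | e :: t => Lword e t end.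
Let pp v s := elt v s ** star (elt v s).
Let valid (v : vertex E) (s : seq (edge E)) : bool :=
  match s with [::] => true | e :: t => (src e == v) && path (@composable E) e t end.

Lemma elt_cons v e t : path (@composable E) e t ->
  elt v (e :: t) = Ledge e ** elt (rng e) t.
Proof. by case: t => [|f t] //= _; rewrite Ledge_rng. Qed.

Lemma vert_elt v s : valid v s -> Lvert v ** elt v s = elt v s.
Proof.
case: s => [|e t] /=; first by rewrite Lvert_idem.
by case/andP=> /eqP <- _; case: t => [|f t] /=; rewrite ?numulA Lsrc_edge.
Qed.

Lemma star_pp v s : star (pp v s) = pp v s.
Proof. by rewrite /pp starM starK. Qed.

Lemma vert_pp v s : valid v s -> Lvert v ** pp v s = pp v s.
Proof. by move=> vs; rewrite /pp numulA vert_elt. Qed.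

Lemma pp_vert v s : valid v s -> pp v s ** Lvert v = pp v s.
Proof. by move=> vs; rewrite -[LHS]starK starM star_pp star_Lvert vert_pp// star_pp. Qed.

Lemma pp_cons v e t : path (@composable E) e t ->
  pp v (e :: t) = Ledge e ** pp (rng e) t ** Lghost e.
Proof. by move=> p; rewrite /pp elt_cons// starM star_Ledge !numulA. Qed.

Lemma valid_tail e t : path (@composable E) e t -> valid (rng e) t.
Proof. by case: t => //= f t /andP[/eqP -> ->]; rewrite eqxx. Qed.

Lemma pp_nil v : pp v [::] = Lvert v.
Proof. by rewrite /pp /= [star _]lpa_starE Lvert_idem. Qed.

Lemma ppM s v t w : valid v s -> valid w t ->
  [\/ pp v s ** pp w t = 0, pp v s ** pp w t = pp v s | pp v s ** pp w t = pp w t].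
Proof.
elim: s v t w => [|e s IH] v t w.
  move=> _ wt; rewrite pp_nil.
  have [->|/eqP vw] := eqVneq v w; first by constructor 3; exact: vert_pp.
  by constructor 1; rewrite -(vert_pp wt) numulA Lvert_orth// numul0r.
case: t => [|f t] vs wt.
  rewrite pp_nil.
  have [<-|/eqP vw] := eqVneq v w; first by constructor 2; exact: pp_vert.
  by constructor 1; rewrite -(pp_vert vs) -numulA Lvert_orth// numulr0.
move: vs wt => /= /andP[_ es] /andP[_ ft]; rewrite !pp_cons//.
have [ef|/eqP ef] := eqVneq e f; last first.
  constructor 1; rewrite numulA numulA -(numulA _ (Lghost e)).
  by rewrite Lghost_edge_orth// numulr0 !numul0r.
rewrite -{}ef in ft *.
have -> : Ledge e ** pp (rng e) s ** Lghost e ** (Ledge e ** pp (rng e) t ** Lghost e)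
   = Ledge e ** (pp (rng e) s ** pp (rng e) t) ** Lghost e.
  have := pp_vert (valid_tail es); move: (pp _ s) (pp _ t) => x y xr.
  by rewrite !numulA -(numulA _ (Lghost e)) Lghost_edge -(numulA _ x (Lvert _)) xr.
case: (IH (rng e) t (rng e)); rewrite ?valid_tail// => ->.
- by constructor 1; rewrite numulr0 numul0r.
- by constructor 2.
- by constructor 3.
Qed.

Lemma gpath_pp (mu : gpath E) : exists v s, valid v s /\ Lpath mu = elt v s.
Proof.
case: mu => [v|e s p]; first by exists v, [::].
by exists (src e), (e :: s); rewrite /= eqxx.
Qed.

Lemma diag0 : diag_set 0.
Proof. by exists [::]; rewrite big_nil. Qed.
Lemma diagDD x y : diag_set x -> diag_set y -> diag_set (x + y).
Proof. by move=> [s ->] [t ->]; exists (s ++ t); rewrite big_cat. Qed.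
Lemma diagZ c x : diag_set x -> diag_set (c *: x).
Proof.
move=> [s ->]; exists [seq (c * cm.1, cm.2) | cm <- s].
by rewrite big_map scaler_sumr; apply: eq_bigr => cm _; rewrite scalerA.
Qed.
Lemma diag_path mu : diag_set (Lpath mu ** star (Lpath mu)).
Proof. by exists [:: (1, mu)]; rewrite big_seq1 scale1r. Qed.
Lemma diagB x y : diag_set x -> diag_set y -> diag_set (x - y).
Proof. by move=> Dx Dy; rewrite -scaleN1r; apply: diagDD => //; apply: diagZ. Qed.
Lemma diag_sum I (r : seq I) (F : I -> lpa) :
  (forall i, diag_set (F i)) -> diag_set (\sum_(i <- r) F i).
Proof. by move=> DF; apply: (big_ind diag_set) => //; [exact: diag0|exact: diagDD]. Qed.
Lemma diag_star x : diag_set x -> diag_set (star x).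
Proof.
move=> [s ->]; rewrite star_sum; exists s; apply: eq_bigr => cm _.
by rewrite star_scale starM starK.
Qed.
Lemma diagM x y : diag_set x -> diag_set y -> diag_set (x ** y).
Proof.
move=> [s ->] [t ->]; rewrite numul_suml; apply: diag_sum => -[c mu] /=.
rewrite numul_sumr; apply: diag_sum => -[d nu] /=.
rewrite -lpa_scaleAl -lpa_scaleAr; do 2!apply: diagZ.
have := diag_path mu; have := diag_path nu.
have [v [m [vm ->]]] := gpath_pp mu; have [w [n [wn ->]]] := gpath_pp nu.
rewrite -!/(pp _ _) => Dn Dm.
by case: (ppM vm wn) => ->//; apply: diag0.
Qed.

Definition lpa_diag : starSubring lpa := StarSubring diag0 diagB diagM diag_star.

Lemma diag_vert v : lpa_diag (Lvert v).
Proof. by have := diag_path (PVertex v); rewrite /= star_Lvert Lvert_idem. Qed.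
Lemma diag_edge e : lpa_diag (Ledge e ** Lghost e).
Proof. by have := @diag_path (@PEdges E e [::] isT); rewrite /= star_Ledge. Qed.

Lemma vert_proj v : is_projection (Lvert v).
Proof. by split; [exact: star_Lvert|exact: Lvert_idem]. Qed.

Definition vert_minus (w : vertex E) (S : {fset edge E}) : lpa :=
  Lvert w - \sum_(e <- S) Ledge e ** Lghost e.

Lemma vert_minus_diag w S : lpa_diag (vert_minus w S).
Proof. by apply: ssubB; [exact: diag_vert|apply: diag_sum => e; exact: diag_edge]. Qed.

Lemma vert_minus_proj w S : emitter_subset w S -> is_projection (vert_minus w S).
Proof.
case=> _ _ Sw; have {}Sw e : e \in S -> src e = w by move/Sw.
set P := \sum_(e <- S) Ledge e ** Lghost e.
have sP : star P = P.
  by rewrite star_sum; apply: eq_bigr => e _; rewrite starM star_Ledge star_Lghost.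
have wP : Lvert w ** P = P.
  rewrite numul_sumr big_seq [RHS]big_seq; apply: eq_bigr => e /Sw <-.
  by rewrite numulA Lsrc_edge.
have Pw : P ** Lvert w = P by rewrite -[LHS]starK starM sP star_Lvert wP.
have PP : P ** P = P.
  rewrite {1}/P numul_suml big_seq [RHS]big_seq; apply: eq_bigr => e eS.
  rewrite /P numul_sumr (big_fsetD1 e)//= big1_fset ?addr0 => [|f].
    by rewrite numulA -(numulA (Ledge e)) Lghost_edge Ledge_rng.
  rewrite !inE => /andP[/eqP fe _] _; rewrite numulA -(numulA (Ledge e)).
  by rewrite Lghost_edge_orth ?numulr0 ?numul0r// => /esym.
split; first by rewrite /vert_minus -/P starD starN sP star_Lvert.
rewrite /vert_minus -/P numulDl !numulDr !(numulNr, numulrN) Lvert_idem.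
by rewrite wP Pw PP opprK addNr addr0.
Qed.

End LPA.

Arguments Lvert {R E}.
Arguments Ledge {R E}.
Arguments Lghost {R E}.

Section ChangeOfRing.
Variables (R S : comPzRingType) (f : {rmorphism R -> S}) (E : digraph).

Fixpoint map_expr (x : lpa_expr R E) : lpa_expr S E :=
  match x with
  | XVertex v => XVertex v
  | XEdge e => XEdge e
  | XGhost e => XGhost e
  | XZero => XZero
  | XAdd x y => XAdd (map_expr x) (map_expr y)
  | XOpp x => XOpp (map_expr x)
  | XMul x y => XMul (map_expr x) (map_expr y)
  | XScale c x => XScale (f c) (map_expr x)
  end.

Lemma map_expr_eq x y : lpa_eq x y -> lpa_eq (map_expr x) (map_expr y).
Proof.
elim=> {x y} /=; try by (move=> *; constructor).
- by move=> x y z _ xy _; apply: lpa_trans.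
- by move=> c d x; rewrite rmorphM; apply: lpa_scaleA.
- by move=> x; rewrite rmorph1; apply: lpa_scale1.
- by move=> c d x; rewrite rmorphD; apply: lpa_scaleDl.
- move=> v rv; apply: lpa_trans (lpa_CK2 S rv) _.
  by elim: (enum_fset _) => [|e t IH] /=; [apply: lpa_refl|apply: lpa_congD; first exact: lpa_refl].
Qed.

Definition lpa_map (x : lpa R E) : lpa S E := lpa_class (map_expr (qrepr x)).

Lemma lpa_mapE x : lpa_map (lpa_class x) = lpa_class (map_expr x).
Proof. by apply/qclassP; apply: map_expr_eq; apply: (qrepr_class (lpa_equiv R E)). Qed.

Lemma lpa_map_nmod_morphism : nmod_morphism lpa_map.
Proof.
split; first exact: lpa_mapE.
by elim/lpaW => x; elim/lpaW => y; rewrite -lpa_classD !lpa_mapE -lpa_classD.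
Qed.
HB.instance Definition _ :=
  GRing.isNmodMorphism.Build (lpa R E) (lpa S E) lpa_map lpa_map_nmod_morphism.

Lemma lpa_mapM x y : lpa_map (x ** y) = lpa_map x ** lpa_map y.
Proof.
by elim/lpaW: x => x; elim/lpaW: y => y; rewrite -lpa_classM !lpa_mapE -lpa_classM.
Qed.
Lemma lpa_map_vert v : lpa_map (Lvert v) = Lvert v. Proof. exact: lpa_mapE. Qed.
Lemma lpa_map_edge e : lpa_map (Ledge e) = Ledge e. Proof. exact: lpa_mapE. Qed.
Lemma lpa_map_ghost e : lpa_map (Lghost e) = Lghost e. Proof. exact: lpa_mapE. Qed.

End ChangeOfRing.

Lemma map_finmxM (A B : nonUnitalRingType) (f : {additive A -> B})
    (fM : {morph f : x y / x ** y}) (a b : finmx A) :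
  map_finmx f (a ** b) = map_finmx f a ** map_finmx f b.
Proof.
have [n an] := finmxP a; have fan : bounded_by n (map_finmx f a).
  by move=> i j /an aij; exact: etrans (congr1 f aij) (raddf0 f).
apply: finmx_eq => i j; rewrite (fmxMEl _ _ _ fan).
rewrite [LHS](_ : _ = f ((a ** b) i j)) // (fmxMEl _ _ _ an) raddf_sum.
by apply: eq_bigr => k _; rewrite fM.
Qed.

Section ME.
Variable E : digraph.

Inductive ME_gen :=
  | GVertex of vertex E
  | GEmitter (w : vertex E) (S : {fset edge E}) of emitter_subset w S.

(* Words up to [ME_eq]; [ME_comm] makes concatenation commutative. *)
Inductive ME_eq : seq ME_gen -> seq ME_gen -> Prop :=
  | ME_refl s : ME_eq s s
  | ME_sym s t : ME_eq s t -> ME_eq t s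
  | ME_trans s t u : ME_eq s t -> ME_eq t u -> ME_eq s u
  | ME_cong s s' t t' : ME_eq s s' -> ME_eq t t' -> ME_eq (s ++ t) (s' ++ t')
  | ME_comm s t : ME_eq (s ++ t) (t ++ s)
  | ME_regular v : regular v ->
      ME_eq [:: GVertex v] [seq GVertex (rng e) | e <- fset_set (out v)]
  | ME_infinite w S (h : emitter_subset w S) :
      ME_eq [:: GVertex w] ([seq GVertex (rng e) | e <- S] ++ [:: GEmitter h])
  | ME_emitter w S1 S2 (h1 : emitter_subset w S1) (h2 : emitter_subset w S2) :
      (S1 `<=` S2)%fset ->
      ME_eq [:: GEmitter h1]
            (GEmitter h2 :: [seq GVertex (rng e) | e <- (S2 `\` S1)%fset]).

Lemma ME_equiv : equivalence_Prop ME_eq.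
Proof. by split; [apply: ME_refl|apply: ME_sym|apply: ME_trans]. Qed.

Definition ME : Type := quot ME_equiv.
HB.instance Definition _ := Choice.copy ME (quot ME_equiv).

Definition ME_class (s : seq ME_gen) : ME := qclass ME_equiv s.
Definition ME_zero : ME := ME_class [::].
Definition ME_add (x y : ME) : ME := ME_class (qrepr x ++ qrepr y).

Lemma ME_addE s t : ME_add (ME_class s) (ME_class t) = ME_class (s ++ t).
Proof. by apply/qclassP; apply: ME_cong; apply: (qrepr_class ME_equiv). Qed.
Lemma ME_addA : associative ME_add.
Proof.
elim/quotW => s; elim/quotW => t; elim/quotW => u.
by rewrite -!/(ME_class _) !ME_addE catA.
Qed.
Lemma ME_addC : commutative ME_add.
Proof.
elim/quotW => s; elim/quotW => t.
by rewrite -!/(ME_class _) !ME_addE; apply/qclassP/ME_comm.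
Qed.
Lemma ME_add0 : left_id ME_zero ME_add.
Proof. by elim/quotW => s; rewrite -!/(ME_class _) ME_addE. Qed.

HB.instance Definition _ := GRing.isNmodule.Build ME ME_addA ME_addC ME_add0.

Definition ME_vertex (v : vertex E) : ME := ME_class [:: GVertex v].
Definition ME_q (w : vertex E) (S : {fset edge E}) (h : emitter_subset w S) : ME :=
  ME_class [:: GEmitter h].

End ME.

Definition vertex_dproj (E : digraph) (v : vertex E) : dproj (lpa_diag int E) :=
  dproj11 (diag_vert int v) (vert_proj int v).

Definition emitter_dproj (E : digraph) (w : vertex E) (S : {fset edge E})
    (h : emitter_subset w S) : dproj (lpa_diag int E) :=
  dproj11 (vert_minus_diag int w S) (vert_minus_proj int h).

Definition iota_LZ (k : fieldType) (E : digraph) : {additive lpa int E -> lpa k E} :=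
  @lpa_map int k (intmul 1 : {rmorphism int -> k}) E.

Lemma iota_LZ_idem (k : fieldType) (E : digraph) (p : dproj (lpa_diag int E)) :
  is_idempotent (map_finmx (iota_LZ k E) p).
Proof.
have [_ pp] := dproj_proj p.
rewrite /is_idempotent -map_finmxM; first by rewrite pp.
exact: lpa_mapM.
Qed.

Definition iota_idem (k : fieldType) (E : digraph) (p : dproj (lpa_diag int E)) :
  idem (lpa k E) := Idem (iota_LZ_idem k p).

(* Main.v *)
(* Composing alpha : M_E -> V^*(L_Z(E), D_Z(E)) with beta gives gamma : M_E -> V(L_k(E)),
   so it suffices that alpha is onto and gamma is bijective.

   alpha is onto: a projection of D_Z(E) is split along the first edges of paths as
   c (v - sum_(e in T) e e^* ) + sum_(e in T) e z_e e^*, where the z_e are projections of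
   smaller depth and c may be taken in {0, 1} because multiples of vertices are nonzero.

   gamma is bijective, with P the path algebra: fix a finite set S of edges containing
   all edges that occur in the matrices at hand, and complete each vertex v not exhausted
   by S by an arrow to a sink with idempotent v - sum_(e in S, s(e) = v) e e^*.  Multiplying
   an element by long enough paths absorbs its ghost edges and leaves an element of P.
   - Onto: the image of an idempotent p is generated by finitely many columns over P.
     Paths are linearly independent in L_k(E), so Cohn's weak algorithm turns the columns
     into a basis, whence p is equivalent to a sum of idempotents of vertices and sinks.
   - One-to-one: given two bases of the same module, expansions v = sum e e^* make one
     matrix of change of basis have entries in P.  Further expansions make its constant
     term of full row rank; by a Nakayama argument the inverse then also has entries in P,
     and the constant terms, being mutually inverse, show that the types of the two bases
     agree.  Expansions do not change the class in M_E. *)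
Require Import Defs.
From HB Require Import structures.
From mathcomp Require Import all_boot all_order all_algebra finmap.
From mathcomp Require Import boolp classical_sets functions cardinality.

Set Implicit Arguments.
Unset Strict Implicit.
Unset Printing Implicit Defensive.

Import Order.TTheory GRing.Theory Num.Theory.
Local Open Scope ring_scope.

(** * Path algebras *)

(** All objects live in one non-unital algebra, the finite matrices over [lpa k E]: path elements
    occupy the entry (0, 0) and column vectors the column 0, so rows, columns and idempotents of
    every size can be multiplied. Most of the argument sees only the relations collected in
    [ckFamily]. The ghost edges dictate its shape. Left multiplication by [gh a] preserves
    polynomials, that is combinations of paths, only when there is no constant term; so an entry
    becomes polynomial only after right multiplication by long paths. Undoing that multiplication
    requires [eps t] to be the sum of [el a ** gh a] over a finite list of arrows. This fails at
    infinite emitters and at vertices with edges outside the chosen set; the extra arrow restores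
    it. The price is sinks, where paths cannot be prolonged: every path into a sink counts as long.
    Each rewriting trades one item of degree d for boundedly many of degree d - 1. It stops because
    the sum of the K ^ d decreases once K exceeds the number of arrows entering or leaving any
    type. *)

HB.mixin Record isNonUnitalAlgebra (k : pzRingType) A
    of NonUnitalRing A & GRing.Lmodule k A := {
  nuscaleAl : forall (c : k) (x y : A), c *: (x ** y) = (c *: x) ** y;
  nuscaleAr : forall (c : k) (x y : A), c *: (x ** y) = x ** (c *: y)
}.

#[short(type="nonUnitalAlgType")]
HB.structure Definition NonUnitalAlgebra (k : pzRingType) :=
  { A of NonUnitalRing A & GRing.Lmodule k A & isNonUnitalAlgebra k A }.

(** Cuntz-Krieger relations of a finite stage. [arr] may contain arrows listed in no [outs], namely
    the edges outside the chosen finite set; therefore [outsP] is one-sided and [gh_el] is asked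
    only inside one list. A type with empty [outs] is a sink. The bounds by [branching] are strict
    so that it can serve as the base of [weight]. *)
Record ckFamily (k : fieldType) (A : nonUnitalAlgType k) := CKFamily {
  typ : eqType;
  arr : eqType;
  asrc : arr -> typ;
  atgt : arr -> typ;
  outs : typ -> seq arr;
  ins : typ -> seq arr;
  outsP : forall a t, a \in outs t -> asrc a = t;
  insP : forall a t, (a \in ins t) = (a \in outs (asrc a)) && (atgt a == t);
  outs_uniq : forall t, uniq (outs t);
  ins_uniq : forall t, uniq (ins t);
  branching : nat;
  size_outs : forall t, (size (outs t) < branching)%N;
  size_ins : forall t, (size (ins t) < branching)%N;
  eps : typ -> A;
  el : arr -> A;
  gh : arr -> A;
  eps_idem : forall t, eps t ** eps t = eps t;
  eps_el : forall a, eps (asrc a) ** el a = el a;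
  el_eps : forall a, el a ** eps (atgt a) = el a;
  eps_gh : forall a, eps (atgt a) ** gh a = gh a;
  gh_eps : forall a, gh a ** eps (asrc a) = gh a;
  gh_el : forall t a b, a \in outs t -> b \in outs t ->
    gh a ** el b = if a == b then eps (atgt a) else 0;
  eps_sum : forall t, outs t != [::] ->
    eps t = \sum_(a <- outs t) el a ** gh a
}.

Section Words.
Variables (k : fieldType) (A : nonUnitalAlgType k) (F : ckFamily A).
Implicit Types (a b : arr F) (s t : typ F) (w : seq (arr F)).

Fixpoint pth s w t : bool :=
  match w with [::] => s == t | a :: w' => (a \in outs s) && pth (atgt a) w' t end.

Fixpoint wel s w : A :=
  match w with [::] => eps s | a :: w' => el a ** wel (atgt a) w' end.

Lemma pth_cat s w w' t u : pth s w t -> pth t w' u -> pth s (w ++ w') u.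
Proof. by elim: w s => [|a w IH] s /= => [/eqP->|/andP[-> /IH h]]. Qed.

Lemma pth_rcons s w a t : pth s (rcons w a) t = pth s w (asrc a) && (a \in ins t).
Proof.
rewrite insP; elim: w s => [|b w IH] s /=; last by rewrite IH andbA.
apply/andP/andP => [[aS ht]|[/eqP -> /andP[]]]//.
by rewrite (outsP aS) eqxx aS.
Qed.

Lemma eps_wel s w t : pth s w t -> eps s ** wel s w = wel s w.
Proof.
case: w => [|a w] /=; first by rewrite eps_idem.
by case/andP=> /outsP <- _; rewrite numulA eps_el.
Qed.

Lemma wel_eps s w t : pth s w t -> wel s w ** eps t = wel s w.
Proof.
elim: w s => [|a w IH] s /= => [/eqP->|/andP[_ /IH h]]; first by rewrite eps_idem.
by rewrite -numulA h.
Qed.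

Lemma wel_cat s w w' t u : pth s w t -> pth t w' u ->
  wel s (w ++ w') = wel s w ** wel t w'.
Proof.
elim: w s => [|a w IH] s /= => [/eqP-> h|/andP[_ h1] h2].
  by rewrite (eps_wel h).
by rewrite (IH _ h1 h2) numulA.
Qed.

Lemma wel_rcons s w a : pth s w (asrc a) -> a \in outs (asrc a) ->
  wel s (rcons w a) = wel s w ** el a.
Proof.
move=> h ha; rewrite -cats1 (wel_cat h (_ : pth _ _ (atgt a))) /= ?ha ?eqxx//.
by rewrite el_eps.
Qed.

End Words.

(* A forest is a set of typed roots generating a free right module over the
   path algebra: [fcoef t r w] reads off the fcoefficient of [root_el r ** wel w]. *)
Record forest (k : fieldType) (A : nonUnitalAlgType k) (F : ckFamily A) := Forest {
  root : eqType;
  rtyp : root -> typ F;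
  root_el : root -> A;
  fcoef : typ F -> root -> seq (arr F) -> A -> k;
  fcoefD : forall t r w c x y, fcoef t r w (c *: x + y) = c * fcoef t r w x + fcoef t r w y;
  fcoef_mono : forall t r w r' w', pth (rtyp r) w t -> pth (rtyp r') w' t ->
    fcoef t r w (root_el r' ** wel (rtyp r') w') = ((r == r') && (w == w'))%:R
}.

(** * Free modules over a path algebra and their degree filtration *)

Section ForestTheory.
Variables (k : fieldType) (A : nonUnitalAlgType k) (F : ckFamily A) (Q : forest F).
Implicit Types (a b : arr F) (s t : typ F) (w : seq (arr F)) (x y z : A).
Implicit Types (r : root Q) (l : seq (k * (root Q * seq (arr F)))).

Definition mono (u : root Q * seq (arr F)) : A := root_el u.1 ** wel (rtyp u.1) u.2.
Definition mono_sum l : A := \sum_(m <- l) m.1 *: mono m.2.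

(** The bound is strict: level 0 contains only zero and level 1 the combinations of roots, so a
    nonzero element always has positive level. *)
Definition fspan_lt d t x : Prop := exists l,
  (forall m, m \in l -> pth (rtyp m.2.1) m.2.2 t /\ (size m.2.2 < d)%N) /\ x = mono_sum l.
Definition fspan t x : Prop := exists d, fspan_lt d t x.

Lemma fspan_ltP d t x : fspan_lt d t x -> fspan t x. Proof. by exists d. Qed.

Lemma fspan_lt_weak d e t x : (d <= e)%N -> fspan_lt d t x -> fspan_lt e t x.
Proof.
move=> de [l [lP ->]]; exists l; split=> // m /lP[p sm]; split=> //.
exact: leq_trans de.
Qed.

Lemma fspan_lt0 d t : fspan_lt d t 0.
Proof. by exists [::]; rewrite /mono_sum big_nil. Qed.

Lemma fspan_lt0_eq t x : fspan_lt 0 t x -> x = 0.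
Proof.
by move=> [[|m l] [lP ->]]; rewrite /mono_sum ?big_nil//; case: (lP m (mem_head _ _)).
Qed.

Lemma fspan_ltD d t x y : fspan_lt d t x -> fspan_lt d t y -> fspan_lt d t (x + y).
Proof.
move=> [l [lP ->]] [l' [lP' ->]]; exists (l ++ l'); split; last by rewrite /mono_sum big_cat.
by move=> m; rewrite mem_cat => /orP[/lP|/lP'].
Qed.

Lemma fspan_ltZ d t c x : fspan_lt d t x -> fspan_lt d t (c *: x).
Proof.
move=> [l [lP ->]]; exists [seq (c * m.1, m.2) | m <- l]; split.
  by move=> m /mapP[m' /lP h ->].
by rewrite /mono_sum scaler_sumr big_map; apply: eq_bigr => m _; rewrite scalerA.
Qed.

Lemma fspan_lt_sum d t (I : eqType) (r : seq I) (P : pred I) (G : I -> A) :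
  (forall i, i \in r -> P i -> fspan_lt d t (G i)) -> fspan_lt d t (\sum_(i <- r | P i) G i).
Proof.
move=> h; rewrite big_seq_cond; apply: (big_ind (fspan_lt d t)).
- exact: fspan_lt0.
- exact: fspan_ltD.
- by move=> i /andP[/h].
Qed.

Lemma fspan_mono r w t : pth (rtyp r) w t -> fspan_lt (size w).+1 t (mono (r, w)).
Proof.
move=> h; exists [:: (1, (r, w))]; rewrite /mono_sum big_seq1 scale1r; split=> // m.
by rewrite inE => /eqP ->.
Qed.

Lemma fspan0 t : fspan t 0. Proof. by exists 0%N; apply: fspan_lt0. Qed.
Lemma fspanD t x y : fspan t x -> fspan t y -> fspan t (x + y).
Proof.
move=> [d xd] [e ye]; exists (maxn d e).
by apply: fspan_ltD; [apply: fspan_lt_weak xd|apply: fspan_lt_weak ye];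
  rewrite ?leq_maxl ?leq_maxr.
Qed.
Lemma fspanZ t c x : fspan t x -> fspan t (c *: x).
Proof. by move=> [d xd]; exists d; apply: fspan_ltZ. Qed.
Lemma fspanN t x : fspan t x -> fspan t (- x).
Proof. by rewrite -scaleN1r; apply: fspanZ. Qed.
Lemma fspan_sum t (I : eqType) (r : seq I) (P : pred I) (G : I -> A) :
  (forall i, i \in r -> P i -> fspan t (G i)) -> fspan t (\sum_(i <- r | P i) G i).
Proof.
move=> h; rewrite big_seq_cond; apply: (big_ind (fspan t)).
- exact: fspan0.
- exact: fspanD.
- by move=> i /andP[/h].
Qed.

Lemma fspan_ind t (P : A -> Prop) : P 0 -> (forall x y, P x -> P y -> P (x + y)) ->
  (forall c r w, pth (rtyp r) w t -> P (c *: mono (r, w))) ->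
  forall x, fspan t x -> P x.
Proof.
move=> P0 PD Pm x [d [l [lP ->]]]; rewrite /mono_sum big_seq.
by apply: (big_ind P) => // -[c [r w]] /lP[/= h _]; apply: Pm.
Qed.

Lemma mono_eps r w t : pth (rtyp r) w t -> mono (r, w) ** eps t = mono (r, w).
Proof. by move=> h; rewrite /mono -numulA (wel_eps h). Qed.

Lemma fspan_eps t x : fspan t x -> x ** eps t = x.
Proof.
move: x; apply: fspan_ind => [|x y hx hy|c r w h]; first by rewrite numul0r.
  by rewrite numulDl hx hy.
by rewrite -nuscaleAl mono_eps.
Qed.

Lemma fcoef0 t r w : fcoef t r w 0 = 0.
Proof. by have := @fcoefD _ _ _ Q t r w (-1) 0 0; rewrite scaler0 addr0 mulN1r addNr. Qed.
Lemma fcoef_sum t r w (I : Type) (s : seq I) (c : I -> k) (G : I -> A) :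
  fcoef t r w (\sum_(i <- s) c i *: G i) = \sum_(i <- s) c i * fcoef t r w (G i).
Proof.
elim: s => [|i s IH]; first by rewrite !big_nil fcoef0.
by rewrite !big_cons fcoefD IH.
Qed.
Lemma fcoefA t r w x y : fcoef t r w (x + y) = fcoef t r w x + fcoef t r w y.
Proof. by rewrite -{1}[x]scale1r fcoefD mul1r. Qed.
Lemma fcoefZ t r w c x : fcoef t r w (c *: x) = c * fcoef t r w x.
Proof. by rewrite -[c *: x]addr0 fcoefD fcoef0 addr0. Qed.
Lemma fcoefS t r w (I : Type) (s : seq I) P (G : I -> A) :
  fcoef t r w (\sum_(i <- s | P i) G i) = \sum_(i <- s | P i) fcoef t r w (G i).
Proof. by apply: (big_morph (fcoef t r w)); [exact: fcoefA|exact: fcoef0]. Qed.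

(** The list may repeat monomials; [fcoef] adds up the scalars of each one and ignores the others by
    [fcoef_mono]. Hence an element of a span is determined by its coefficients. *)
Lemma mono_sum_fcoef l t : (forall m, m \in l -> pth (rtyp m.2.1) m.2.2 t) ->
  mono_sum l = \sum_(u <- undup (unzip2 l)) fcoef t u.1 u.2 (mono_sum l) *: mono u.
Proof.
move=> lP; have cE u : u \in unzip2 l ->
    fcoef t u.1 u.2 (mono_sum l) = \sum_(m <- l | u == m.2) m.1.
  case/mapP=> m /lP pm ->; rewrite fcoef_sum big_seq [RHS]big_mkcond [RHS]big_seq.
  apply: eq_bigr => m' /lP pm'; rewrite fcoef_mono//.
  case: (m) (m') => [_ [r w]] [c' [r' w']] /=; rewrite xpair_eqE.
  by case: ifP; rewrite ?mulr1 ?mulr0.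
transitivity (\sum_(u <- undup (unzip2 l)) \sum_(m <- l | u == m.2) m.1 *: mono u);
  last by rewrite big_seq [RHS]big_seq; apply: eq_bigr => u;
    rewrite mem_undup => ul; rewrite cE // scaler_suml.
rewrite (exchange_big_dep predT)//= /mono_sum [LHS]big_seq [RHS]big_seq.
apply: eq_bigr => m ml; rewrite -big_filter.
suff -> : [seq u <- undup (unzip2 l) | u == m.2] = [:: m.2] by rewrite big_seq1.
have : m.2 \in undup (unzip2 l) by rewrite mem_undup; apply: map_f.
have := undup_uniq (unzip2 l); move: (m.2) => c.
elim: (undup _) => //= u v IH /andP[uv vu]; rewrite inE.
have [-> _|uc /=] := eqVneq c u; last exact: IH.
congr cons; apply/eqP; rewrite -size_eq0 size_filter -leqn0 leqNgt -has_count.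
by apply/hasP => -[y yv /= /eqP yu]; rewrite -yu yv in uv.
Qed.

Lemma fspan_fcoef0 t x : fspan t x ->
  (forall r w, pth (rtyp r) w t -> fcoef t r w x = 0) -> x = 0.
Proof.
move=> [d [l [lP ->]]] h; rewrite (@mono_sum_fcoef _ t); last by move=> m /lP[].
rewrite big_seq big1// => -[r w]; rewrite mem_undup => /mapP[m /lP[pm _] e].
by rewrite h ?scale0r// e.
Qed.

Lemma mono_rcons r w a : pth (rtyp r) w (asrc a) -> a \in outs (asrc a) ->
  mono (r, rcons w a) = mono (r, w) ** el a.
Proof. by move=> h ha; rewrite /mono wel_rcons// numulA. Qed.

Lemma fspan_el d a x : a \in outs (asrc a) ->
  fspan_lt d (asrc a) x -> fspan_lt d.+1 (atgt a) (x ** el a).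
Proof.
move=> ha [l [lP ->]]; exists [seq (m.1, (m.2.1, rcons m.2.2 a)) | m <- l]; split.
  move=> m /mapP[m' /lP[h1 h2] ->] /=; rewrite size_rcons; split=> //.
  by rewrite pth_rcons h1 insP ha eqxx.
rewrite /mono_sum big_map numul_suml [LHS]big_seq [RHS]big_seq; apply: eq_bigr => m /lP[h1 _] /=.
by rewrite -nuscaleAl (mono_rcons h1 ha); case: (m.2).
Qed.

Lemma fspan_wel s w t x : pth s w t -> fspan s x -> fspan t (x ** wel s w).
Proof.
elim: w s x => [|a w IH] s x /= => [/eqP-> h|/andP[ha p] [d h]].
  by rewrite fspan_eps.
rewrite numulA; apply: IH => //; exists d.+1; apply: fspan_el; first by rewrite (outsP ha).
by rewrite (outsP ha).
Qed.

(** A nonempty path is a shorter path followed by its last arrow; monomials are grouped by that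
    arrow. *)
Lemma fspan_last d t x : fspan_lt d.+1 t x -> exists z (y : arr F -> A),
  [/\ fspan_lt 1 t z, forall a, a \in ins t -> fspan_lt d (asrc a) (y a)
    & x = z + \sum_(a <- ins t) y a ** el a].
Proof.
move=> [l [lP ->]].
elim: l lP => [|m l IH] lP.
  exists 0, (fun=> 0); split; [exact: fspan_lt0|by move=> a _; exact: fspan_lt0|].
  by rewrite /mono_sum big_nil big1 ?addr0// => a _; rewrite numul0r.
case: IH => [m' m'l|z [y [hz hy e]]]; first by apply: lP; rewrite inE m'l orbT.
rewrite /mono_sum big_cons -/(mono_sum l) e.
case: m lP => c [r w] /(_ _ (mem_head _ _))[/=]; case/lastP: w => [|w a] pw sw.
  exists (c *: mono (r, [::]) + z), y; split; rewrite ?addrA//.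
  by apply: fspan_ltD => //; apply: fspan_ltZ; exact: fspan_mono pw.
move: pw; rewrite pth_rcons => /andP[pw ai].
have ha : a \in outs (asrc a) by move: ai; rewrite insP => /andP[].
exists z, (fun b => (if b == a then c *: mono (r, w) else 0) + y b); split=> //.
  move=> b /hy yb; apply: fspan_ltD => //; case: eqP => [->|_]; last exact: fspan_lt0.
  apply/fspan_ltZ/(fspan_lt_weak _ (fspan_mono pw)); by rewrite size_rcons ltnS in sw.
under [in RHS]eq_bigr do rewrite /= numulDl.
rewrite big_split /= addrCA; congr (_ + (_ + _)).
rewrite (bigD1_seq a) ?ins_uniq//= eqxx big1 ?addr0; last first.
  by move=> b /negbTE ->; rewrite numul0r.
by rewrite mono_rcons// nuscaleAl.
Qed.

Lemma fcoef_el t r w a x : pth (rtyp r) w (asrc a) -> a \in ins t -> fspan (asrc a) x ->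
  fcoef t r (rcons w a) (x ** el a) = fcoef (asrc a) r w x.
Proof.
move=> pw ai; move: x; have := ai; rewrite insP => /andP[ha _].
apply: fspan_ind => [|x y hx hy|c r' w' pw']; first by rewrite numul0r !fcoef0.
  by rewrite numulDl !fcoefA hx hy.
rewrite -nuscaleAl !fcoefZ -(mono_rcons pw' ha) !fcoef_mono ?pth_rcons ?pw ?pw' ?ai//.
by rewrite eqseq_rcons eqxx andbT.
Qed.

Lemma fcoef_el_neq t r w a x : pth (rtyp r) w t -> a \in ins t -> fspan (asrc a) x ->
  (forall w', w <> rcons w' a) -> fcoef t r w (x ** el a) = 0.
Proof.
move=> pw ai + wa; move: x; have := ai; rewrite insP => /andP[ha _].
apply: fspan_ind => [|x y hx hy|c r' w' pw']; first by rewrite numul0r !fcoef0.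
  by rewrite numulDl !fcoefA hx hy addr0.
rewrite -nuscaleAl !fcoefZ -(mono_rcons pw' ha) fcoef_mono ?pth_rcons ?pw' ?ai//.
by case: (w =P _) => [/wa|_]; rewrite ?andbF ?mulr0.
Qed.

Lemma fcoef_const t r a w z : pth (rtyp r) (rcons w a) t -> fspan_lt 1 t z ->
  fcoef t r (rcons w a) z = 0.
Proof.
move=> pw [l [lP ->]]; rewrite fcoef_sum big_seq big1// => m /lP[pm].
rewrite ltnS leqn0 size_eq0 => /eqP e; rewrite fcoef_mono//.
by rewrite e; case: (w) => [|? ?]; rewrite andbF mulr0.
Qed.

(** Uniqueness of the splitting in [fspan_last]: words with different last arrows differ, so the
    coefficient at [rcons w a] sees only [y a], and there the coefficient at [w]. *)
Lemma fspan_last_eq0 t z (y : arr F -> A) : fspan_lt 1 t z ->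
  (forall a, a \in ins t -> fspan (asrc a) (y a)) ->
  z + \sum_(a <- ins t) y a ** el a = 0 ->
  z = 0 /\ (forall a, a \in ins t -> y a = 0).
Proof.
move=> hz hy e; have y0 a : a \in ins t -> y a = 0.
  move=> ai; apply: (fspan_fcoef0 (hy _ ai)) => r w pw.
  have pwa : pth (rtyp r) (rcons w a) t by rewrite pth_rcons pw ai.
  have /(congr1 (fcoef t r (rcons w a))) := e.
  rewrite fcoefA fcoef_const// add0r fcoef0 fcoefS (bigD1_seq a) ?ins_uniq//=.
  rewrite fcoef_el//; last exact: hy.
  rewrite big_seq_cond big1 ?addr0// => b /andP[bi ba].
  apply: fcoef_el_neq => //; first exact: hy.
  by move=> w' /rcons_inj[_ ab]; rewrite ab eqxx in ba.
split=> //; rewrite -e big_seq big1 ?addr0// => a /y0 ->; exact: numul0r.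
Qed.

End ForestTheory.

Record pathBasis (k : fieldType) (A : nonUnitalAlgType k) (F : ckFamily A) := PathBasis {
  pcoef : typ F -> typ F -> seq (arr F) -> A -> k;
  pcoefD : forall s t w c x y, pcoef s t w (c *: x + y) = c * pcoef s t w x + pcoef s t w y;
  pcoef_wel : forall s t w w', pth s w t -> pth s w' t ->
    pcoef s t w (wel s w') = (w == w')%:R
}.

(** * Polynomial entries, constant terms and multiplication by long paths *)

Section PathForest.
Variables (k : fieldType) (A : nonUnitalAlgType k) (F : ckFamily A) (B : pathBasis F).
Implicit Types (a b : arr F) (s t u : typ F) (w : seq (arr F)) (x y z : A).

Lemma path_coef_mono s t w w' : pth s w t -> pth s w' t ->
  pcoef B s t w (eps s ** wel s w') = ((tt == tt) && (w == w'))%:R.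
Proof. by move=> h h'; rewrite (eps_wel h') pcoef_wel. Qed.

(** With [eps s] as the only root, the path algebra itself is a forest, so matrix entries inherit
    the theory of [fspan]. *)
Definition path_forest s : forest F :=
  @Forest k A F unit (fun=> s) (fun=> eps s) (fun t _ w => pcoef B s t w)
    (fun t _ => @pcoefD _ _ _ B s t)
    (fun t _ w _ w' => @path_coef_mono s t w w').

Definition pspan_lt d s t x := fspan_lt (path_forest s) d t x.
Definition pspan s t x := fspan (path_forest s) t x.

Lemma pspan_wel_lt s w t : pth s w t -> pspan_lt (size w).+1 s t (wel s w).
Proof.
move=> h; have /= := @fspan_mono _ _ _ (path_forest s) tt w t h.
by rewrite /mono /= (eps_wel h).
Qed.

Lemma pspan_wel s w t : pth s w t -> pspan s t (wel s w).
Proof. by move=> h; apply: fspan_ltP (pspan_wel_lt h). Qed.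

Lemma pspan_ind s t (P : A -> Prop) : P 0 -> (forall x y, P x -> P y -> P (x + y)) ->
  (forall c w, pth s w t -> P (c *: wel s w)) ->
  forall x, pspan s t x -> P x.
Proof.
move=> P0 PD Pm; apply: fspan_ind => // c [] w h.
by rewrite /mono /= (eps_wel h); apply: Pm.
Qed.

Lemma pspanM s t u x y : pspan s t x -> pspan t u y -> pspan s u (x ** y).
Proof.
move=> xP; move: y; apply: pspan_ind => [|y z hy hz|c w h].
- by rewrite numulr0; apply: fspan0.
- by rewrite numulDr; apply: fspanD.
- by rewrite -nuscaleAr; apply: fspanZ; apply: fspan_wel xP.
Qed.

(** The augmentation killing all arrows. The value 0 for [s != t] is imposed on every [x],
    polynomial or not, in accordance with the absence of an empty path from [s] to [t]. *)
Definition cst s t x : k := if s == t then pcoef B s t [::] x else 0.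

Lemma cstD s t x y : cst s t (x + y) = cst s t x + cst s t y.
Proof. rewrite /cst; case: eqP => _; last by rewrite addr0.
exact: (@fcoefA _ _ _ (path_forest s) t tt [::] x y). Qed.
Lemma cst0 s t : cst s t 0 = 0.
Proof. rewrite /cst; case: eqP => // _.
exact: (@fcoef0 _ _ _ (path_forest s) t tt [::]). Qed.
Lemma cstZ s t c x : cst s t (c *: x) = c * cst s t x.
Proof. rewrite /cst; case: eqP => _; last by rewrite mulr0.
exact: (@fcoefZ _ _ _ (path_forest s) t tt [::] c x). Qed.
Lemma cst_sum s t (I : Type) (r : seq I) P (G : I -> A) :
  cst s t (\sum_(i <- r | P i) G i) = \sum_(i <- r | P i) cst s t (G i).
Proof. by apply: (big_morph (cst s t)); [exact: cstD|exact: cst0]. Qed.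
Lemma cst_neq s t x : s != t -> cst s t x = 0.
Proof. by rewrite /cst => /negbTE ->. Qed.

Lemma cst_wel s t w : pth s w t -> cst s t (wel s w) = (w == [::])%:R.
Proof.
move=> h; rewrite /cst; case: eqP => [st|]; last by case: w h => //= /eqP.
by rewrite pcoef_wel 1?eq_sym//= st.
Qed.

(** A concatenation of paths is empty only if both paths are, so the augmentation is
    multiplicative. *)
Lemma cstM s t u x y : pspan s t x -> pspan t u y -> cst s u (x ** y) = cst s t x * cst t u y.
Proof.
move=> + yP; move: x; apply: pspan_ind => [|x z hx hz|c w h].
- by rewrite numul0r !cst0 mul0r.
- by rewrite numulDl !cstD hx hz mulrDl.
rewrite -nuscaleAl !cstZ -mulrA; congr (_ * _).
move: y yP; apply: pspan_ind => [|x z hx hz|d w' h'].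
- by rewrite numulr0 !cst0 mulr0.
- by rewrite numulDr !cstD hx hz mulrDr.
rewrite -nuscaleAr !cstZ mulrCA; congr (_ * _).
rewrite -(wel_cat h h') !cst_wel//; last exact: pth_cat h h'.
by case: w {h} => [|a w] /=; rewrite ?mul1r ?mul0r.
Qed.

Lemma eps_neq0 s : eps s <> 0 :> A.
Proof.
move=> e; have /eqP := @cst_wel s s [::] (eqxx _).
by rewrite /= e cst0 eq_sym oner_eq0.
Qed.

Lemma pspan_cst d s t x : pspan_lt d s t x -> exists l : seq (k * seq (arr F)),
  (forall m, m \in l -> [/\ pth s m.2 t, (size m.2 < d)%N & m.2 != [::]]) /\
  x = cst s t x *: eps s + \sum_(m <- l) m.1 *: wel s m.2.
Proof.
move=> [l [lP ->]]; elim: l lP => [|[c [[] w]] l IH] lP.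
  by exists [::]; rewrite /mono_sum !big_nil cst0 scale0r addr0.
case: IH => [m ml|l' [l'P e]]; first by apply: lP; rewrite inE ml orbT.
rewrite /mono_sum big_cons -/(mono_sum l) /=.
have [/= pw sw] := lP _ (mem_head _ _).
rewrite cstD cstZ /mono /= (eps_wel pw) cst_wel// scalerDl {1}e addrA.
case: w pw sw {lP} => [|a w] pw sw; rewrite ?mulr1 ?mulr0 ?scale0r.
  by exists l'; rewrite /=.
exists ((c, a :: w) :: l'); split.
  by move=> m; rewrite inE => /orP[/eqP ->//|/l'P].
by rewrite add0r big_cons /= -addrA addrCA.
Qed.

(** Every path occurring in [x] has a first arrow, which [gh a] deletes if it is [a]; otherwise the
    path is killed. A constant term would leave a multiple of [gh a], which is no combination of
    paths. *)
Lemma gh_pspan_lt d s t x a : a \in outs s -> pspan_lt d s t x -> cst s t x = 0 ->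
  pspan_lt d.-1 (atgt a) t (gh a ** x).
Proof.
move=> ha xP c0; have [l [lP ->]] := pspan_cst xP; rewrite c0 scale0r add0r.
rewrite numul_sumr; apply: fspan_lt_sum => -[c [|b w]] /lP[]//= /andP[hb pw] sw _ _.
rewrite -nuscaleAr; apply: fspan_ltZ; rewrite numulA (gh_el ha hb).
case: eqP => [->|_]; last by rewrite numul0r; exact: fspan_lt0.
rewrite (eps_wel pw); apply: (fspan_lt_weak _ (pspan_wel_lt pw)).
by case: d sw {xP lP}.
Qed.

Lemma gh_pspan s t x a : a \in outs s -> pspan s t x -> cst s t x = 0 ->
  pspan (atgt a) t (gh a ** x).
Proof. by move=> ha [d h] c0; exists d.-1; apply: gh_pspan_lt c0. Qed.

Lemma pspan_outs_nil s t x : outs s = [::] -> pspan s t x -> cst s t x = 0 -> x = 0.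
Proof.
move=> o [d xP] c0; have [l [lP ->]] := pspan_cst xP; rewrite c0 scale0r add0r.
by rewrite big_seq big1// => -[c [|b w]] /lP[]//=; rewrite o.
Qed.

(* The ghost edges of [x] are absorbed by multiplication with paths of length at
   least [n]; a path ending at a sink cannot be prolonged. *)
Definition eventually (Q : forest F) n t x : Prop := forall w u, pth t w u ->
  (n <= size w)%N \/ outs u = [::] -> fspan Q u (x ** wel t w).
Definition evfspan (Q : forest F) t x := exists n, eventually Q n t x.
Definition evspan s t x := evfspan (path_forest s) t x.

Lemma eventually_weak Q m n t x : (m <= n)%N -> eventually Q m t x -> eventually Q n t x.
Proof. by move=> mn h w u p [nw|o]; apply: h => //; [left; apply: leq_trans nw|right]. Qed.

Lemma eventually_fspan Q t x : x ** eps t = x -> eventually Q 0 t x -> fspan Q t x.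
Proof. by move=> e h; rewrite -e; apply: (h [::] t); rewrite /= ?eqxx//; left. Qed.

(** At a sink the empty path already counts as long. *)
Lemma eventually_outs_nil Q n t x :
  outs t = [::] -> eventually Q n t x -> eventually Q 0 t x.
Proof.
move=> o h [|a w] u /=; last by rewrite o.
by move=> /eqP <- _; apply: (h [::]); rewrite /= ?eqxx//; right.
Qed.

Lemma eventually_el Q n t x a : a \in outs t ->
  eventually Q n t x -> eventually Q n.-1 (atgt a) (x ** el a).
Proof.
move=> ha h w u p sw; rewrite -numulA; apply: (h (a :: w)); rewrite /= ?ha//.
by case: sw => [sw|]; [left; rewrite -ltnS in sw; apply: leq_trans (leqSpred _) sw|right].
Qed.

Lemma evfspan_fspan Q t x : fspan Q t x -> evfspan Q t x.
Proof. by move=> h; exists 0%N => w u p _; apply: fspan_wel h. Qed.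

Lemma evfspanD Q t x y : evfspan Q t x -> evfspan Q t y -> evfspan Q t (x + y).
Proof.
move=> [m hx] [n hy]; exists (maxn m n) => w u p o; rewrite numulDl; apply: fspanD.
  exact: (eventually_weak (leq_maxl m n) hx).
exact: (eventually_weak (leq_maxr m n) hy).
Qed.

Lemma evfspanZ Q t c x : evfspan Q t x -> evfspan Q t (c *: x).
Proof. by move=> [m h]; exists m => w u p o; rewrite -nuscaleAl; apply: fspanZ; apply: h. Qed.

Lemma evfspan0 Q t : evfspan Q t 0.
Proof. by exists 0%N => w u p o; rewrite numul0r; apply: fspan0. Qed.

Lemma evfspan_sum Q t (I : eqType) (r : seq I) (P : pred I) (G : I -> A) :
  (forall i, i \in r -> P i -> evfspan Q t (G i)) -> evfspan Q t (\sum_(i <- r | P i) G i).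
Proof.
move=> h; rewrite big_seq_cond; apply: (big_ind (evfspan Q t)).
- exact: evfspan0.
- exact: evfspanD.
- by move=> i /andP[/h].
Qed.

Lemma evfspan_el Q t x a : a \in outs t -> evfspan Q t x -> evfspan Q (atgt a) (x ** el a).
Proof. by move=> ha [n h]; exists n.-1; apply: eventually_el ha h. Qed.

(** One arrow beyond the first [n] suffices: after [n] arrows the entry is polynomial, and by [cstM]
    the next arrow kills its constant term, as [gh_pspan] demands. For a path into a sink [u] the
    constant term vanishes because [s] emits [a], so [s] differs from [u]. *)
Lemma evspan_gh s t x a : a \in outs s -> x ** eps t = x ->
  evspan s t x -> evspan (atgt a) t (gh a ** x).
Proof.
move=> ha xe [n h]; exists n.+1 => w u; case/lastP: w => [|w b].
  rewrite /= => /eqP <- [|o]; first by rewrite ltn0.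
  rewrite -numulA.
  have xP : pspan s t (x ** eps t) by apply: (h [::]); rewrite /= ?eqxx//; right.
  apply: (gh_pspan ha) => //; apply: cst_neq; apply: contraTN ha => /eqP ->.
  by rewrite o.
rewrite pth_rcons size_rcons ltnS => /andP[p hb] o.
have hb' : b \in outs (asrc b) by move: hb; rewrite insP => /andP[].
have hbu : atgt b = u by move: hb; rewrite insP => /andP[_ /eqP].
have pb : pth t (rcons w b) u by rewrite pth_rcons p hb.
have xP : pspan s u (x ** wel t (rcons w b)).
  apply: h => //; rewrite size_rcons; case: o => [o|]; [left|right] => //.
  exact: leqW.
have [nw|nw] := leqP n (size w); last first.
  case: o => [|o]; first by rewrite leqNgt nw.
  rewrite -numulA; apply: (gh_pspan ha) => //; apply: cst_neq; apply: contraTN ha => /eqP ->.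
  by rewrite o.
rewrite -numulA; apply: (gh_pspan ha) => //.
rewrite (wel_rcons p hb') numulA (@cstM _ (asrc b)); first last.
- have := @pspan_wel (asrc b) [:: b] u; rewrite /= hb' hbu eqxx => /(_ isT).
  by rewrite -hbu el_eps.
- by apply: h => //; left.
have := @cst_wel (asrc b) u [:: b]; rewrite /= hb' hbu eqxx => /(_ isT).
by rewrite -hbu el_eps => ->; rewrite mulr0.
Qed.

End PathForest.

(** * Frames of an idempotent *)

Definition pairf (X : Type) n m (f : 'I_n -> X) (g : 'I_m -> X) : 'I_(n + m) -> X :=
  fun i => match fintype.split i with inl j => f j | inr l => g l end.

Lemma pairf_l (X : Type) n m (f : 'I_n -> X) (g : 'I_m -> X) j : pairf f g (lshift m j) = f j.
Proof. by rewrite /pairf; case: split_ordP => l /eqP; rewrite ?eq_shift// => /eqP ->. Qed.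

Lemma pairf_r (X : Type) n m (f : 'I_n -> X) (g : 'I_m -> X) l : pairf f g (rshift n l) = g l.
Proof. by rewrite /pairf; case: split_ordP => j /eqP; rewrite ?eq_shift// => /eqP ->. Qed.

Lemma pairf_ind n m (P : 'I_(n + m) -> Prop) :
  (forall j, P (lshift m j)) -> (forall l, P (rshift n l)) -> forall i, P i.
Proof. by move=> hl hr i; case: (split_ordP i) => j ->. Qed.

Definition repl (X : Type) n m (f : 'I_n.+1 -> X) (J : 'I_n.+1) (g : 'I_m -> X) :
    'I_(n + m) -> X :=
  pairf (fun j => f (lift J j)) g.

Lemma repl_l (X : Type) n m (f : 'I_n.+1 -> X) J (g : 'I_m -> X) j :
  repl f J g (lshift m j) = f (lift J j).
Proof. exact: pairf_l. Qed.

Lemma repl_r (X : Type) n m (f : 'I_n.+1 -> X) J (g : 'I_m -> X) l :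
  repl f J g (rshift n l) = g l.
Proof. exact: pairf_r. Qed.

Lemma big_repl (M : nmodType) n m (J : 'I_n.+1) (G : 'I_(n + m) -> M) (H : 'I_n.+1 -> M) :
  (forall j, G (lshift m j) = H (lift J j)) ->
  \sum_i G i = \sum_(j | j != J) H j + \sum_l G (rshift n l).
Proof.
move=> GH; rewrite big_split_ord; congr (_ + _); rewrite (eq_bigr _ (fun j _ => GH j)).
rewrite [RHS]big_mkcond (bigD1_ord J)//= eqxx add0r.
by apply: eq_bigr => j _; rewrite eq_sym neq_lift.
Qed.

(** The multiset order on degrees, coded as a number: trading one item of degree d for fewer than
    [K] items of degree d - 1 lowers it. *)
Definition weight K n (d : 'I_n -> nat) : nat := (\sum_i K ^ d i)%N.

Lemma weight_repl K n m (d : 'I_n.+1 -> nat) J e : (m * K ^ e < K ^ d J)%N ->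
  (weight K (repl d J (fun _ : 'I_m => e)) < weight K d)%N.
Proof.
move=> me.
have E : weight K (repl d J (fun _ : 'I_m => e)) =
    (\sum_(j | j != J) K ^ d j + \sum_l K ^ repl d J (fun _ : 'I_m => e) (rshift n l))%N.
  by apply: (@big_repl _ _ _ J _ (fun j => K ^ d j)%N) => j; rewrite repl_l.
rewrite {}E /weight [ltnRHS](bigD1 J)//= addnC ltn_add2r.
by under eq_bigr do rewrite repl_r; rewrite sum_nat_const card_ord.
Qed.

Lemma ltn_mul_expn K m d : (0 < d)%N -> (m < K)%N -> (m * K ^ d.-1 < K ^ d)%N.
Proof.
by case: d => // d _ mK; rewrite expnS ltn_pmul2r// expn_gt0 (leq_ltn_trans _ mK).
Qed.

Section Frames.
Variables (k : fieldType) (A : nonUnitalAlgType k) (F : ckFamily A).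
Implicit Types (a b : arr F) (s t u : typ F) (p : A).

(** An isomorphism of the image of [p] with the direct sum of the images of the [eps (t j)]: [x] is
    the list of its columns and [y] its inverse. The family [t] is the type of the frame. *)
Record frame p n (t : 'I_n -> typ F) (x y : 'I_n -> A) : Prop := Frame {
  frame_x : forall j, x j ** eps (t j) = x j;
  frame_y : forall j, eps (t j) ** y j = y j;
  frame_orth : forall i j, y i ** x j = if i == j then eps (t i) else 0;
  frame_sum : \sum_j x j ** y j = p
}.

Lemma frame_px p n (t : 'I_n -> typ F) x y j : frame p t x y -> p ** x j = x j.
Proof.
case=> fx fy fo <-; rewrite numul_suml (bigD1 j)//= big1 ?addr0 => [|i ij].
  by rewrite -numulA fo eqxx fx.
by rewrite -numulA fo (negbTE ij) numulr0.
Qed.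

Lemma frame_yp p n (t : 'I_n -> typ F) x y j : frame p t x y -> y j ** p = y j.
Proof.
case=> fx fy fo <-; rewrite numul_sumr (bigD1 j)//= big1 ?addr0 => [|i ij].
  by rewrite numulA fo eqxx fy.
by rewrite numulA fo eq_sym (negbTE ij) numul0r.
Qed.

Definition arrow_of t (l : 'I_(size (outs t))) : arr F := tnth (in_tuple (outs t)) l.

Lemma arrow_of_in t l : @arrow_of t l \in outs t.
Proof. exact: mem_tnth. Qed.

Lemma sum_arrow_of (M : nmodType) t (G : arr F -> M) :
  \sum_l G (@arrow_of t l) = \sum_(a <- outs t) G a.
Proof. by rewrite [RHS]big_tnth. Qed.

Lemma frame_expand p n (t : 'I_n.+1 -> typ F) x y J : outs (t J) != [::] -> frame p t x y ->
  frame p (repl t J (fun l => atgt (@arrow_of (t J) l)))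
    (repl x J (fun l => x J ** el (@arrow_of (t J) l)))
    (repl y J (fun l => gh (@arrow_of (t J) l) ** y J)).
Proof.
move=> o [fx fy fo fs]; split.
- by apply: pairf_ind => j; rewrite !(repl_l, repl_r)// -numulA el_eps.
- by apply: pairf_ind => j; rewrite !(repl_l, repl_r)// numulA eps_gh.
- apply: pairf_ind => i; apply: pairf_ind => j; rewrite !(repl_l, repl_r) eq_shift.
  + by rewrite fo (inj_eq (@lift_inj _ J)).
  + by rewrite numulA fo [lift _ _ == _]eq_sym (negbTE (neq_lift _ _)) numul0r.
  + by rewrite -numulA fo (negbTE (neq_lift _ _)) numulr0.
  + rewrite -numulA (numulA (y J)) fo eqxx numulA.
    have := gh_eps (arrow_of i); rewrite (outsP (arrow_of_in i)) => ->.
    rewrite (gh_el (arrow_of_in i) (arrow_of_in j)).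
    by rewrite (inj_eq (tuple_uniqP (in_tuple _) (outs_uniq _))).
- rewrite -fs (@big_repl _ _ _ J _ (fun j => x j ** y j)) => [|j]; last by rewrite !repl_l.
  rewrite [RHS](bigD1 J)//= addrC; congr (_ + _).
  under eq_bigr do rewrite !repl_r numulA -(numulA (x J)).
  rewrite -numul_suml -numul_sumr (@sum_arrow_of _ (t J) (fun a => el a ** gh a)).
  by rewrite -eps_sum// fx.
Qed.

(** An elementary change of basis: the row [y J] becomes a combination of rows, and the columns
    undergo the inverse operation. Scalars act between summands of equal type only, hence the
    condition on the support of [lam]. *)
Lemma frame_combine p n (t : 'I_n -> typ F) x y J (lam : 'I_n -> k) :
  lam J != 0 -> (forall j, lam j != 0 -> t j = t J) -> frame p t x y ->
  frame p t (fun j => if j == J then (lam J)^-1 *: x J else x j - (lam j / lam J) *: x J)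
    (fun j => if j == J then \sum_i lam i *: y i else y j).
Proof.
move=> lJ lt [fx fy fo fs].
have ltZ j z : lam j *: (z ** eps (t j)) = lam j *: (z ** eps (t J)).
  by have [->|/lt ->] := eqVneq (lam j) 0; rewrite ?scale0r.
have fxJ j : lam j *: x J ** eps (t j) = lam j *: x J.
  by rewrite -nuscaleAl ltZ fx.
split.
- move=> j; case: eqP => [->|_]; first by rewrite -nuscaleAl fx.
  rewrite numulDl fx numulNr; congr (_ - _).
  by rewrite mulrC -scalerA -nuscaleAl fxJ.
- move=> j; case: eqP => [->|_]; last exact: fy.
  rewrite numul_sumr; apply: eq_bigr => i _; rewrite -nuscaleAr.
  by have [->|/lt <-] := eqVneq (lam i) 0; rewrite ?scale0r// fy.
- move=> i j; have lamx l : (\sum_i lam i *: y i) ** x l = lam l *: eps (t l).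
    rewrite numul_suml (bigD1 l)//= big1 ?addr0 => [|i' il].
      by rewrite -nuscaleAl fo eqxx.
    by rewrite -nuscaleAl fo (negbTE il) scaler0.
  case: (i =P J) => [->|/eqP iJ]; case: (j =P J) => [->|/eqP jJ].
  + by rewrite eqxx -nuscaleAr lamx scalerA mulVf// scale1r.
  + rewrite numulDr numulrN -nuscaleAr !lamx scalerA divfK// eq_sym (negbTE jJ).
    by have [->|/lt ->] := eqVneq (lam j) 0; rewrite ?scale0r ?subrr.
  + by rewrite -nuscaleAr fo (negbTE iJ) scaler0.
  + by rewrite numulDr numulrN -nuscaleAr !fo (negbTE iJ) scaler0 subr0.
- rewrite (bigD1 J)//= eqxx.
  rewrite [X in _ + X](eq_bigr (fun j => x j ** y j - (lam j / lam J) *: (x J ** y j))); last first.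
    by move=> j /negbTE ->; rewrite numulDl numulNr -nuscaleAl.
  rewrite sumrB addrCA -fs [RHS](bigD1 J)//= addrC; congr (_ + _).
  rewrite -nuscaleAl numul_sumr scaler_sumr (bigD1 J)//=.
  rewrite -addrA -[RHS]addr0 -nuscaleAr scalerA mulVf// scale1r; congr (_ + _).
  apply/eqP; rewrite subr_eq0; apply/eqP; apply: eq_bigr => j _.
  by rewrite -nuscaleAr scalerA mulrC.
Qed.

Lemma frame_equiv p (q u v : A) n (t : 'I_n -> typ F) x y : p ** p = p ->
  p = u ** v -> q = v ** u -> frame q t x y ->
  frame p t (fun j => u ** x j) (fun j => y j ** v).
Proof.
move=> pp pE qE fr; have [fx fy fo fs] := fr; split.
- by move=> j; rewrite -numulA fx.
- by move=> j; rewrite numulA fy.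
- move=> i j; rewrite numulA -(numulA (y i)) -qE (frame_yp i fr); exact: fo.
- transitivity (u ** q ** v); last by rewrite qE numulA -pE -numulA -pE pp.
  by rewrite -fs numul_sumr numul_suml; apply: eq_bigr => j _; rewrite !numulA.
Qed.

End Frames.

(** * Uniqueness of the class of a frame *)

Section Uniqueness.
Variables (k : fieldType) (A : nonUnitalAlgType k) (F : ckFamily A) (B : pathBasis F).
Variables (M : nmodType) (cls : typ F -> M).
Hypothesis cls_outs : forall t, outs t != [::] -> cls t = \sum_(a <- outs t) cls (atgt a).
Implicit Types (a b : arr F) (s t u : typ F) (p : A).

Lemma cls_expand n (t : 'I_n.+1 -> typ F) J : outs (t J) != [::] ->
  \sum_j cls (repl t J (fun l => atgt (@arrow_of _ _ F (t J) l)) j) = \sum_j cls (t j).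
Proof.
move=> o; rewrite (@big_repl _ _ _ J _ (fun j => cls (t j))) => [|j]; last by rewrite repl_l.
rewrite [RHS](bigD1 J)//= addrC; congr (_ + _).
under eq_bigr do rewrite repl_r.
by rewrite (sum_arrow_of _ (fun a => cls (atgt a))) -cls_outs.
Qed.

Variables (p : A) (m : nat) (s : 'I_m -> typ F) (X Y : 'I_m -> A).
Hypothesis frXY : frame p s X Y.

(** Expanding the summand [J] multiplies its column by each outgoing arrow, so one arrow fewer has
    to be awaited. A column that still waits does not end at a sink, by [eventually_outs_nil]. The
    products [y ** X] acquire ghost arrows on the left and remain eventually polynomial by
    [evspan_gh]. *)
Lemma expand_columns n (t : 'I_n -> typ F) x y : frame p t x y ->
  (forall i j, evspan B (s i) (t j) (Y i ** x j)) ->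
  (forall i j, evspan B (t j) (s i) (y j ** X i)) ->
  exists n' (t' : 'I_n' -> typ F) x' y',
   [/\ frame p t' x' y', forall i j, pspan B (s i) (t' j) (Y i ** x' j),
       forall i j, evspan B (t' j) (s i) (y' j ** X i)
     & \sum_j cls (t' j) = \sum_j cls (t j)].
Proof.
move=> fr Yx yX; have [d dP] : exists d : 'I_n -> nat, forall i j,
    eventually (path_forest B (s i)) (d j) (t j) (Y i ** x j).
  have /choice[D DP] (ij : 'I_m * 'I_n) :
      exists e, eventually (path_forest B (s ij.1)) e (t ij.2) (Y ij.1 ** x ij.2) by apply: Yx.
  exists (fun j => \max_i D (i, j))%N => i j; apply: eventually_weak (DP (i, j)).
  exact: (leq_bigmax_cond (F := fun i => D (i, j))).
have [N] := ubnP (weight (branching F) d).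
elim: N n t x y d fr dP yX {Yx} => // N IH n t x y d fr dP yX dN.
have [all0|/existsNP[J /existsNP[i0 Ji]]] :=
  pselect (forall j i, eventually (path_forest B (s i)) 0 (t j) (Y i ** x j)).
  exists n, t, x, y; split=> // i j; apply: eventually_fspan => //.
  by rewrite -numulA (frame_x fr).
have dJ : (0 < d J)%N by case: posnP => // dJ; case: Ji; rewrite -dJ.
have o : outs (t J) != [::] by apply/eqP => o; apply: Ji; apply: eventually_outs_nil (dP i0 J).
case: n t x y d fr dP yX J dN Ji dJ o => [|n] t x y d fr dP yX J dN Ji dJ o.
  by case: J {Ji dJ o}.
case: (IH _ _ _ _ (repl d J (fun _ : 'I_(size (outs (t J))) => (d J).-1))
    (frame_expand o fr)) => [||| n' [t' [x' [y' [h1 h2 h3 h4]]]]]; last first.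
- exists n', t', x', y'; split=> //.
  by rewrite h4; apply: cls_expand.
- by rewrite ltnS in dN; apply: leq_trans dN; apply: weight_repl;
  apply: ltn_mul_expn; rewrite ?size_outs.
- move=> i; apply: pairf_ind => j; rewrite !(repl_l, repl_r)// -numulA.
  apply: evspan_gh => //; first exact: arrow_of_in.
  by rewrite -numulA (frame_x frXY).
- move=> i; apply: pairf_ind => j; rewrite !(repl_l, repl_r)//.
  by rewrite numulA; apply: eventually_el => //; apply: arrow_of_in.
Qed.

Definition cst_mx n (t : 'I_n -> typ F) (y : 'I_n -> A) : 'M[k]_(n, m) :=
  \matrix_(j, i) cst B (t j) (s i) (y j ** X i).

Lemma pspan_row_eq0 n (t : 'I_n -> typ F) x y j : frame p t x y ->
  (forall i, y j ** X i = 0) -> False.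
Proof.
move=> fr yX; apply: (@eps_neq0 _ _ _ B (t j)).
have := frame_orth fr j j; rewrite eqxx => <-.
rewrite -(frame_yp j fr) -(frame_sum frXY) numul_sumr big1 ?numul0r// => i _.
by rewrite numulA yX numul0r.
Qed.

(* A linear relation between the rows of constant terms yields a combination of rows
   without constant term; factoring out its first arrows lowers the degrees. *)
Lemma reduce_rows n (t : 'I_n -> typ F) x y : frame p t x y ->
  (forall i j, pspan B (t j) (s i) (y j ** X i)) ->
  (forall i j, evspan B (s i) (t j) (Y i ** x j)) ->
  exists n' (t' : 'I_n' -> typ F) x' y',
   [/\ frame p t' x' y', forall i j, pspan B (t' j) (s i) (y' j ** X i),
       forall i j, evspan B (s i) (t' j) (Y i ** x' j),
       row_free (cst_mx t' y')
     & \sum_j cls (t' j) = \sum_j cls (t j)].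
Proof.
move=> fr yX Yx; have [d dP] : exists d : 'I_n -> nat, forall i j,
    pspan_lt B (d j) (t j) (s i) (y j ** X i).
  have /choice[D DP] (ij : 'I_m * 'I_n) :
      exists e, pspan_lt B e (t ij.2) (s ij.1) (y ij.2 ** X ij.1) by apply: yX.
  exists (fun j => \max_i D (i, j))%N => i j; apply: fspan_lt_weak (DP (i, j)).
  exact: (leq_bigmax_cond (F := fun i => D (i, j))).
have [N] := ubnP (weight (branching F) d).
elim: N n t x y d fr dP Yx {yX} => // N IH n t x y d fr dP Yx dN.
have [free|/negP/negP] := boolP (row_free (cst_mx t y)).
  by exists n, t, x, y; split=> // i j; apply: fspan_ltP (dP i j).
rewrite -kermx_eq0 => /rowV0Pn[v /sub_kermxP vC /rV0Pn[j0 vj0]].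
(* Constant terms between different types vanish, so a vector of the left kernel may be cut down to
   the rows of a single type and stays in the kernel. *)
pose lam j := if t j == t j0 then v 0 j else 0.
have lj0 : lam j0 != 0 by rewrite /lam eqxx.
(* The row of highest degree in the relation is the one replaced, so that the combination does not
   exceed its degree. *)
case: (@arg_maxnP _ j0 (fun j => lam j != 0) d lj0) => J lJ dmax.
have tJ : t J = t j0 by apply/eqP; move: lJ; rewrite /= /lam; case: ifP; rewrite ?eqxx.
have ltJ j : lam j != 0 -> t j = t J.
  by rewrite /lam tJ; case: (t j =P _) => //; rewrite eqxx.
pose yJ := \sum_j lam j *: y j.
have yJc i : cst B (t J) (s i) (yJ ** X i) = 0.
  rewrite numul_suml cst_sum.
  have [tsi|] := eqVneq (t J) (s i); last first.
    by move=> tsi; rewrite big1// => j _; rewrite cst_neq.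
  have := congr1 (fun C : 'M_(_, _) => C 0 i) vC; rewrite !mxE => /esym e.
  rewrite [RHS]e; apply: eq_bigr => j _; rewrite -nuscaleAl cstZ mxE /lam -tJ.
  case: eqP => [->//|/eqP tj]; rewrite mul0r cst_neq ?mulr0//.
  by rewrite -tsi.
have yJd i : pspan_lt B (d J) (t J) (s i) (yJ ** X i).
  rewrite numul_suml; apply: fspan_lt_sum => j _ _; rewrite -nuscaleAl.
  have [->|lj] := eqVneq (lam j) 0; first by rewrite scale0r; apply: fspan_lt0.
  by apply: fspan_ltZ; rewrite -(ltJ _ lj); apply: fspan_lt_weak (dP i j); apply: dmax.
have fr' := frame_combine lJ ltJ fr.
(* The combined row belongs to a frame and cannot vanish. Hence its degree is positive, and having
   no constant term it cannot start at a sink. *)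
have yJ0 : ~ (forall i, yJ ** X i = 0).
  by move=> h; apply: (@pspan_row_eq0 _ _ _ _ J fr') => i; rewrite eqxx.
have dJ : (0 < d J)%N.
  case: posnP => // dJ; case: yJ0 => i; have := yJd i; rewrite dJ.
  exact: fspan_lt0_eq.
have o : outs (t J) != [::].
  apply/eqP => o; apply: yJ0 => i.
  exact: (pspan_outs_nil o (fspan_ltP (yJd i)) (yJc i)).
have {}Yx i j : evspan B (s i) (t j)
    (Y i ** (if j == J then (lam J)^-1 *: x J else x j - (lam j / lam J) *: x J)).
  case: eqP => [->|_]; first by rewrite -nuscaleAr; apply/evfspanZ/Yx.
  rewrite numulDr numulrN; apply: evfspanD; first exact: Yx.
  rewrite -scaleN1r; apply: evfspanZ.
  rewrite -nuscaleAr; have [->|/ltJ ->] := eqVneq (lam j) 0; last by apply/evfspanZ/Yx.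
  by rewrite mul0r scale0r; apply: evfspan0.
have {fr yJ0} [x1 [y1 [fr1 y1J y1n Yx1]]] : exists x1 y1,
    [/\ frame p t x1 y1, y1 J = yJ, forall j, j != J -> y1 j = y j
      & forall i j, evspan B (s i) (t j) (Y i ** x1 j)].
  by do 2!eexists; split; [exact: fr'|rewrite /= eqxx|move=> j /negbTE /= ->|exact: Yx].
clearbody yJ; move: {fr' x Yx lam lJ ltJ tJ lj0 dmax vC vj0 v j0} yJc yJd o dJ.
case: n t x1 y1 y d fr1 dP Yx1 J dN y1J y1n
   => [|n] t x1 y1 y d fr1 dP Yx1 J dN y1J y1n yJc yJd o dJ.
  by case: J {yJc yJd o dJ y1J y1n}.
case: (IH _ _ _ _ (repl d J (fun _ : 'I_(size (outs (t J))) => (d J).-1))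
    (frame_expand o fr1)) => [||| n' [t' [x' [y' [h1 h2 h3 h4 h5]]]]]; last first.
- exists n', t', x', y'; split=> //.
  by rewrite h5; apply: cls_expand.
- by rewrite ltnS in dN; apply: leq_trans dN; apply: weight_repl;
  apply: ltn_mul_expn; rewrite ?size_outs.
- move=> i; apply: pairf_ind => j; rewrite !(repl_l, repl_r)// numulA.
  by apply: evfspan_el; [apply: arrow_of_in|apply: Yx1].
- move=> i; apply: pairf_ind => j; rewrite !(repl_l, repl_r).
    by rewrite y1n// eq_sym neq_lift.
  rewrite -numulA y1J; apply: gh_pspan_lt => //; exact: arrow_of_in.
Qed.

(* Nakayama: modulo paths of positive length each [x j] is a combination of the
   [X i], and long paths send every [x j] into the span of the [X i]. *)
Lemma rows_onto n (t : 'I_n -> typ F) x y : frame p t x y ->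
  (forall i j, pspan B (t j) (s i) (y j ** X i)) ->
  (forall i j, evspan B (s i) (t j) (Y i ** x j)) ->
  row_free (cst_mx t y) -> forall i j, pspan B (s i) (t j) (Y i ** x j).
Proof.
move=> fr yX Yx free.
(* A right inverse of the matrix of constant terms, cut down to pairs of equal type; in [CE] the
   discarded entries only meet zero constant terms. *)
pose C i j := if s i == t j then pinvmx (cst_mx t y) i j else 0.
have CE j j' : t j' = t j ->
    \sum_i C i j * cst B (t j') (s i) (y j' ** X i) = (j' == j)%:R.
  move=> tj; have := congr1 (fun D : 'M_(_, _) => D j' j) (mulmxVp free).
  rewrite !mxE => <-; apply: eq_bigr => i _; rewrite mxE /C.
  by have [e|ne] := eqVneq (s i) (t j); rewrite mulrC// cst_neq ?(mul0r, mulr0)// tj eq_sym.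
have CeqP i j (z : A) : C i j *: (z ** eps (s i)) = C i j *: (z ** eps (t j)).
  by rewrite /C; case: eqP => [->//|_]; rewrite !scale0r.
(* The error made when [x j] is approximated by [\sum_i C i j *: X i], in coordinates of the frame
   [x], [y]; it has no constant term. *)
pose r j j' := \sum_i C i j *: (y j' ** X i) - (if j' == j then eps (t j) else 0).
have rP j j' : pspan B (t j') (t j) (r j j').
  apply: fspanD.
    apply: fspan_sum => i _ _; rewrite /C; case: eqP => [<-|_]; first by apply: fspanZ; apply: yX.
    by rewrite scale0r; apply: fspan0.
  apply: fspanN; case: eqP => [->|_]; last exact: fspan0.
  by apply: (@pspan_wel _ _ _ _ _ [::]); rewrite /= eqxx.
have rc j j' : cst B (t j') (t j) (r j j') = 0.
  have [tj|] := eqVneq (t j') (t j); last exact: cst_neq.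
  rewrite cstD cst_sum -scaleN1r cstZ mulN1r.
  have -> : cst B (t j') (t j) (if j' == j then eps (t j) else 0) = (j' == j)%:R.
    case: eqP => [->|_]; last by rewrite cst0.
    by have /= -> := @cst_wel _ _ _ B (t j) (t j) [::] (eqxx _).
  rewrite -(CE j j' tj); apply/eqP; rewrite subr_eq0; apply/eqP; apply: eq_bigr => i _.
  by rewrite cstZ /C; case: eqP => [->//|_]; rewrite !mul0r.
have xE j : x j = \sum_i C i j *: X i - \sum_j' x j' ** r j j'.
  apply/eqP; rewrite eq_sym subr_eq; apply/eqP.
  transitivity (\sum_j' x j' ** (\sum_i C i j *: (y j' ** X i))).
    under [RHS]eq_bigr do rewrite numul_sumr.
    rewrite exchange_big; apply: eq_bigr => i _ /=.
    rewrite -{1}(frame_px i frXY) -(frame_sum fr) numul_suml scaler_sumr.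
    by apply: eq_bigr => j' _; rewrite -nuscaleAr numulA.
  have -> : x j = \sum_j' x j' ** (if j' == j then eps (t j) else 0).
    rewrite (bigD1 j)//= eqxx (frame_x fr) big1 ?addr0// => i /negbTE ->.
    exact: numulr0.
  by rewrite -big_split; apply: eq_bigr => j' _; rewrite /= -numulDr /r addrC subrK.
have [N NP] : exists N, forall i j, eventually (path_forest B (s i)) N (t j) (Y i ** x j).
  have /choice[D DP] (ij : 'I_m * 'I_n) :
      exists e, eventually (path_forest B (s ij.1)) e (t ij.2) (Y ij.1 ** x ij.2) by apply: Yx.
  exists (\max_ij D ij)%N => i j; apply: eventually_weak (DP (i, j)).
  exact: leq_bigmax.
suff H0 : forall i j, eventually (path_forest B (s i)) 0 (t j) (Y i ** x j).
  by move=> i j; apply: eventually_fspan => //; rewrite -numulA (frame_x fr).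
(* The waiting length is lowered from N + 1 to N by inserting [xE]: the [X] part is polynomial at
   once, and every path [v] of the error is nonempty, so [v ++ w] has length N + 1 as soon as [w]
   has length N. *)
elim: N NP => // N IH NP; apply: IH => i j w u pw sw.
rewrite [in Y i ** x j]xE numulDr numulrN numulDl; apply: fspanD.
  rewrite numul_sumr numul_suml; apply: fspan_sum => i' _ _.
  rewrite -nuscaleAr -nuscaleAl (frame_orth frXY).
  case: (i =P i') => [<-|_]; last by rewrite numul0r scaler0; apply: fspan0.
  rewrite /C; case: eqP => [->|_]; last by rewrite scale0r; apply: fspan0.
  by rewrite (eps_wel pw); apply: fspanZ; apply: pspan_wel.
rewrite numulNr; apply: fspanN; rewrite numul_sumr numul_suml; apply: fspan_sum => j' _ _.
have [d rd] := rP j j'; have [l [lP ->]] := pspan_cst rd.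
rewrite rc scale0r add0r !numul_sumr numul_suml; apply: fspan_sum => -[c v] /lP[pv _ v0] _.
rewrite -!nuscaleAr -nuscaleAl numulA -numulA; apply: fspanZ.
rewrite -(wel_cat pv pw); apply: NP; first exact: pth_cat pv pw.
case: sw => [sw|]; last by right.
left; case: v v0 {pv} => // a v _; rewrite /= size_cat ltnS.
exact: leq_trans (leq_addl _ _).
Qed.

End Uniqueness.

Section Uniqueness2.
Variables (k : fieldType) (A : nonUnitalAlgType k) (F : ckFamily A) (B : pathBasis F).
Implicit Types (a b : arr F) (s t u : typ F) (p : A).

(** Constant terms vanish between different types, so by multiplicativity the blocks of type [u] of
    the two change-of-basis matrices already satisfy C D = 1 over the field; such a product bounds
    the number of rows of C by its number of columns. *)
Lemma polynomial_frames_le p m (s : 'I_m -> typ F) X Y n (t : 'I_n -> typ F) x y u :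
  frame p s X Y -> frame p t x y ->
  (forall i j, pspan B (s i) (t j) (Y i ** x j)) ->
  (forall i j, pspan B (t j) (s i) (y j ** X i)) ->
  (#|[pred j | t j == u]| <= #|[pred i | s i == u]|)%N.
Proof.
move=> frs frt Yx yX; set J := [pred j | _]; set I := [pred i | _].
pose C := \matrix_(j < #|J|, i < #|I|)
   cst B (t (enum_val j)) (s (enum_val i)) (y (enum_val j) ** X (enum_val i)).
pose D := \matrix_(i < #|I|, j < #|J|)
   cst B (s (enum_val i)) (t (enum_val j)) (Y (enum_val i) ** x (enum_val j)).
apply: (@mulmx1_min _ _ _ C D); apply/matrixP => j j'; rewrite !mxE.
have tu (l : 'I_#|J|) : t (enum_val l) = u by have := enum_valP l; rewrite inE => /eqP.
transitivity (cst B (t (enum_val j)) (t (enum_val j')) (y (enum_val j) ** x (enum_val j')));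
  last first.
  rewrite (frame_orth frt) (inj_eq enum_val_inj) !tu.
  case: eqP => _; last by rewrite cst0.
  by have /= -> := @cst_wel _ _ _ B u u [::] (eqxx _).
rewrite -(frame_yp _ frt) -(frame_sum frs) numul_sumr numul_suml cst_sum.
rewrite (bigID I)/= [X in _ + X]big1 ?addr0 => [|i si]; last first.
  rewrite numulA -numulA (cstM (yX i _) (Yx i _)).
  by rewrite cst_neq ?mul0r// tu eq_sym.
transitivity (\sum_(i in I) cst B (t (enum_val j)) (s i) (y (enum_val j) ** X i) *
  cst B (s i) (t (enum_val j')) (Y i ** x (enum_val j'))).
  by rewrite [RHS]big_enum_val; apply: eq_bigr => i _; rewrite !mxE.
by apply: eq_bigr => i _; rewrite numulA -numulA (cstM (yX i _) (Yx i _)).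
Qed.

Lemma polynomial_frames_sum (M : nmodType) (cls : typ F -> M)
    p m (s : 'I_m -> typ F) X Y n (t : 'I_n -> typ F) x y :
  frame p s X Y -> frame p t x y ->
  (forall i j, pspan B (s i) (t j) (Y i ** x j)) ->
  (forall i j, pspan B (t j) (s i) (y j ** X i)) ->
  \sum_j cls (t j) = \sum_i cls (s i).
Proof.
move=> frs frt Yx yX.
have sumE N (r : 'I_N -> typ F) : \sum_j cls (r j) = \sum_(u <- codom r) cls u.
  by rewrite /codom /image_mem big_map big_enum.
rewrite !sumE; apply: perm_big; apply/allP => u _ /=.
have countE N (r : 'I_N -> typ F) : count_mem u (codom r) = #|[pred j | r j == u]|.
  rewrite /codom /image_mem count_map cardE -size_filter enumT.
  by congr size; apply: eq_filter.
rewrite !countE eqn_leq (polynomial_frames_le u frs frt)//.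
by rewrite (polynomial_frames_le u frt frs).
Qed.

Theorem frame_class_uniq (M : nmodType) (cls : typ F -> M) :
  (forall t, outs t != [::] -> cls t = \sum_(a <- outs t) cls (atgt a)) ->
  forall p m (s : 'I_m -> typ F) X Y n (t : 'I_n -> typ F) x y,
  frame p s X Y -> frame p t x y ->
  (forall i j, evspan B (s i) (t j) (Y i ** x j)) ->
  (forall i j, evspan B (t j) (s i) (y j ** X i)) ->
  \sum_i cls (s i) = \sum_j cls (t j).
Proof.
move=> cO p m s X Y n t x y frs frt Yx yX.
have [n1 [t1 [x1 [y1 [fr1 Yx1 yX1 <-]]]]] := expand_columns cO frs frt Yx yX.
(* The roles are exchanged: the expanded frame stays fixed and the other one is reduced against
   it. *)
have [m2 [s2 [X2 [Y2 [fr2 Yx2 yX2 free <-]]]]] :=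
  reduce_rows cO fr1 frs (fun i j => Yx1 j i) (fun i j => yX1 j i).
have := rows_onto fr1 fr2 Yx2 yX2 free.
move=> h; apply: (polynomial_frames_sum _ fr1 fr2) => // i j; exact: Yx2.
Qed.

End Uniqueness2.

(** * Existence of frames *)

Section WeakAlgorithm.
Variables (k : fieldType) (A : nonUnitalAlgType k) (F : ckFamily A) (B : pathBasis F).
Variable Q : forest F.
Implicit Types (a b : arr F) (s t u : typ F).

Lemma fspanM s t x g : fspan Q s x -> pspan B s t g -> fspan Q t (x ** g).
Proof.
move=> xQ; move: g; apply: pspan_ind => [|x' y hx hy|c w h].
- by rewrite numulr0; apply: fspan0.
- by rewrite numulDr; apply: fspanD.
- by rewrite -nuscaleAr; apply: fspanZ; apply: fspan_wel xQ.
Qed.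

Lemma pspan_lt1 s t z : pspan_lt B 1 s t z -> z = cst B s t z *: eps s.
Proof.
move=> /pspan_cst[l [lP e]]; rewrite [LHS]e big_seq big1 ?addr0// => -[c w] /lP[_].
by case: w.
Qed.

(** Since [eps t] is the sum of the [el a ** gh a], the right multiplications by the arrows leaving
    [t] are jointly injective; this is iterated up to length [n] or a sink. *)
Lemma wel_faithful n t x : x ** eps t = x ->
  (forall w u, pth t w u -> (n <= size w)%N \/ outs u = [::] -> x ** wel t w = 0) -> x = 0.
Proof.
elim: n t x => [|n IH] t x xt h.
  by rewrite -xt; apply: (h [::] t); rewrite /= ?eqxx//; left.
have [o|o] := eqVneq (outs t) [::].
  by rewrite -xt; apply: (h [::] t); rewrite /= ?eqxx//; right.
rewrite -xt (eps_sum o) numul_sumr big_seq big1// => a ha.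
rewrite numulA (IH (atgt a) (x ** el a)) ?numul0r// -?numulA ?el_eps// => w u pw sw.
rewrite -numulA; apply: (h (a :: w) u); rewrite /= ?ha//.
Qed.

Variables (p : A).
Hypothesis pp : p ** p = p.

(* Splitting a relation [\sum_j x j ** g j = 0] along last arrows: either the
   constant terms of the [g j] give the conclusion, or one arrow carries a shorter
   relation. *)
Lemma dependence D n (t : 'I_n -> typ F) (x : 'I_n -> A) u (g : 'I_n -> A) :
  (forall j, fspan Q (t j) (x j)) -> (forall j, p ** x j = x j) ->
  (forall j, pspan_lt B D (t j) u (g j)) -> \sum_j x j ** g j = 0 ->
  ~ (forall j, g j = 0) ->
  exists (v : typ F) (c : 'I_n -> k) (z : arr F -> A) (J : 'I_n),
    [/\ c J != 0, forall j, c j != 0 -> t j = v,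
        forall a, a \in ins v -> fspan Q (asrc a) (z a) /\ p ** z a = z a
      & \sum_j c j *: x j = \sum_(a <- ins v) z a ** el a].
Proof.
move=> xQ px; elim: D u g => [|D IH] u g gD xg g0.
  by case: g0 => j; apply: fspan_lt0_eq (gD j).
have [z0 /choice[y gE]] := choice (fun j => fspan_last (gD j)).
pose c j := cst B (t j) u (z0 j).
have z0E j : z0 j = c j *: eps (t j) by case: (gE j) => h _ _; apply: pspan_lt1.
have cu j : c j != 0 -> t j = u.
  by apply: contraNeq => tu; rewrite /c cst_neq ?eqxx.
pose z a := \sum_j x j ** y j a.
have yP j a : a \in ins u -> pspan B (t j) (asrc a) (y j a).
  by case: (gE j) => _ h _ /h; apply: fspan_ltP.
have zQ a : a \in ins u -> fspan Q (asrc a) (z a).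
  by move=> ai; apply: fspan_sum => j _ _; apply: fspanM (yP j a ai).
have pz a : p ** z a = z a.
  by rewrite numul_sumr; apply: eq_bigr => j _; rewrite numulA px.
have zE : \sum_j c j *: x j + \sum_(a <- ins u) z a ** el a = 0.
  rewrite -[RHS]xg; under [in LHS]eq_bigr do rewrite -(fspan_eps (xQ _)) nuscaleAr -z0E.
  under [X in _ + X = _]eq_bigr do rewrite numul_suml.
  rewrite exchange_big -big_split; apply: eq_bigr => j _ /=.
  have [_ _ ->] := gE j; rewrite numulDr numul_sumr; congr (_ + _).
  by apply: eq_bigr => a _; rewrite numulA.
have [[J cJ]|/forallNP c0] := pselect (exists J, c J != 0).
  exists u, c, (fun a => - z a), J; split=> //.
    by move=> a ai; rewrite numulrN pz; split=> //; apply: fspanN; apply: zQ.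
  move/eqP: zE; rewrite addr_eq0 => /eqP ->; rewrite -sumrN.
  by apply: eq_bigr => a _; rewrite numulNr.
have {}c0 j : c j = 0 by apply/eqP/negPn/negP/c0.
have /(fspan_last_eq0 (fspan_lt0 Q 1 u) zQ)[_ z_0] : 0 + \sum_(a <- ins u) z a ** el a = 0.
  by rewrite -[RHS]zE; congr (_ + _); rewrite big1// => j _; rewrite c0 scale0r.
have [a /not_implyP[ai /existsNP[j yj]]] : exists a, ~ (a \in ins u -> forall j, y j a = 0).
  apply/existsNP => y0; apply: g0 => j; have [_ _ ->] := gE j.
  rewrite z0E c0 scale0r add0r big_seq big1// => a ai.
  by rewrite y0// numul0r.
apply: (IH (asrc a) (fun j => y j a)) => //.
- by move=> i; case: (gE i) => _ /(_ a ai).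
- exact: z_0.
Qed.

(** The row [y] maps the free module to eventually polynomial elements. This makes the products
    [y i ** x j] accessible to polynomial independence of the [x j]. *)
Definition tame s y := forall u z, fspan Q u z -> evspan B s u (y ** z).

(* Weak algorithm: a dependent system of generators is replaced by one of smaller
   weight, trading a generator of highest degree in the relation for the [z a]. *)
Theorem frame_of_generators n (t : 'I_n -> typ F) (x y : 'I_n -> A) :
  (forall j, fspan Q (t j) (x j)) -> (forall j, p ** x j = x j) ->
  (forall j, eps (t j) ** y j = y j) -> (forall j, tame (t j) (y j)) ->
  \sum_j x j ** y j = p ->
  exists n' (t' : 'I_n' -> typ F) x' y', frame p t' x' y'.
Proof.
move=> xQ; have [d dP] := choice xQ.
have [N] := ubnP (weight (branching F) d).
elim: N n t x y d dP {xQ} => // N IH n t x y d xd dN px ey yt xy.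
have xQ j : fspan Q (t j) (x j) by apply: fspan_ltP (xd j).
have [indep|/existsNP[u /existsNP[g /not_implyP[gP /not_implyP[xg g0]]]]] :=
  pselect (forall u (g : 'I_n -> A), (forall j, pspan B (t j) u (g j)) ->
    \sum_j x j ** g j = 0 -> forall j, g j = 0).
  exists n, t, x, (fun j => y j ** p); split.
  - by move=> j; apply: fspan_eps.
  - by move=> j; rewrite numulA ey.
  (* For a fixed column [j] the defects [b l] satisfy a relation with the [x l]. They are only
     eventually polynomial, so independence is applied after multiplication by long paths, which
     [wel_faithful] then removes. *)
  - move=> i j; pose b i := y i ** p ** x j - (if i == j then eps (t i) else 0).
    suff : b i = 0 by move/eqP; rewrite subr_eq0 => /eqP.
    have bt l : b l ** eps (t j) = b l.
      rewrite numulDl -numulA (fspan_eps (xQ j)) numulNr; congr (_ - _).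
      by case: eqP => [->|_]; rewrite ?eps_idem ?numul0r.
    have xb : \sum_l x l ** b l = 0.
      under eq_bigr do rewrite numulDr numulrN 2!numulA.
      rewrite sumrB -!numul_suml xy pp px (bigD1 j)//= eqxx (fspan_eps (xQ j)) big1 ?addr0 ?subrr//.
      by move=> l /negbTE ->; rewrite numulr0.
    have [M MP] : exists M, forall l, eventually (path_forest B (t l)) M (t j) (b l).
      have /choice[D DP] l : evspan B (t l) (t j) (b l).
        apply: evfspanD; first by rewrite -numulA px; apply: yt.
        apply: evfspan_fspan; apply: fspanN; case: eqP => [->|_]; last exact: fspan0.
        by apply: (@pspan_wel _ _ _ _ _ [::]); rewrite /= eqxx.
      exists (\max_l D l)%N => l; apply: eventually_weak (DP l).
      exact: leq_bigmax.
    apply: (wel_faithful (n := M) (bt i)) => w v pw sw.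
    apply: (indep v (fun l => b l ** wel (t j) w)) => [l|]; first exact: MP.
    by rewrite (eq_bigr _ (fun l _ => numulA _ _ _)) -numul_suml xb numul0r.
  - by rewrite (eq_bigr _ (fun l _ => numulA _ _ _)) -numul_suml xy pp.
have [D gD] : exists D, forall j, pspan_lt B D (t j) u (g j).
  have /choice[D DP] := gP; exists (\max_l D l)%N => l; apply: fspan_lt_weak (DP l).
  exact: leq_bigmax.
have [v [c [z [J0 [cJ0 cv zP zE]]]]] := dependence xQ px gD xg g0.
case: (@arg_maxnP _ J0 (fun j => c j != 0) d cJ0) => J /= cJ dmax.
have Zd : fspan_lt Q (d J) v (\sum_j c j *: x j).
  apply: fspan_lt_sum => j _ _; have [->|cj] := eqVneq (c j) 0.
    by rewrite scale0r; apply: fspan_lt0.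
  by apply: fspan_ltZ; rewrite -(cv _ cj); apply: fspan_lt_weak (xd j); apply: dmax.
(* If [d J] is 0, maximality makes every generator in the relation zero, and [x J] is simply
   dropped. *)
pose I := if d J is 0 then [::] else ins v.
have {}zE : \sum_j c j *: x j = \sum_(a <- I) z a ** el a.
  rewrite /I; case dJ: (d J) => [|e]; last exact: zE.
  by rewrite big_nil; apply: (@fspan_lt0_eq _ _ _ Q v); rewrite -dJ.
(* The degree bound on the combination passes to each [z a], because the splitting along last arrows
   is unique. *)
have zd a : a \in I -> fspan_lt Q (d J).-1 (asrc a) (z a).
  rewrite /I; case dJ: (d J) => [//|e] ai; move: Zd; rewrite dJ => /fspan_last[z0 [y0 [z01 y0P E]]].
  have : - z0 + \sum_(a <- ins v) (z a - y0 a) ** el a = 0.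
    under eq_bigr do rewrite numulDl numulNr.
    move: zE; rewrite /I dJ => zE.
    rewrite sumrB -zE E; set S := \sum_(_ <- _) _; apply/eqP; rewrite addrC subr_eq0 addrK eqxx//.
  move=> e0; case: (@fspan_last_eq0 _ _ _ Q v (- z0) (fun b => z b - y0 b))
    => [|b bi|//|_ /(_ a ai)].
  - by rewrite -scaleN1r; apply: fspan_ltZ.
  - apply: fspanD; first by case: (zP b bi).
    by apply: fspanN; apply: fspan_ltP (y0P b bi).
  - by move/eqP; rewrite subr_eq0 => /eqP ->; apply: y0P.
have Iv a : a \in I -> a \in ins v by rewrite /I; case: (d J).
have IK : (size I * branching F ^ (d J).-1 < branching F ^ d J)%N.
  rewrite /I; case: (posnP (d J)) => [->//|dJ].
  by rewrite -{1}(prednK dJ) /=; apply: ltn_mul_expn => //; apply: size_ins.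
case: n t x y d xd dN px ey yt xy xQ J {dmax J0 cJ0 gP xg g0 gD D g} c cv cJ Zd I zE zd Iv IK
  => [|n] t x y d xd dN px ey yt xy xQ J c cv cJ Zd I zE zd Iv IK; first by have := ltn_ord J.
pose a_ (l : 'I_(size I)) := tnth (in_tuple I) l.
have aI l : a_ l \in I by apply: mem_tnth.
have aiv l := Iv _ (aI l).
have ao l : a_ l \in outs (asrc (a_ l)) by move: (aiv l); rewrite insP => /andP[].
have av l : atgt (a_ l) = v by move: (aiv l); rewrite insP => /andP[_ /eqP].
have tJ : t J = v by apply: cv.
(* Solving the relation for [x J] and substituting in [\sum_j x j ** y j] gives the new rows: each
   remaining [y j] loses [c j / c J] times [y J], and [z a] is paired with [el a ** y J] divided by
   [c J]. *)
apply: (IH _ (repl t J (fun l => asrc (a_ l))) (repl x J (fun l => z (a_ l)))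
  (repl (fun j => y j - (c j / c J) *: y J) J (fun l => (c J)^-1 *: (el (a_ l) ** y J)))
  (repl d J (fun _ => (d J).-1))).
- by apply: pairf_ind => j; rewrite !(repl_l, repl_r)//; apply: zd.
- by rewrite ltnS in dN; apply: leq_trans dN; apply: weight_repl.
- apply: pairf_ind => j; rewrite !(repl_l, repl_r)//.
  by case: (zP _ (aiv j)).
- apply: pairf_ind => j; rewrite !(repl_l, repl_r).
    rewrite numulDr ey numulrN -nuscaleAr; congr (_ - _).
    have [->|/cv ->] := eqVneq (c (lift J j)) 0; first by rewrite mul0r !scale0r.
    by rewrite -tJ ey.
  by rewrite -nuscaleAr numulA eps_el.
- apply: pairf_ind => j; rewrite !(repl_l, repl_r) => u1 z1 zQ1.
    rewrite numulDl numulNr; apply: evfspanD; first exact: yt.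
    rewrite -scaleN1r; apply: evfspanZ; rewrite -nuscaleAl.
    have [->|/cv cj] := eqVneq (c (lift J j)) 0; first by rewrite mul0r scale0r; apply: evfspan0.
    by apply: evfspanZ; rewrite cj -tJ; apply: yt.
  rewrite -nuscaleAl; apply: evfspanZ; rewrite -numulA.
  have [M MP] := yt J _ _ zQ1; exists M => w' u' pw sw; rewrite -numulA.
  apply: (pspanM (t := t J)); last exact: MP.
  have := @pspan_wel _ _ _ B (asrc (a_ j)) [:: a_ j] (t J).
  by rewrite /= ao av tJ eqxx -(av j) el_eps; apply.
- rewrite (@big_repl _ _ _ J _ (fun j => x j ** (y j - (c j / c J) *: y J)))
    => [|j]; last by rewrite !repl_l.
  under [X in _ + X]eq_bigr do rewrite !repl_r -nuscaleAr numulA.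
  rewrite -scaler_sumr -numul_suml
    -[\sum_l _ ** _](big_tnth _ _ I predT (fun a => z a ** el a)) -zE.
  rewrite numul_suml scaler_sumr [X in _ + X](bigD1 J)//= addrCA -big_split /=.
  rewrite -[RHS]xy [RHS](bigD1 J)//=.
  rewrite -nuscaleAl scalerA mulVf// scale1r; congr (_ + _); apply: eq_bigr => j _.
  by rewrite numulDr numulrN -nuscaleAr -nuscaleAl scalerA mulrC addrNK.
Qed.

(** Expanding a generator along the outgoing arrows shortens its waiting length; rows gain a ghost
    arrow on the left and stay tame by [evspan_gh]. *)
Theorem frame_of_eventual_generators n (t : 'I_n -> typ F) (x y : 'I_n -> A) :
  (forall j, exists e, eventually Q e (t j) (x j)) ->
  (forall j, x j ** eps (t j) = x j) -> (forall j, p ** x j = x j) ->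
  (forall j, eps (t j) ** y j = y j) -> (forall j, tame (t j) (y j)) ->
  \sum_j x j ** y j = p ->
  exists n' (t' : 'I_n' -> typ F) x' y', frame p t' x' y'.
Proof.
move=> /choice[d dP] xe.
have [N] := ubnP (weight (branching F) d).
elim: N n t x y d dP xe => // N IH n t x y d dP xe dN px ey yt xy.
have [all0|/existsNP[J Jx]] := pselect (forall j, eventually Q 0 (t j) (x j)).
  by apply: (frame_of_generators _ px ey yt xy) => j; apply: eventually_fspan.
have dJ : (0 < d J)%N by case: posnP => // dJ; case: Jx; rewrite -dJ.
have o : outs (t J) != [::] by apply/eqP => o; apply: Jx; apply: eventually_outs_nil (dP J).
case: n t x y d dP xe dN px ey yt xy J Jx dJ o
  => [|n] t x y d dP xe dN px ey yt xy J Jx dJ o; first by have := ltn_ord J.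
have aP := @arrow_of_in _ _ F (t J).
apply: (IH _ (repl t J (fun l => atgt (arrow_of l))) (repl x J (fun l => x J ** el (arrow_of l)))
  (repl y J (fun l => gh (arrow_of l) ** y J)) (repl d J (fun _ => (d J).-1))).
- by apply: pairf_ind => j; rewrite !(repl_l, repl_r)//; apply: eventually_el.
- by apply: pairf_ind => j; rewrite !(repl_l, repl_r)// -numulA el_eps.
- rewrite ltnS in dN; apply: leq_trans dN; apply: weight_repl.
  by apply: ltn_mul_expn => //; apply: size_outs.
- by apply: pairf_ind => j; rewrite !(repl_l, repl_r)// numulA px.
- by apply: pairf_ind => j; rewrite !(repl_l, repl_r)// numulA eps_gh.
- apply: pairf_ind => j; rewrite !(repl_l, repl_r)// => u z zQ; rewrite -numulA.
  apply: (evspan_gh (aP j)); last exact: yt.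
  by rewrite -numulA (fspan_eps zQ).
- rewrite (@big_repl _ _ _ J _ (fun j => x j ** y j)) => [|j]; last by rewrite !repl_l.
  rewrite -[RHS]xy [RHS](bigD1 J)//= addrC; congr (_ + _).
  under eq_bigr do rewrite !repl_r numulA -(numulA (x J)).
  rewrite -numul_suml -numul_sumr (sum_arrow_of _ (fun a => el a ** gh a)).
  by rewrite -eps_sum// xe.
Qed.

End WeakAlgorithm.

(** * A graded representation of Leavitt path algebras *)

Section Representation.
Local Open Scope classical_set_scope.
Variables (R : comPzRingType) (E : digraph).
Implicit Types (e : edge E) (v w : vertex E).

(* For every vertex [v] the maps [push e], [src e = v], are injective with disjoint
   images in the set of codes, covering it when [v] is regular; [pop v] inverts them.
   The integer in a point records path length, which makes the module graded. *)
Definition code : Type := nat * seq (edge E).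
Definition point : Type := vertex E * code * int.
HB.instance Definition _ := Choice.on code.
HB.instance Definition _ := Choice.on point.
Implicit Types (f g : point -> R).

Definition outseq v : seq (edge E) := fset_set (out v).

Lemma outseqP v : finite_set (out v) -> forall e, (e \in outseq v) = (src e == v).
Proof.
move=> fv e; rewrite /outseq in_fset_set//.
by apply/idP/eqP => [|ev]; rewrite ?inE//=; apply/asboolP.
Qed.

(** At a finite emitter the edges are digits of a number in base [size (outseq v)], so that at a
    regular vertex every code begins with some edge, as CK2 requires. At an infinite emitter they
    are letters of a word, and the empty word begins with none. *)
Definition push e (c : code) : code :=
  if `[< finite_set (out (src e)) >] then
    ((c.1 * size (outseq (src e)) + index e (outseq (src e)))%N, c.2)
  else (c.1, e :: c.2).

Definition pop v (c : code) : option (edge E * code) :=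
  if `[< finite_set (out v) >] then
    let N := size (outseq v) in
    if onth (outseq v) (c.1 %% N) is Some e then Some (e, ((c.1 %/ N)%N, c.2)) else None
  else if c.2 is e :: s then if src e == v then Some (e, (c.1, s)) else None else None.

Lemma push_pop e c : pop (src e) (push e c) = Some (e, c).
Proof.
rewrite /pop /push; case: asboolP => fv /=; last by rewrite eqxx; case: c.
set s := outseq _; have es : e \in s by rewrite outseqP.
have ls : (index e s < size s)%N by rewrite index_mem.
rewrite modnMDl modn_small// divnMDl ?(leq_ltn_trans _ ls)// divn_small// addn0.
rewrite (onthE _ _) (nth_map e)// nth_index//; by case: c.
Qed.

Lemma pop_push v c e c' : pop v c = Some (e, c') -> src e = v /\ push e c' = c.
Proof.
rewrite /pop; case: asboolP => fv; last first.
  case: c => m [//|f s] /=; case: eqP => // fe [<- <-]; split=> //.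
  by rewrite /push; case: asboolP; rewrite fe.
set s := outseq v; set i := (c.1 %% size s)%N.
case oi: (onth s i) => [f|//] [<- <-].
have is_ : (i < size s)%N by rewrite -onthTE oi.
have fi : nth f s i = f by apply: onth_nth.
have fs : f \in s by rewrite -fi mem_nth.
have fv' : src f = v by apply/eqP; rewrite -outseqP.
split=> //; rewrite /push fv'; case: asboolP => // _.
rewrite -/s -{1}fi index_uniq ?fset_uniq// -divn_eq.
by case: c @i oi is_ fi.
Qed.

Lemma pop_regular v c : regular v -> exists e c', pop v c = Some (e, c').
Proof.
move=> [fv [e ev]]; rewrite /pop; case: asboolP => // _.
have es : e \in outseq v by rewrite outseqP//; apply/eqP.
have : (c.1 %% size (outseq v) < size (outseq v))%N.
  by rewrite ltn_pmod//; case: (outseq v) es.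
by rewrite -onthTE; case: onth => // f _; exists f; eexists.
Qed.

Definition exhausted (S : {fset edge E}) v := out v !=set0 /\ (forall e, src e = v -> e \in S).

(** Provides points on which [v] minus the sum of the [e e^*], [e] in [S], acts as the identity. If
    no edge at [v] lies outside [S], then [v] emits nothing and any code will do. *)
Lemma pop_avoid (S : {fset edge E}) v : ~ exhausted S v ->
  exists c, forall e c', e \in S -> pop v c <> Some (e, c').
Proof.
move=> ex; have [[e [ev eS]]|noe] := pselect (exists e, src e = v /\ e \notin S).
  exists (push e (0%N, [::])) => f c' fS; rewrite -ev push_pop => -[ef _].
  by rewrite ef fS in eS.
exists (0%N, [::]) => f c' fS /pop_push[fv _]; apply: ex; split; first by exists f.
by move=> e ev; apply: contrapT => /negP eS; apply: noe; exists e.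
Qed.

(** On indicator functions, [e] moves the point [(rng e, c, n)] to [(src e, push e c, n + 1)] and
    its ghost moves it back. Functions of arbitrary support are allowed, which spares any
    bookkeeping of supports. *)
Fixpoint rep (x : lpa_expr R E) (f : point -> R) : point -> R :=
  match x with
  | XVertex v => fun y => if y.1.1 == v then f y else 0
  | XEdge e => fun y => if pop y.1.1 y.1.2 is Some (e', c) then
      if e' == e then f (rng e, c, y.2 - 1) else 0 else 0
  | XGhost e => fun y => if y.1.1 == rng e then f (src e, push e y.1.2, y.2 + 1) else 0
  | XZero => fun=> 0
  | XAdd x1 x2 => fun y => rep x1 f y + rep x2 f y
  | XOpp x1 => fun y => - rep x1 f y
  | XMul x1 x2 => rep x1 (rep x2 f)
  | XScale c x1 => fun y => c * rep x1 f y
  end.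

Lemma rep_linear x c f g y :
  rep x (fun y => c * f y + g y) y = c * rep x f y + rep x g y.
Proof.
elim: x f g y => /=.
- by move=> v f g y; case: eqP => _ //; rewrite mulr0 addr0.
- move=> e f g y; case: pop => [[e' c']|]; last by rewrite mulr0 addr0.
  by case: eqP => _ //; rewrite mulr0 addr0.
- by move=> e f g y; case: eqP => _ //; rewrite mulr0 addr0.
- by move=> *; rewrite mulr0 addr0.
- by move=> x1 IH1 x2 IH2 f g y; rewrite IH1 IH2 mulrDr addrACA.
- by move=> x1 IH1 f g y; rewrite IH1 opprD mulrN.
- move=> x1 IH1 x2 IH2 f g y; rewrite -IH1; congr (rep x1 _ y).
  by apply/funext => z; rewrite IH2.
- by move=> d x1 IH1 f g y; rewrite IH1 mulrDr mulrCA.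
Qed.

Lemma repD x f g y : rep x (fun y => f y + g y) y = rep x f y + rep x g y.
Proof.
rewrite -[rep x f y]mul1r -rep_linear; congr (rep x _ y).
by apply/funext => z; rewrite mul1r.
Qed.

Lemma rep0 x y : rep x (fun=> 0) y = 0.
Proof.
have := rep_linear x (-1) (fun=> 0) (fun=> 0) y; rewrite [X in _ = X + _]mulN1r [RHS]addNr => e.
by rewrite -[RHS]e; congr (rep x _ y); apply/funext => z; rewrite mulr0 addr0.
Qed.

Lemma repZ x c f y : rep x (fun y => c * f y) y = c * rep x f y.
Proof.
rewrite -[RHS]addr0 -(rep0 x y) -rep_linear; congr (rep x _ y).
by apply/funext => z; rewrite addr0.
Qed.

Lemma rep_eq x1 x2 : lpa_eq x1 x2 -> rep x1 = rep x2.
Proof.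
elim=> {x1 x2} /=.
- by [].
- by move=> x y _ ->.
- by move=> x y z _ -> _ ->.
- by move=> x x' y y' _ -> _ ->.
- by move=> x x' _ ->.
- by move=> x x' y y' _ -> _ ->.
- by move=> c x x' _ ->.
- by move=> x y z; do 2 apply/funext => ?; rewrite addrA.
- by move=> x y; do 2 apply/funext => ?; rewrite addrC.
- by move=> x; do 2 apply/funext => ?; rewrite add0r.
- by move=> x; do 2 apply/funext => ?; rewrite addNr.
- by [].
- by [].
- by move=> x y z; do 2 apply/funext => ?; rewrite repD.
- by move=> c d x; do 2 apply/funext => ?; rewrite mulrA.
- by move=> x; do 2 apply/funext => ?; rewrite mul1r.
- by move=> c x y; do 2 apply/funext => ?; rewrite mulrDr.
- by move=> c d x; do 2 apply/funext => ?; rewrite mulrDl.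
- by [].
- by move=> c x y; do 2 apply/funext => ?; rewrite repZ.
- by move=> v; do 2 apply/funext => ?; case: eqP => // ->; rewrite eqxx.
- by move=> v w vw; do 2 apply/funext => ?; case: eqP => // ->; case: eqP.
- move=> e; apply/funext => f; apply/funext => -[[v c] n] /=.
  case: eqP => // ve; case ep: pop => [[e' c']|//].
  by case: eqP => // ee; case: ve; have [<- _] := pop_push ep; rewrite ee.
- move=> e; apply/funext => f; apply/funext => -[[v c] n] /=.
  by case: pop => [[e' c']|//]; rewrite eqxx.
- by move=> e; do 2 apply/funext => ?; case: eqP.
- by move=> e; do 2 apply/funext => ?; rewrite eqxx.
- move=> e; apply/funext => f; apply/funext => -[[v c] n] /=.
  by rewrite push_pop eqxx addrK; case: eqP => // ->.
- move=> e f ef; apply/funext => g; apply/funext => -[[v c] n] /=.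
  by rewrite push_pop; case: (e =P f) => //; rewrite if_same.
- move=> v rv; apply/funext => f; apply/funext => -[[w c] n] /=.
  have -> (s : seq (edge E)) y : rep (foldr (@XAdd R E) XZero
       [seq XMul (XEdge e) (XGhost e) | e <- s]) f y =
     \sum_(e <- s) rep (XMul (XEdge e) (XGhost e)) f y.
    by elim: s => [|e s IH]; rewrite ?big_nil// big_cons -IH.
  have [fv _] := rv; case: (w =P v) => [->|wv]; last first.
    rewrite big_seq big1// => e; rewrite outseqP// => /eqP ev /=.
    case ep: pop => [[e' c']|//]; case: eqP => // ee; case: wv.
    by have [<- _] := pop_push ep; rewrite ee.
  have [e [c' ep]] := pop_regular c rv; have [ev ec] := pop_push ep.
  rewrite (bigD1_seq e) ?fset_uniq//=; last by rewrite outseqP// ev.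
  rewrite ep !eqxx subrK ec ev big1 ?addr0// => e' /negbTE.
  by rewrite eq_sym => ->.
Qed.

Definition Lrep (x : lpa R E) : (point -> R) -> point -> R := rep (qrepr x).

Lemma LrepE x : Lrep (lpa_class x) = rep x.
Proof. exact: rep_eq (qrepr_class (lpa_equiv R E) x). Qed.

Lemma LrepD x y f b : Lrep (x + y) f b = Lrep x f b + Lrep y f b.
Proof. by elim/lpaW: x => x; elim/lpaW: y => y; rewrite -lpa_classD !LrepE. Qed.
Lemma LrepZ c x f b : Lrep (c *: x) f b = c * Lrep x f b.
Proof. by elim/lpaW: x => x; rewrite -lpa_classZ !LrepE. Qed.
Lemma LrepM x y f : Lrep (x ** y) f = Lrep x (Lrep y f).
Proof. by elim/lpaW: x => x; elim/lpaW: y => y; rewrite -lpa_classM !LrepE. Qed.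
Lemma Lrep0 f b : Lrep 0 f b = 0.
Proof. by rewrite -lpa_class0 LrepE. Qed.
Lemma LrepN x f b : Lrep (- x) f b = - Lrep x f b.
Proof. by elim/lpaW: x => x; rewrite -lpa_classN !LrepE. Qed.
Lemma Lrep_sum I (r : seq I) (P : pred I) (G : I -> lpa R E) f b :
  Lrep (\sum_(i <- r | P i) G i) f b = \sum_(i <- r | P i) Lrep (G i) f b.
Proof. by apply: (big_morph (fun x => Lrep x f b)) => [x y|]; rewrite ?LrepD ?Lrep0. Qed.
Definition indicator (b : point) : point -> R := fun y => (y == b)%:R.

Lemma Lrep_vert v b : Lrep (Lvert v) (indicator b) =
  if b.1.1 == v then indicator b else (fun=> 0).
Proof.
apply/funext => y; rewrite LrepE /= /indicator.
case: (y =P b) => [->|yb]; first by case: eqP => //; rewrite eqxx.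
by case: eqP => // _; case: eqP => // _; case: eqP yb.
Qed.

Lemma Lrep_edge e c n : Lrep (Ledge e) (indicator (rng e, c, n)) =
  indicator (src e, push e c, n + 1).
Proof.
apply/funext => -[[v c'] m]; rewrite LrepE /= /indicator.
case ep: pop => [[e' d]|]; last first.
  by case: eqP => // -[ve ce _]; move: ep; rewrite ve ce push_pop.
have [ev ed] := pop_push ep.
have [ee|ee] := eqVneq e' e.
  rewrite -ed -ev ee !xpair_eqE !eqxx /= subr_eq; congr (_%:R)%B.
  congr (nat_of_bool (_ && _)); apply/eqP/eqP => [->//|h].
  by have := push_pop e d; rewrite h push_pop => -[].
case: eqP => // -[ve ce _]; move: ep; rewrite ve ce push_pop => -[e1].
by rewrite e1 eqxx in ee.
Qed.

Lemma Lrep_edge_ghost_avoid e b : (forall c, pop b.1.1 b.1.2 <> Some (e, c)) ->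
  Lrep (Ledge e ** Lghost e) (indicator b) = fun=> 0.
Proof.
move=> av; apply/funext => -[[v c] n]; rewrite LrepM LrepE /=.
case ep: pop => [[e' d]|//]; case: eqP => // ee.
rewrite ee in ep; have [ev ed] := pop_push ep.
rewrite LrepE /= eqxx /indicator; case: eqP => // eb; case: (av d).
by rewrite -eb /= push_pop.
Qed.

End Representation.

(** * Matrices over a Leavitt path algebra *)

Section FinMxModule.
Variables (k : pzRingType) (V : lmodType k).

Lemma scalefmx_subproof c (a : finmx V) :
  exists n, forall i j, (n <= i)%N || (n <= j)%N -> c *: a i j = 0.
Proof. by have [n an] := finmxP a; exists n => i j /an ->; rewrite scaler0. Qed.
Definition scalefmx c (a : finmx V) : finmx V := FinMx (scalefmx_subproof c a).

Lemma scalefmxA c d a : scalefmx c (scalefmx d a) = scalefmx (c * d) a.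
Proof. by apply: finmx_eq => i j /=; rewrite scalerA. Qed.
Lemma scalefmx1 : left_id 1 scalefmx.
Proof. by move=> a; apply: finmx_eq => i j /=; rewrite scale1r. Qed.
Lemma scalefmxDr : right_distributive scalefmx +%R.
Proof. by move=> c a b; apply: finmx_eq => i j /=; rewrite scalerDr. Qed.
Lemma scalefmxDl a : {morph scalefmx^~ a : c d / c + d}.
Proof. by move=> c d; apply: finmx_eq => i j /=; rewrite scalerDl. Qed.

HB.instance Definition _ :=
  GRing.Zmodule_isLmodule.Build k (finmx V) scalefmxA scalefmx1 scalefmxDr scalefmxDl.

End FinMxModule.

HB.instance Definition _ (R : comPzRingType) (E : digraph) :=
  isNonUnitalAlgebra.Build R (lpa R E) (@lpa_scaleAl R E) (@lpa_scaleAr R E).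

Section FinMxAlgebra.
Variables (k : pzRingType) (B : nonUnitalAlgType k).
Implicit Types (a b : finmx B) (x y : B).

Lemma fmxM_scaleAl (c : k) a b : c *: (a ** b) = (c *: a) ** b.
Proof.
have [n bn] := finmxP b; apply: finmx_eq => i j.
transitivity (c *: ((a ** b) i j)); first by [].
rewrite !(fmxMEr _ _ _ bn) scaler_sumr.
by apply: eq_bigr => l _; rewrite nuscaleAl.
Qed.

Lemma fmxM_scaleAr (c : k) a b : c *: (a ** b) = a ** (c *: b).
Proof.
have [n an] := finmxP a; apply: finmx_eq => i j.
transitivity (c *: ((a ** b) i j)); first by [].
rewrite !(fmxMEl _ _ _ an) scaler_sumr.
by apply: eq_bigr => l _; rewrite nuscaleAr.
Qed.

HB.instance Definition _ :=
  isNonUnitalAlgebra.Build k (finmx B) fmxM_scaleAl fmxM_scaleAr.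

Lemma tensZ (c : k) x i j : (c *: x) \otimes e_(i, j) = c *: (x \otimes e_(i, j)).
Proof. by apply: finmx_eq => r s /=; case: ifP; rewrite ?scaler0. Qed.

End FinMxAlgebra.

Section Tens.
Variable B : nonUnitalRingType.
Implicit Types (a b : finmx B) (x y : B).

Lemma tensD x y i j : (x + y) \otimes e_(i, j) = x \otimes e_(i, j) + y \otimes e_(i, j).
Proof. by apply: finmx_eq => r s; rewrite finmxDE /=; case: ifP; rewrite ?addr0. Qed.
Lemma tens0 i j : (0 : B) \otimes e_(i, j) = 0.
Proof. by apply: finmx_eq => r s /=; case: ifP. Qed.
Lemma tensN x i j : (- x) \otimes e_(i, j) = - (x \otimes e_(i, j)).
Proof. by apply: finmx_eq => r s; rewrite finmxNE /=; case: ifP; rewrite ?oppr0. Qed.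
Lemma tens_sum (I : Type) (r : seq I) P (G : I -> B) i j :
  (\sum_(l <- r | P l) G l) \otimes e_(i, j) = \sum_(l <- r | P l) G l \otimes e_(i, j).
Proof. by apply: (big_morph (fun x => x \otimes e_(i, j))) => [x y|]; rewrite ?tensD ?tens0. Qed.

Lemma tensM_neq x y i j l r : j <> l -> x \otimes e_(i, j) ** y \otimes e_(l, r) = 0.
Proof.
move=> jl; have [n bn] := finmxP (y \otimes e_(l, r)).
apply: finmx_eq => s t; rewrite (fmxMEr _ _ _ bn) big1// => m _ /=.
case: (m =P j :> nat) => [->|_]; last by rewrite andbF numul0r.
by case: (j =P l) => // _; rewrite numulr0.
Qed.

Definition corner x : finmx B := x \otimes e_(0, 0).

Lemma cornerM x y : corner x ** corner y = corner (x ** y). Proof. exact: tensM. Qed.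

Lemma fsum_mxE (I : Type) (r : seq I) P (G : I -> finmx B) i j :
  (\sum_(l <- r | P l) G l) i j = \sum_(l <- r | P l) G l i j.
Proof. by apply: (big_morph (fun x : finmx B => x i j)). Qed.

Lemma finmx_tens_sum n a : bounded_by n a ->
  a = \sum_(i < n) \sum_(j < n) (a i j) \otimes e_(i, j).
Proof.
move=> an; apply: finmx_eq => r s; rewrite fsum_mxE.
under eq_bigr do rewrite fsum_mxE.
have [rn|nr] := ltnP r n; last first.
  rewrite an ?nr// big1// => i _; rewrite big1// => j _ /=.
  by case: (r =P i :> nat) => // ri; move: (ltn_ord i); rewrite -ri ltnNge nr.
have [sn|ns] := ltnP s n; last first.
  rewrite an ?ns ?orbT// big1// => i _; rewrite big1// => j _ /=.
  by case: (s =P j :> nat) => [sj|]; rewrite ?andbF//; move: (ltn_ord j); rewrite -sj ltnNge ns.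
rewrite (bigD1 (Ordinal rn))//= [X in _ + X]big1 ?addr0 => [|i ir]; last first.
  rewrite big1// => j _; case: (r =P i :> nat) => // ri.
  by rewrite -val_eqE /= ri eqxx in ir.
rewrite (bigD1 (Ordinal sn))//= !eqxx big1 ?addr0// => j js.
case: (s =P j :> nat) => [sj|]; rewrite ?andbF//.
by rewrite -val_eqE /= sj eqxx in js.
Qed.

End Tens.

Section VertMinus.
Variables (R : comPzRingType) (E : digraph).
Implicit Types (e : edge E) (v w : vertex E) (T : {fset edge E}).

Lemma ghost_edge e f : Lghost e ** Ledge f = if e == f then Lvert (rng e) else 0 :> lpa R E.
Proof. by case: eqP => [->|/(Lghost_edge_orth R)//]; exact: Lghost_edge. Qed.

Lemma vert_vert v w : Lvert v ** Lvert w = if v == w then Lvert v else 0 :> lpa R E.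
Proof. by case: eqP => [->|/(Lvert_orth R)//]; exact: Lvert_idem. Qed.

Lemma vert_edge v e : Lvert v ** Ledge e = if v == src e then Ledge e else 0 :> lpa R E.
Proof.
rewrite -{1}(Lsrc_edge R e) numulA vert_vert.
by case: eqP => [->|_]; rewrite ?Lsrc_edge ?numul0r.
Qed.

Lemma edge_vert v e : Ledge e ** Lvert v = if rng e == v then Ledge e else 0 :> lpa R E.
Proof.
rewrite -{1}(Ledge_rng R e) -numulA vert_vert.
by case: eqP => _; rewrite ?Ledge_rng ?numulr0.
Qed.

Lemma ghost_vert v e : Lghost e ** Lvert v = if src e == v then Lghost e else 0 :> lpa R E.
Proof.
rewrite -{1}(Lghost_src R e) -numulA vert_vert.
by case: eqP => _; rewrite ?Lghost_src ?numulr0.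
Qed.

Section Subset.
Variables (v : vertex E) (T : {fset edge E}).
Hypothesis Tv : forall e, e \in T -> src e = v.

Lemma vert_mul_minus : Lvert v ** vert_minus R v T = vert_minus R v T.
Proof.
rewrite /vert_minus numulDr Lvert_idem numulrN; congr (_ - _).
rewrite numul_sumr big_seq [RHS]big_seq; apply: eq_bigr => e /Tv ev.
by rewrite numulA vert_edge ev eqxx.
Qed.

Lemma vert_minus_mul : vert_minus R v T ** Lvert v = vert_minus R v T.
Proof.
rewrite /vert_minus numulDl Lvert_idem numulNr; congr (_ - _).
rewrite numul_suml big_seq [RHS]big_seq; apply: eq_bigr => e /Tv ev.
by rewrite -numulA ghost_vert ev eqxx.
Qed.

Lemma vert_minus_edge e : src e = v ->
  vert_minus R v T ** Ledge e = if e \in T then 0 else Ledge e.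
Proof.
move=> ev; rewrite /vert_minus numulDl numulNr vert_edge ev eqxx numul_suml.
case: ifPn => eT.
  rewrite (big_fsetD1 e)//= -numulA ghost_edge eqxx Ledge_rng big1_fset ?addr0 ?subrr//.
  move=> f; rewrite !inE => /andP[/negbTE fe _] _.
  by rewrite -numulA ghost_edge fe numulr0.
rewrite big1_fset ?subr0// => f fT _; rewrite -numulA ghost_edge.
by case: eqP => [fe|_]; rewrite ?numulr0//; rewrite -fe fT in eT.
Qed.

Lemma ghost_vert_minus e : src e = v ->
  Lghost e ** vert_minus R v T = if e \in T then 0 else Lghost e.
Proof.
move=> ev; rewrite /vert_minus numulDr numulrN ghost_vert ev eqxx numul_sumr.
case: ifPn => eT.
  rewrite (big_fsetD1 e)//= numulA ghost_edge eqxx Lrng_ghost big1_fset ?addr0 ?subrr//.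
  move=> f; rewrite !inE => /andP[/negbTE fe _] _.
  by rewrite numulA ghost_edge eq_sym fe numul0r.
rewrite big1_fset ?subr0// => f fT _; rewrite numulA ghost_edge.
by case: eqP => [fe|_]; rewrite ?numul0r//; rewrite fe fT in eT.
Qed.

Lemma vert_minus_idem : vert_minus R v T ** vert_minus R v T = vert_minus R v T.
Proof.
rewrite {1}/vert_minus numulDl numulNr vert_mul_minus numul_suml.
rewrite big_seq big1 ?subr0// => e eT.
by rewrite -numulA ghost_vert_minus ?eT ?numulr0//; apply: Tv.
Qed.

End Subset.
End VertMinus.

(** * Finite stages of a graph *)

Section Stage.
Variables (E : digraph) (S : {fset edge E}).
Implicit Types (e : edge E) (v w : vertex E).

Definition stage_out v : {fset edge E} := [fset e in S | src e == v]%fset.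

Lemma stage_outP v e : (e \in stage_out v) = (e \in S) && (src e == v).
Proof. by rewrite !inE. Qed.

Lemma stage_out_src v e : e \in stage_out v -> src e = v.
Proof. by rewrite stage_outP => /andP[_ /eqP]. Qed.

Definition remainder := {v : vertex E | `[< ~ exhausted S v >]}.
HB.instance Definition _ := Choice.on remainder.

(* A vertex [v] emitting edges outside [S], or none at all, is completed by an
   extra arrow from [inl v] to a sink [inr v] whose idempotent is
   [v - \sum_(e in S, src e = v) e e^*]. *)
Definition stage_typ : Type := vertex E + remainder.
Definition stage_arr : Type := edge E + remainder.
HB.instance Definition _ := Choice.on stage_typ.
HB.instance Definition _ := Choice.on stage_arr.

Definition stage_src (a : stage_arr) : stage_typ :=
  match a with inl e => inl (src e) | inr u => inl (val u) end.
Definition stage_rng (a : stage_arr) : stage_typ :=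
  match a with inl e => inl (rng e) | inr u => inr u end.
Definition stage_outs (t : stage_typ) : seq stage_arr :=
  match t with
  | inl v => [seq inl e | e <- stage_out v] ++ [seq inr u | u <- seq_of_opt (insub v)]
  | inr _ => [::]
  end.
Definition stage_ins (t : stage_typ) : seq stage_arr :=
  match t with
  | inl v => [seq inl e | e <- S & rng e == v]
  | inr u => [:: inr u]
  end.

Lemma mem_stage_outs_edge e v :
  ((inl e : stage_arr) \in stage_outs (inl v)) = (e \in S) && (src e == v).
Proof.
rewrite mem_cat mem_map; last by move=> ? ? [].
rewrite -stage_outP; case: (_ \in _) => //=.
by apply/mapP => -[].
Qed.

Lemma mem_stage_outs_rem (u : remainder) v :
  ((inr u : stage_arr) \in stage_outs (inl v)) = (val u == v).
Proof.
rewrite mem_cat; have -> : inr u \in [seq (inl e : stage_arr) | e <- stage_out v] = false.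
  by apply/mapP => -[].
rewrite mem_map /=; last by move=> ? ? [].
case: insubP => [u' _ <-|nv] /=; first by rewrite inE.
by apply/esym/negbTE; apply: contraNneq nv => <-; apply: (valP u).
Qed.

Lemma stage_outsP (a : stage_arr) t : a \in stage_outs t -> stage_src a = t.
Proof.
case: t => [v|//]; case: a => [e|u]; rewrite ?mem_stage_outs_edge ?mem_stage_outs_rem.
  by case/andP=> _ /eqP <-.
by move=> /eqP <-.
Qed.

Lemma stage_insP (a : stage_arr) t :
  (a \in stage_ins t) = (a \in stage_outs (stage_src a)) && (stage_rng a == t).
Proof.
case: a => [e|u]; rewrite ?mem_stage_outs_edge ?mem_stage_outs_rem eqxx ?andbT /=;
  case: t => [v|u'] /=.
- rewrite mem_map; last by move=> ? ? [].
  by rewrite mem_filter andbC.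
- by rewrite inE andbF.
- by apply/mapP => -[].
- by rewrite inE.
Qed.

Lemma stage_outs_uniq t : uniq (stage_outs t).
Proof.
case: t => [v|//]; rewrite cat_uniq !map_inj_uniq ?fset_uniq /=; last 2 first.
- by move=> ? ? [].
- by move=> ? ? [].
case: insub => //= u; rewrite andbT orbF; by apply/mapP => -[].
Qed.

Lemma stage_ins_uniq t : uniq (stage_ins t).
Proof.
case: t => [v|//]; rewrite map_inj_uniq ?filter_uniq ?fset_uniq//.
by move=> ? ? [].
Qed.

(** At most |S| edges and one extra arrow leave a vertex; one more makes the bound strict. *)
Definition stage_branching : nat := (size (S : seq _)).+2.

Lemma size_stage_outs t : (size (stage_outs t) < stage_branching)%N.
Proof.
case: t => [v|//]; rewrite /stage_outs size_cat !size_map.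
have : (size (stage_out v) <= size (S : seq _))%N.
  by apply: fsubset_leq_card; apply/fsubsetP => e; rewrite stage_outP => /andP[].
by rewrite /stage_branching; case: insub => [u|] /= h; rewrite ?addn1 ?addn0 !ltnS// leqW.
Qed.

Lemma size_stage_ins t : (size (stage_ins t) < stage_branching)%N.
Proof.
case: t => [v|//]; rewrite size_map size_filter ltnS; apply: leqW; exact: count_size.
Qed.

Variable R : comPzRingType.
Notation L := (lpa R E).

Definition vrest v : L := vert_minus R v (stage_out v).

Definition Leps (t : stage_typ) : L :=
  match t with inl v => Lvert v | inr u => vrest (val u) end.
(** The extra arrow is the inclusion of a subprojection of [v], so it coincides with its own ghost
    and with the idempotent of its sink. *)
Definition Lel (a : stage_arr) : L :=
  match a with inl e => Ledge e | inr u => vrest (val u) end.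
Definition Lgh (a : stage_arr) : L :=
  match a with inl e => Lghost e | inr u => vrest (val u) end.

Let sub v e : e \in stage_out v -> src e = v := @stage_out_src v e.

Lemma Leps_idem t : Leps t ** Leps t = Leps t.
Proof. by case: t => [v|u] /=; [exact: Lvert_idem|exact: vert_minus_idem (@sub _)]. Qed.
Lemma Leps_el a : Leps (stage_src a) ** Lel a = Lel a.
Proof. by case: a => [v|u] /=; [exact: Lsrc_edge|exact: vert_mul_minus (@sub _)]. Qed.
Lemma Lel_eps a : Lel a ** Leps (stage_rng a) = Lel a.
Proof. by case: a => [v|u] /=; [exact: Ledge_rng|exact: vert_minus_idem (@sub _)]. Qed.
Lemma Leps_gh a : Leps (stage_rng a) ** Lgh a = Lgh a.
Proof. by case: a => [v|u] /=; [exact: Lrng_ghost|exact: vert_minus_idem (@sub _)]. Qed.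
Lemma Lgh_eps a : Lgh a ** Leps (stage_src a) = Lgh a.
Proof. by case: a => [v|u] /=; [exact: Lghost_src|exact: vert_minus_mul (@sub _)]. Qed.

Lemma Lgh_el t a b : a \in stage_outs t -> b \in stage_outs t ->
  Lgh a ** Lel b = if a == b then Leps (stage_rng a) else 0.
Proof.
case: t => [v|//]; case: a => [e|u]; case: b => [f|u'];
  rewrite ?mem_stage_outs_edge ?mem_stage_outs_rem.
- by move=> _ _; rewrite ghost_edge.
- move=> /andP[eS /eqP ev] /eqP uv; rewrite /= /vrest uv (@ghost_vert_minus R E v _ e ev).
  by rewrite stage_outP eS ev eqxx.
- move=> /eqP uv /andP[eS /eqP ev]; rewrite /= /vrest uv (@vert_minus_edge R E v _ f ev).
  by rewrite stage_outP eS ev eqxx.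
- move=> /eqP uv /eqP uv'; have -> : u = u' by apply/val_inj; rewrite uv.
  by rewrite eqxx; apply: vert_minus_idem (@sub _).
Qed.

Lemma sum_stage_outs (M : nmodType) v (G : stage_arr -> M) :
  \sum_(a <- stage_outs (inl v)) G a =
  \sum_(e <- stage_out v) G (inl e) + \sum_(u <- seq_of_opt (insub v : option remainder)) G (inr u).
Proof. by rewrite big_cat !big_map. Qed.

(** [S] is finite, so a vertex exhausted by it emits finitely many edges. *)
Lemma exhausted_stage_out v : exhausted S v -> regular v /\ stage_out v = fset_set (out v).
Proof.
move=> [[e ev] eS]; have fv : finite_set (out v).
  apply: (sub_finite_set (B := [set` S]%classic)); first by move=> f /eS.
  exact: finite_fset.
split; first by split=> //; exists e.
apply/fsetP => f; rewrite stage_outP in_fset_set//.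
apply/andP/idP => [[_ /eqP fv']|]; first by apply/asboolP.
by move=> /asboolP fv'; split; [apply: eS|apply/eqP].
Qed.

Lemma Leps_sum t : stage_outs t != [::] -> Leps t = \sum_(a <- stage_outs t) Lel a ** Lgh a.
Proof.
case: t => [v _|//]; rewrite sum_stage_outs /=.
case: insubP => [u _ <-|/asboolPn/contrapT ex] /=.
  by rewrite big_seq1 vert_minus_idem ?/vrest ?/vert_minus ?[_ + (_ - _)]addrC ?subrK//; apply: sub.
have [rv ->] := exhausted_stage_out ex; rewrite big_nil addr0; exact: Lvert_CK2.
Qed.

End Stage.

(** * Linear independence of the paths of a stage *)

Section StageFamily.
Variables (k : fieldType) (E : digraph) (S : {fset edge E}).
Notation L := (lpa k E).
Notation A := (finmx (lpa k E)).
Implicit Types (e : edge E) (v : vertex E) (t s : stage_typ S) (a b : stage_arr S).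

Lemma stage_eps_idem t : corner (Leps k t) ** corner (Leps k t) = corner (Leps k t).
Proof. by rewrite cornerM Leps_idem. Qed.
Lemma stage_eps_el a : corner (Leps k (stage_src a)) ** corner (Lel k a) = corner (Lel k a).
Proof. by rewrite cornerM Leps_el. Qed.
Lemma stage_el_eps a : corner (Lel k a) ** corner (Leps k (stage_rng a)) = corner (Lel k a).
Proof. by rewrite cornerM Lel_eps. Qed.
Lemma stage_eps_gh a : corner (Leps k (stage_rng a)) ** corner (Lgh k a) = corner (Lgh k a).
Proof. by rewrite cornerM Leps_gh. Qed.
Lemma stage_gh_eps a : corner (Lgh k a) ** corner (Leps k (stage_src a)) = corner (Lgh k a).
Proof. by rewrite cornerM Lgh_eps. Qed.
Lemma stage_gh_el t a b : a \in stage_outs t -> b \in stage_outs t ->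
  corner (Lgh k a) ** corner (Lel k b) = if a == b then corner (Leps k (stage_rng a)) else 0.
Proof.
by move=> ha hb; rewrite cornerM (Lgh_el k ha hb); case: eqP => _ //; apply: tens0.
Qed.
Lemma stage_eps_sum t : stage_outs t != [::] ->
  corner (Leps k t) = \sum_(a <- stage_outs t) corner (Lel k a) ** corner (Lgh k a).
Proof.
move=> o; rewrite (Leps_sum k o) /corner tens_sum; apply: eq_bigr => a _.
by rewrite tensM.
Qed.

Definition stage : ckFamily A := @CKFamily k A (stage_typ S) (stage_arr S)
  (@stage_src E S) (@stage_rng E S) (@stage_outs E S) (@stage_ins E S)
  (fun a t => @stage_outsP E S a t) (@stage_insP E S) (@stage_outs_uniq E S)
  (@stage_ins_uniq E S) (stage_branching S) (@size_stage_outs E S) (@size_stage_ins E S)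
  (fun t => corner (Leps k t)) (fun a => corner (Lel k a)) (fun a => corner (Lgh k a))
  stage_eps_idem stage_eps_el stage_el_eps stage_eps_gh stage_gh_eps stage_gh_el stage_eps_sum.

Implicit Types w : seq (arr stage).
Notation spth := (pth (F := stage)).
Notation swel := (wel (F := stage)).

Definition avoiding (u : remainder S) : code E :=
  sval (cid (pop_avoid (asboolW (valP u)))).

Lemma avoidingP (u : remainder S) e c : e \in S -> pop (val u) (avoiding u) <> Some (e, c).
Proof. by rewrite /avoiding; case: cid => c' /= h; apply: h. Qed.

Definition base t : point E :=
  match t with inl v => (v, (0%N, [::]), 0) | inr u => (val u, avoiding u, 0) end.

Definition act a (b : point E) : point E :=
  match a with inl e => (src e, push e b.1.2, b.2 + 1) | inr _ => b end.

Definition endpoint t w : point E := foldr act (base t) w.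

Definition tvert t : vertex E := match t with inl v => v | inr u => val u end.

Lemma endpoint_vert s w t : spth s w t -> (endpoint t w).1.1 = tvert s.
Proof.
elim: w s => [|a w IH] s /= => [/eqP->|/andP[ha pw]]; first by case: t.
rewrite -(stage_outsP ha); case: a ha pw => [e|u] //= _ pw.
exact: (IH (inr u)).
Qed.

Lemma endpoint_ge0 t w : 0 <= (endpoint t w).2.
Proof.
elim: w => [|[e|u] w IH] //=; first by case: t.
exact: addr_ge0.
Qed.

(** The extra arrow fixes points, so the empty path at [inr u] and the arrow into it from
    [inl (val u)] have the same endpoint; the first hypothesis rules out such comparisons. The
    integer separates what codes cannot: at a vertex whose only edge is a loop, [push] fixes every
    code. *)
Lemma endpoint_inj s s' t w w' : (s == inl (tvert s)) = (s' == inl (tvert s')) ->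
  spth s w t -> spth s' w' t -> endpoint t w = endpoint t w' -> s = s' /\ w = w'.
Proof.
have base0 : (base t).2 = 0 by case: t.
have ge0 w1 : 0 < (endpoint t w1).2 + 1 by rewrite ltzD1 endpoint_ge0.
have nilP a w1 s1 s2 : (s1 == inl (tvert s1)) = (s2 == inl (tvert s2)) -> s1 = t ->
    spth s2 (a :: w1) t -> base t <> endpoint t (a :: w1).
  move=> ss st /= /andP[ha pw]; case: a ha pw => [e|u] /= ha pw.
    by move/(congr1 (@snd _ _)) => /= eq0; have := ge0 w1; rewrite -eq0 base0 ltxx.
  case: w1 pw => [/= /eqP ut|a w1 /=]; last by [].
  by move: ss; rewrite st -ut -(stage_outsP ha) /= eqxx.
elim: w s s' w' => [|a w IH] s s' [|a' w'] ss.
- by move=> /= /eqP -> /eqP ->.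
- by move=> /eqP st p' e; case: (nilP a' w' s s' ss st p').
- by move=> p /eqP st e; case: (nilP a w s' s (esym ss) st p).
move=> /= /andP[ha pw] /andP[ha' pw'].
rewrite -(stage_outsP ha) -(stage_outsP ha') /=.
case: a a' ha ha' pw pw' => [f|u] [f'|u'] /= ha ha' pw pw' e.
- case: e => sf cf nf; have := push_pop f (endpoint t w).1.2.
  rewrite cf sf push_pop => -[ff' cc]; rewrite -ff' in pw cc *.
  have [] := IH (inl (rng f')) (inl (rng f')) w' _ pw pw'; rewrite ?eqxx//; last by move=> _ ->.
  rewrite [LHS]surjective_pairing [RHS]surjective_pairing; congr pair; last exact: addIr nf.
  rewrite [LHS]surjective_pairing [RHS]surjective_pairing cc; congr pair.
  by rewrite (endpoint_vert pw) (endpoint_vert pw').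
- case: w' pw' e => [/= /eqP ut|? ? //] e; have := ge0 w.
  by move/(congr1 (@snd _ _)): e => /= ->; rewrite base0 ltxx.
- case: w pw {IH} e => [/= /eqP ut|? ? //] e; have := ge0 w'.
  by move/(congr1 (@snd _ _)): e => /= <-; rewrite base0 ltxx.
case: w pw {IH e} => [/= /eqP ut|? ? //]; case: w' pw' => [/= /eqP ut'|? ? //].
by move: ut; rewrite -ut' => -[->].
Qed.

Fixpoint Lwel s w : L :=
  match w with [::] => Leps k s | a :: w' => Lel k a ** Lwel (stage_rng a) w' end.

Lemma wel_corner s w : swel s w = corner (Lwel s w).
Proof. by elim: w s => [|a w IH] s //=; rewrite IH cornerM. Qed.

(** The code of this base point begins with no edge of [S], so all the subtracted [e e^*] kill
    it. *)
Lemma Lrep_rest (u : remainder S) : Lrep (vrest S k (val u)) (indicator k (base (inr u))) =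
  indicator k (base (inr u)).
Proof.
apply/funext => y; rewrite /vrest /vert_minus LrepD LrepN Lrep_vert /= eqxx.
rewrite Lrep_sum big_seq big1 ?subr0// => e; rewrite stage_outP => /andP[eS _].
by rewrite Lrep_edge_ghost_avoid// => c /=; apply: avoidingP.
Qed.

Lemma Lrep_Lwel s w t : spth s w t ->
  Lrep (Lwel s w) (indicator k (base t)) = indicator k (endpoint t w).
Proof.
elim: w s => [|a w IH] s /= => [/eqP->|/andP[ha pw]].
  case: t => [v|u]; last exact: Lrep_rest.
  by rewrite /= Lrep_vert /= eqxx.
rewrite LrepM (IH _ pw); case: a ha pw => [e|u] ha pw /=; last first.
  by case: w pw {IH} => [/= /eqP <-|//]; apply: Lrep_rest.
have := endpoint_vert pw; case: (endpoint t w) => -[v c] n /= ->.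
exact: Lrep_edge.
Qed.

Definition Lcoef t w (x : L) : k := Lrep x (indicator k (base t)) (endpoint t w).

Lemma Lcoef_linear t w c x y : Lcoef t w (c *: x + y) = c * Lcoef t w x + Lcoef t w y.
Proof. by rewrite /Lcoef LrepD LrepZ. Qed.

Lemma Lcoef_Lwel s s' t w w' : (s == inl (tvert s)) = (s' == inl (tvert s')) ->
  spth s w t -> spth s' w' t ->
  Lcoef t w (Lwel s' w') = ((s == s') && (w == w'))%:R.
Proof.
move=> ss pw pw'; rewrite /Lcoef (Lrep_Lwel pw') /indicator; congr (_%:R)%B.
congr nat_of_bool; apply/eqP/andP => [/(endpoint_inj ss pw pw')[-> ->]//|].
by move=> [/eqP _ /eqP ->].
Qed.

Lemma corner_coef_linear s t w c (x y : A) :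
  Lcoef t w ((c *: x + y) 0 0) = c * Lcoef t w (x 0 0) + Lcoef t w (y 0 0) :> k.
Proof. by rewrite finmxDE Lcoef_linear. Qed.

Lemma corner_coef_wel s t w w' : spth s w t -> spth s w' t ->
  Lcoef t w (swel s w' 0 0) = (w == w')%:R.
Proof. by move=> p p'; rewrite wel_corner /= (Lcoef_Lwel _ p p') ?eqxx. Qed.

Definition stage_basis : pathBasis stage :=
  @PathBasis k A stage (fun s t w x => Lcoef t w (x 0 0))
    corner_coef_linear corner_coef_wel.

(** A row index with a vertex: these roots generate the columns whose entries are combinations of
    paths from vertices. No sink is a root, so no empty path of this forest ends at a sink. *)
Definition column_root : Type := nat * vertex E.
HB.instance Definition _ := Choice.on column_root.
Implicit Type r : column_root.

Definition column_typ r : typ stage := inl r.2.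
Definition column_el r : A := Lvert r.2 \otimes e_(r.1, 0).

Lemma column_coef_linear t r w c (x y : A) :
  Lcoef t w ((c *: x + y) r.1 0%N) = c * Lcoef t w (x r.1 0%N) + Lcoef t w (y r.1 0%N) :> k.
Proof. by rewrite finmxDE Lcoef_linear. Qed.

Lemma Lvert_Lwel v w t : spth (inl v) w t -> Lvert v ** Lwel (inl v) w = Lwel (inl v) w.
Proof.
case: w => [_|a w /andP[/stage_outsP ha _]]; first exact: Lvert_idem.
by rewrite numulA; congr (_ ** _); have := Leps_el k a; rewrite ha.
Qed.

Lemma column_wel r w t : spth (column_typ r) w t ->
  column_el r ** swel (column_typ r) w = Lwel (inl r.2) w \otimes e_(r.1, 0).
Proof. by move=> pw; rewrite wel_corner /column_el /corner tensM (Lvert_Lwel pw). Qed.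

Lemma column_coef_mono t r w r' w' :
  spth (column_typ r) w t -> spth (column_typ r') w' t ->
  Lcoef t w ((column_el r' ** swel (column_typ r') w') r.1 0%N) =
  ((r == r') && (w == w'))%:R.
Proof.
move=> p p'; rewrite (column_wel p') /=.
case: r r' p p' => [i v] [i' v'] /= p p'; rewrite xpair_eqE andbT.
case: eqP => [_|]; last by rewrite /Lcoef Lrep0.
by rewrite (Lcoef_Lwel _ p p')//= !eqxx.
Qed.

Definition columns : forest stage :=
  @Forest k A stage column_root column_typ column_el (fun t r w x => Lcoef t w (x r.1 0%N))
    column_coef_linear column_coef_mono.

End StageFamily.

(** * Edges occurring in a matrix, and local units *)

Section Support.
Variables (R : comPzRingType) (E : digraph).
Implicit Types (e : edge E) (v : vertex E).

Fixpoint expr_edges (x : lpa_expr R E) : {fset edge E} :=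
  (match x with
  | XEdge e | XGhost e => [fset e]
  | XAdd x1 x2 | XMul x1 x2 => expr_edges x1 `|` expr_edges x2
  | XOpp x1 | XScale _ x1 => expr_edges x1
  | _ => fset0
  end)%fset.

Definition supported (S : {fset edge E}) (x : lpa R E) : Prop :=
  exists2 y, lpa_class y = x & (expr_edges y `<=` S)%fset.

Definition mx_supported (S : {fset edge E}) (M : finmx (lpa R E)) : Prop :=
  forall i j, supported S (M i j).

Lemma supportedW S T x : (S `<=` T)%fset -> supported S x -> supported T x.
Proof. by move=> ST [y <- yS]; exists y => //; apply: fsubset_trans ST. Qed.

Lemma mx_supported_ex (M : finmx (lpa R E)) : exists S, mx_supported S M.
Proof.
have [n Mn] := finmxP M.
exists (\bigcup_(ij <- enum {: 'I_n * 'I_n}) expr_edges (qrepr (M ij.1 ij.2)))%fset => i j.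
have [ni|ni] := leqP n i.
  by exists XZero; [rewrite Mn ?ni|rewrite /= fsub0set].
have [nj|nj] := leqP n j.
  by exists XZero; [rewrite Mn ?nj ?orbT|rewrite /= fsub0set].
exists (qrepr (M i j)); first exact: qreprK.
exact: (bigfcup_sup (j := (Ordinal ni, Ordinal nj)) _ (mem_enum _ _)).
Qed.

Lemma mx_supportedW S T M : (S `<=` T)%fset -> mx_supported S M -> mx_supported T M.
Proof. by move=> ST MS i j; apply: supportedW (MS i j). Qed.

Lemma supported0 S : supported S 0.
Proof. by exists XZero => //; apply: fsub0set. Qed.

Lemma supported_vert S v : supported S (Lvert v).
Proof. by exists (XVertex v) => //; apply: fsub0set. Qed.

Lemma supportedD S x y : supported S x -> supported S y -> supported S (x + y).
Proof.
move=> [a <- aS] [b <- bS]; exists (XAdd a b); first exact: lpa_classD.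
by rewrite /= fsubUset aS.
Qed.

Lemma supportedN S x : supported S x -> supported S (- x).
Proof. by move=> [a <- aS]; exists (XOpp a); first exact: lpa_classN. Qed.

Lemma supportedM S x y : supported S x -> supported S y -> supported S (x ** y).
Proof.
move=> [a <- aS] [b <- bS]; exists (XMul a b); first exact: lpa_classM.
by rewrite /= fsubUset aS.
Qed.

Lemma supported_edge S e : e \in S -> supported S (Ledge e).
Proof. by move=> eS; exists (XEdge e); rewrite //= fsub1set. Qed.
Lemma supported_ghost S e : e \in S -> supported S (Lghost e).
Proof. by move=> eS; exists (XGhost e); rewrite //= fsub1set. Qed.

Lemma supported_vert_minus S T v : (T `<=` S)%fset -> supported S (vert_minus R v T).
Proof.
move=> /fsubsetP TS; apply: supportedD; first exact: supported_vert.
apply: supportedN; rewrite big_seq; apply: (big_ind (supported S)).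
- exact: supported0.
- exact: supportedD.
- by move=> e /TS eS; apply: supportedM; [apply: supported_edge|apply: supported_ghost].
Qed.

Lemma mx_supported_tens S x i j : supported S x -> mx_supported S (x \otimes e_(i, j)).
Proof. by move=> xS r s /=; case: ifP => // _; apply: supported0. Qed.

Definition right_unit (V : {fset vertex E}) (x : lpa R E) : Prop :=
  x ** (\sum_(v <- V) Lvert v) = x.

Lemma vert_sum v (V : {fset vertex E}) : v \in V ->
  Lvert v ** (\sum_(w <- V) Lvert w) = Lvert v :> lpa R E.
Proof.
move=> vV; rewrite numul_sumr (big_fsetD1 v)//= Lvert_idem big1_fset ?addr0// => w.
by rewrite !inE vert_vert eq_sym => /andP[/negbTE ->].
Qed.

Lemma right_unitW V W x : (V `<=` W)%fset -> right_unit V x -> right_unit W x.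
Proof.
move=> /fsubsetP VW xV; rewrite /right_unit -{1}xV -numulA numul_suml big_seq.
rewrite (eq_bigr (fun v => Lvert v)) => [|v /VW]; last exact: vert_sum.
by rewrite -big_seq.
Qed.

(** With infinitely many vertices there is no unit; finite sums of vertices replace it. *)
Lemma right_unit_ex x : exists V, right_unit V x.
Proof.
elim/lpaW: x; elim=> [v|e|e||x [V Vx] y [W Wy]|x [V Vx]|x _ y [W Wy]|c x [V Vx]].
- by exists [fset v]%fset; rewrite /right_unit big_seq_fset1; apply: Lvert_idem.
- by exists [fset rng e]%fset; rewrite /right_unit big_seq_fset1; apply: Ledge_rng.
- by exists [fset src e]%fset; rewrite /right_unit big_seq_fset1; apply: Lghost_src.
- by exists fset0; rewrite /right_unit lpa_class0 numul0r.
- exists (V `|` W)%fset; rewrite /right_unit lpa_classD numulDl.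
  by rewrite (right_unitW (fsubsetUl _ _) Vx) (right_unitW (fsubsetUr _ _) Wy).
- by exists V; rewrite /right_unit lpa_classN numulNr Vx.
- by exists W; rewrite /right_unit lpa_classM -numulA Wy.
- by exists V; rewrite /right_unit lpa_classZ -lpa_scaleAl Vx.
Qed.

Lemma mx_right_unit (M : finmx (lpa R E)) : exists n (V : {fset vertex E}),
  bounded_by n M /\ M ** (\sum_(i < n) \sum_(v <- V) Lvert v \otimes e_(i, i)) = M.
Proof.
have [n Mn] := finmxP M; have /choice[W WM] ij := right_unit_ex (M ij.1 ij.2).
pose V := (\bigcup_(ij <- enum {: 'I_n * 'I_n}) W (val ij.1, val ij.2))%fset.
exists n, V; split=> //; apply: finmx_eq => r s.
rewrite (fmxMEl _ _ _ Mn).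
have DE (l s' : nat) : (\sum_(i < n) \sum_(v <- V) Lvert v \otimes e_(i, i)) l s' =
    if (l == s') && (l < n)%N then \sum_(v <- V) Lvert v else 0 :> lpa R E.
  rewrite fsum_mxE; under eq_bigr do rewrite fsum_mxE.
  have [ln|nl] := ltnP l n; last first.
    rewrite andbF big1// => i _; rewrite big1// => v _ /=.
    by case: (l =P i :> nat) => // li; move: (ltn_ord i); rewrite -li ltnNge nl.
  rewrite (bigD1 (Ordinal ln))//= [X in _ + X]big1 ?addr0 => [|i il]; last first.
    rewrite big1// => v _; case: (l =P i :> nat) => // li.
    by rewrite -val_eqE /= li eqxx in il.
  by rewrite andbT eq_sym; under eq_bigr do rewrite eqxx; case: eqP => // _; rewrite big1.
under eq_bigr do rewrite DE.
have [sn|ns] := ltnP s n; last first.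
  rewrite [RHS]Mn ?ns ?orbT// big1// => l _.
  case: eqP => [ls|_]; last by rewrite numulr0.
  by move: (ltn_ord l); rewrite ls ltnNge ns.
rewrite (bigD1 (Ordinal sn))//= [X in _ + X]big1 ?addr0 => [|l ls]; last first.
  by case: eqP => [lse|_]; rewrite ?numulr0//; rewrite -val_eqE /= lse eqxx in ls.
rewrite eqxx sn /=; have [rn|nr] := ltnP r n; last by rewrite Mn ?nr// numul0r.
apply: right_unitW (WM (r, s)) => /=.
by apply: (bigfcup_sup (j := (Ordinal rn, Ordinal sn))) => //; rewrite mem_enum.
Qed.

End Support.

(** * Absorption of ghost edges by long paths *)

Section Saturation.
Variables (k : fieldType) (E : digraph) (S : {fset edge E}).
Notation L := (lpa k E).
Notation A := (finmx (lpa k E)).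
Notation F := (stage k S).
Notation Q := (columns k S).
Notation B := (stage_basis k S).
Implicit Types (e : edge E) (v : vertex E) (t s u : stage_typ S) (w : seq (arr F)).
Implicit Types (z M : A).

Lemma mono_columns l v w t : pth (F := F) (inl v) w t ->
  mono (Q := Q) ((l, v), w) = @Lwel k E S (inl v) w \otimes e_(l, 0).
Proof. exact: (@column_wel k E S (l, v)). Qed.

Lemma fspan_columns l v w t : pth (F := F) (inl v) w t ->
  fspan Q t (@Lwel k E S (inl v) w \otimes e_(l, 0)).
Proof.
move=> pw; rewrite -(mono_columns l pw).
exact: (fspan_ltP (@fspan_mono _ _ _ Q (l, v) w t pw)).
Qed.

Lemma columns_ind t (P : A -> Prop) : P 0 -> (forall x y, P x -> P y -> P (x + y)) ->
  (forall c x, P x -> P (c *: x)) ->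
  (forall l v w, pth (F := F) (inl v) w t -> P (@Lwel k E S (inl v) w \otimes e_(l, 0))) ->
  forall z, fspan Q t z -> P z.
Proof.
move=> P0 PD PZ Pm; apply: fspan_ind => // c [l v] w pw.
by apply: PZ; rewrite (mono_columns l pw); apply: Pm.
Qed.

Lemma fspan_mul_vert v i j t z : fspan Q t z -> fspan Q t (Lvert v \otimes e_(i, j) ** z).
Proof.
move: z; apply: columns_ind => [|x y hx hy|c x hx|l u w pw].
- by rewrite numulr0; apply: fspan0.
- by rewrite numulDr; apply: fspanD.
- by rewrite -nuscaleAr; apply: fspanZ.
case: (j =P l) => [->|jl]; last by rewrite tensM_neq//; apply: fspan0.
rewrite tensM -(@Lvert_Lwel k E S _ _ _ pw) numulA vert_vert.
case: eqP => [->|_]; first by rewrite (@Lvert_Lwel k E S _ _ _ pw); apply: fspan_columns.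
by rewrite numul0r tens0; apply: fspan0.
Qed.

Lemma fspan_mul_edge e i j t z : e \in S ->
  fspan Q t z -> fspan Q t (Ledge e \otimes e_(i, j) ** z).
Proof.
move=> eS; move: z; apply: columns_ind => [|x y hx hy|c x hx|l u w pw].
- by rewrite numulr0; apply: fspan0.
- by rewrite numulDr; apply: fspanD.
- by rewrite -nuscaleAr; apply: fspanZ.
case: (j =P l) => [->|jl]; last by rewrite tensM_neq//; apply: fspan0.
rewrite tensM -(@Lvert_Lwel k E S _ _ _ pw) numulA edge_vert.
case: eqP => [eu|_]; last by rewrite numul0r tens0; apply: fspan0.
rewrite -{}eu in pw *; apply: (@fspan_columns _ (src e) (inl e :: w)).
by rewrite /= mem_stage_outs_edge eS eqxx.
Qed.

(* Combinations of nonempty paths: on these, left multiplication by a ghost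
   edge of [S] or by a sink idempotent stays within combinations of paths. *)
Definition positive t z := exists2 l : seq (k * (root Q * seq (arr F))),
  (forall m, m \in l -> pth (F := F) (column_typ k S m.2.1) m.2.2 t /\ m.2.2 != [::]) &
  z = mono_sum (Q := Q) l.

Lemma positive_ind t (P : A -> Prop) : P 0 -> (forall x y, P x -> P y -> P (x + y)) ->
  (forall c x, P x -> P (c *: x)) ->
  (forall l v a w, pth (F := F) (inl v) (a :: w) t ->
    P (@Lwel k E S (inl v) (a :: w) \otimes e_(l, 0))) ->
  forall z, positive t z -> P z.
Proof.
move=> P0 PD PZ Pm z [l lP ->]; rewrite /mono_sum big_seq.
apply: (big_ind P) => // -[c [[i v] w]] /lP[]; case: w => // a w pw _.
by apply: PZ; rewrite (mono_columns i pw); apply: Pm.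
Qed.

Lemma positive_sink (r : remainder S) z : fspan Q (inr r) z -> positive (inr r) z.
Proof.
move=> [d [l [lP ->]]]; exists l => // m /lP[pm _]; split=> //.
by case: m.2.2 pm => //=.
Qed.

Lemma positive_el a z : a \in stage_outs (stage_src a) ->
  fspan Q (stage_src a) z -> positive (stage_rng a) (z ** corner (Lel k a)).
Proof.
move=> ha [d [l [lP ->]]]; exists [seq (m.1, (m.2.1, rcons m.2.2 a)) | m <- l].
  move=> m /mapP[m' /lP[pm _] ->] /=; split; last by case: m'.2.2.
  by rewrite (@pth_rcons _ _ F) pm stage_insP ha eqxx.
rewrite /mono_sum big_map numul_suml [LHS]big_seq [RHS]big_seq.
apply: eq_bigr => -[c [r w]] /lP[/= pm _]; rewrite -nuscaleAl; congr (_ *: _).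
by rewrite (@mono_rcons _ _ _ Q r w a pm ha).
Qed.

(** One arrow more than needed for polynomiality ends up as the last arrow of every monomial. *)
Lemma eventually_positive n t z w u : eventually Q n t z -> pth (F := F) t w u ->
  (n < size w)%N \/ stage_outs u = [::] -> positive u (z ** wel (F := F) t w).
Proof.
move=> h pw nw; case: u pw nw => [v|r] pw nw; last first.
  by apply: positive_sink; apply: h => //; right.
(* A vertex is never a sink of the stage: it emits an edge of [S] if exhausted, and the extra arrow
   otherwise. *)
have {}nw : (n < size w)%N.
  case: nw => // o; case: (insubP (remainder S) v) => [r _ rv|].
    by have := mem_stage_outs_rem r v; rewrite o -rv eqxx.
  move=> /asboolPn/contrapT[[e ev] eS].
  by have := mem_stage_outs_edge S e v; rewrite o eS// ev eqxx.
case/lastP: w nw pw => [//|w a]; rewrite size_rcons ltnS => nw pw.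
have := pw; rewrite (@pth_rcons _ _ F) => /andP[pw' ]; rewrite stage_insP => /andP[ha /eqP <-].
rewrite (@wel_rcons _ _ F)// numulA; apply: positive_el => //.
by apply: h => //; left.
Qed.

Lemma positive_mul_ghost e i j t z : e \in S -> positive t z ->
  fspan Q t (Lghost e \otimes e_(i, j) ** z).
Proof.
move=> eS; move: z; apply: positive_ind => [|x y hx hy|c x hx|l v a w pw].
- by rewrite numulr0; apply: fspan0.
- by rewrite numulDr; apply: fspanD.
- by rewrite -nuscaleAr; apply: fspanZ.
case: (j =P l) => [->|jl]; last by rewrite tensM_neq//; apply: fspan0.
rewrite tensM -(@Lvert_Lwel k E S _ _ _ pw) numulA ghost_vert.
case: (src e =P v) => [ev|_]; last by rewrite numul0r tens0; apply: fspan0.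
move: pw => /= /andP[ha pw]; have he : (inl e : stage_arr S) \in stage_outs (inl v).
  by rewrite mem_stage_outs_edge eS ev eqxx.
rewrite numulA (Lgh_el k he ha); case: eqP => [ea|_]; last by rewrite numul0r tens0; apply: fspan0.
by rewrite -ea in pw *; rewrite /= (@Lvert_Lwel k E S _ _ _ pw); apply: fspan_columns.
Qed.

(** Vertices and edges of [S] preserve polynomial columns; each ghost edge costs one more arrow on
    the right. Induction on an expression is what keeps all intermediate products inside the
    stage. *)
Lemma evfspan_mul_expr (x : lpa_expr k E) i j t z : (expr_edges x `<=` S)%fset ->
  evfspan Q t z -> evfspan Q t (lpa_class x \otimes e_(i, j) ** z).
Proof.
elim: x i j z => [v|e|e||x IHx y IHy|x IHx|x IHx y IHy|c x IHx] i j z /=.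
- by move=> _ [n h]; exists n => w u pw nw; rewrite -numulA; apply: fspan_mul_vert; apply: h.
- rewrite fsub1set => eS [n h]; exists n => w u pw nw; rewrite -numulA.
  by apply: fspan_mul_edge => //; apply: h.
- rewrite fsub1set => eS [n h]; exists n.+1 => w u pw nw; rewrite -numulA.
  by apply: positive_mul_ghost => //; apply: eventually_positive h pw nw.
- by move=> _ _; rewrite lpa_class0 tens0 numul0r; apply: evfspan0.
- rewrite fsubUset => /andP[xS yS] h; rewrite lpa_classD tensD numulDl.
  by apply: evfspanD; [apply: IHx|apply: IHy].
- move=> xS h; rewrite lpa_classN tensN numulNr -scaleN1r; apply: evfspanZ; exact: IHx.
- rewrite fsubUset => /andP[xS yS] h; rewrite lpa_classM -(tensM _ _ i i j) -numulA.
  by apply: IHx => //; apply: IHy.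
- by move=> xS h; rewrite lpa_classZ tensZ -nuscaleAl; apply: evfspanZ; apply: IHx.
Qed.

Lemma evfspan_mul M t z : mx_supported S M -> evfspan Q t z -> evfspan Q t (M ** z).
Proof.
move=> MS h; have [n Mn] := finmxP M; rewrite (finmx_tens_sum Mn) numul_suml.
apply: evfspan_sum => i _ _; rewrite numul_suml; apply: evfspan_sum => j _ _.
by have [x <- xS] := MS i j; apply: evfspan_mul_expr.
Qed.

(** A vertex keeps the paths starting there; a sink idempotent keeps the paths whose first arrow
    enters that sink. The latter needs nonempty paths: the empty path at [v] would become the
    idempotent itself, which is no path from the sink to [v]. *)
Lemma evspan_eps s t z : evfspan Q t z -> evspan B s t (corner (Leps k s) ** z).
Proof.
move=> [n h]; exists n.+1 => w u pw nw; rewrite -numulA.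
have := eventually_positive h pw nw; move: (z ** _).
apply: positive_ind => [|x y hx hy|c x hx|l v a w' pw'].
- by rewrite numulr0; apply: fspan0.
- by rewrite numulDr; apply: fspanD.
- by rewrite -nuscaleAr; apply: fspanZ.
case: l => [|l]; last by rewrite tensM_neq//; apply: fspan0.
rewrite tensM -(@Lvert_Lwel k E S _ _ _ pw') numulA.
case: s {nw pw h} => [v'|r] /=.
  rewrite vert_vert; case: eqP => [->|_]; last by rewrite numul0r tens0; apply: fspan0.
  rewrite (@Lvert_Lwel k E S _ _ _ pw') -/(corner _) -wel_corner; exact: pspan_wel.
have rv : vrest S k (val r) ** Lvert (val r) = vrest S k (val r).
  exact/vert_minus_mul/stage_out_src.
have -> : vrest S k (val r) ** Lvert v = if val r == v then vrest S k (val r) else 0.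
  by rewrite -{1}rv -numulA vert_vert; case: eqP => _; rewrite ?rv ?numulr0.
case: eqP => [vr|_]; last by rewrite numul0r tens0; apply: fspan0.
subst v.
move: pw' => /= /andP[ha pw']; have hr := mem_stage_outs_rem r (val r).
rewrite eqxx in hr; have := Lgh_el k hr ha => /= e; rewrite numulA e.
case: eqP => [ra|_]; last by rewrite numul0r tens0; apply: fspan0.
rewrite -{}ra in pw' *.
case: w' pw' => [/= /eqP <-|//]; rewrite (@Leps_idem _ S k (inr r)).
by have := @pspan_wel _ _ _ B (inr r) [::] (inr r) (eqxx _).
Qed.

Lemma evspan_mul s t M z : mx_supported S M -> evfspan Q t z ->
  evspan B s t (corner (Leps k s) ** (M ** z)).
Proof. by move=> MS h; apply: evspan_eps; apply: evfspan_mul. Qed.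

End Saturation.

(** * Comparison of the graph monoid with the monoid of idempotents *)

(** A common induction for classes in V, classes in V^*, frames and the range of [alpha], all of
    them additive on orthogonal sums. *)
Lemma orthogonal_sum_rel (A : nonUnitalRingType) (M : nmodType) (P : A -> M -> Prop) :
  P 0 0 ->
  (forall p q c d, P p c -> P q d -> p ** q = 0 -> q ** p = 0 -> P (p + q) (c + d)) ->
  forall (I : eqType) (r : seq I) (G : I -> A) (H : I -> M), uniq r ->
  (forall i, i \in r -> P (G i) (H i)) ->
  (forall i j, i \in r -> j \in r -> i != j -> G i ** G j = 0) ->
  P (\sum_(i <- r) G i) (\sum_(i <- r) H i).
Proof.
move=> P0 PD I; elim=> [|i r IH] G H /=; first by rewrite !big_nil.
case/andP=> ir ur GH GG; rewrite !big_cons; apply: PD.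
- by apply: GH; rewrite mem_head.
- apply: IH => // [j jr|j l jr lr]; first by apply: GH; rewrite inE jr orbT.
  by apply: GG; rewrite inE ?jr ?lr orbT.
- rewrite numul_sumr big_seq big1// => j jr; apply: GG; rewrite ?mem_head ?inE ?jr ?orbT//.
  by apply: contraNneq ir => ->.
- rewrite numul_suml big_seq big1// => j jr; apply: GG; rewrite ?mem_head ?inE ?jr ?orbT//.
  by apply: contraNneq ir => <-.
Qed.

Section VRel.
Variable B : nonUnitalRingType.
Implicit Types (p q u v : finmx B) (c d : V B).

(** The relational form keeps proofs of idempotency out of the terms that are rewritten. *)
Definition V_rel p c : Prop := exists h : is_idempotent p, V_class (Idem h) = c.

Lemma V_rel_class (p : idem B) : V_rel p (V_class p).
Proof. by case: p => p h; exists h. Qed.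

Lemma V_rel_uniq p c d : V_rel p c -> V_rel p d -> c = d.
Proof. by move=> [h <-] [h' <-]; congr V_class; apply: idem_eq. Qed.

Lemma V_rel0 : V_rel 0 0.
Proof. exact: (V_rel_class (idem0 B)). Qed.

Lemma V_rel_sim p q u v c : V_rel p c -> q ** q = q -> q = u ** v -> p = v ** u -> V_rel q c.
Proof.
move=> [h <-] h' quv pvu; exists h'; apply/qclassP; exists u, v; split=> //.
Qed.

Lemma V_rel_simP p q c : V_rel p c -> V_rel q c -> exists u v, p = u ** v /\ q = v ** u.
Proof. by move=> [h <-] [h' /esym /qclassP]. Qed.

Lemma V_relD p q c d : V_rel p c -> V_rel q d -> p ** q = 0 -> q ** p = 0 ->
  V_rel (p + q) (c + d).
Proof.
move=> [hp <-] [hq <-] pq qp; set P := Idem hp; set Q := Idem hq.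
have [m pm] := finmxP p; have pm' : bounded_by m P by [].
have h : is_idempotent (p + q).
  by rewrite /is_idempotent numulDl !numulDr pq qp hp hq addr0 add0r.
exists h; rewrite (V_classD _ pm'); apply/qclassP.
(* The two factors carry [q] to the diagonal positions from [m] on and back, while [p] stays in
   place; orthogonality removes the cross terms. *)
exists (p + shc m q), (p + shr m q); rewrite /= !numulDl !numulDr; split.
  rewrite mul_shr (bounded_uc pm) numul0r addr0 !shc_mul (bounded_ur pm) numulr0 add0r.
  by rewrite ur_shr hp hq.
rewrite mul_shc pq shc_0 addr0 !shr_mul qp shr_0 add0r mul_shc hq hp.
by rewrite /osum /block_sum.
Qed.

Lemma V_rel_sum (I : eqType) (r : seq I) (G : I -> finmx B) (H : I -> V B) : uniq r ->
  (forall i, i \in r -> V_rel (G i) (H i)) ->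
  (forall i j, i \in r -> j \in r -> i != j -> G i ** G j = 0) ->
  V_rel (\sum_(i <- r) G i) (\sum_(i <- r) H i).
Proof. exact: (orthogonal_sum_rel V_rel0 V_relD). Qed.

End VRel.

Section FrameSum.
Variables (k : fieldType) (A : nonUnitalAlgType k) (F : ckFamily A).
Implicit Types (p q : A).

Lemma frame_add p q n m (t : 'I_n -> typ F) x y (t' : 'I_m -> typ F) x' y' :
  p ** q = 0 -> q ** p = 0 -> frame p t x y -> frame q t' x' y' ->
  frame (p + q) (pairf t t') (pairf x x') (pairf y y').
Proof.
move=> pq qp f f'; have [fx fy fo fs] := f; have [fx' fy' fo' fs'] := f'; split.
- by apply: pairf_ind => j; rewrite !(pairf_l, pairf_r).
- by apply: pairf_ind => j; rewrite !(pairf_l, pairf_r).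
- apply: pairf_ind => i; apply: pairf_ind => j; rewrite !(pairf_l, pairf_r) eq_shift//.
    by rewrite -(frame_yp i f) -(frame_px j f') numulA -(numulA (y i)) pq numulr0 numul0r.
  by rewrite -(frame_yp i f') -(frame_px j f) numulA -(numulA (y' i)) qp numulr0 numul0r.
- rewrite big_split_ord -fs -fs' /=; congr (_ + _); apply: eq_bigr => j _;
    by rewrite !(pairf_l, pairf_r).
Qed.

End FrameSum.

Section StageClass.
Variables (E : digraph).
Implicit Types (e : edge E) (v : vertex E).

Lemma ME_class_cat (s t : seq (ME_gen E)) : ME_class (s ++ t) = ME_class s + ME_class t.
Proof. by rewrite -ME_addE. Qed.

Lemma ME_class_map (I : Type) (r : seq I) (f : I -> ME_gen E) :
  ME_class [seq f i | i <- r] = \sum_(i <- r) ME_class [:: f i].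
Proof.
elim: r => [|i r IH]; first by rewrite big_nil.
by rewrite big_cons -IH -ME_class_cat.
Qed.

Definition sum_rng (T : {fset edge E}) : ME E := \sum_(e <- T) ME_vertex (rng e).

Lemma sum_rngE (T : {fset edge E}) : ME_class [seq GVertex (rng e) | e <- T] = sum_rng T.
Proof. exact: ME_class_map. Qed.

Lemma ME_vertex_regular v : regular v -> ME_vertex v = sum_rng (fset_set (out v)).
Proof. by move=> rv; rewrite -sum_rngE; apply/qclassP; apply: ME_regular. Qed.

Lemma ME_vertex_infinite v T (h : emitter_subset v T) :
  ME_vertex v = sum_rng T + ME_q h.
Proof. by rewrite -sum_rngE -ME_class_cat; apply/qclassP; apply: ME_infinite. Qed.

Lemma ME_q_sub v T U (h : emitter_subset v T) (h' : emitter_subset v U) :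
  (T `<=` U)%fset -> ME_q h = ME_q h' + sum_rng (U `\` T)%fset.
Proof.
by move=> TU; rewrite -sum_rngE -ME_class_cat; apply/qclassP; apply: ME_emitter.
Qed.

Lemma big_fsetD (M : nmodType) (I : choiceType) (T U : {fset I}) (G : I -> M) :
  (T `<=` U)%fset -> \sum_(e <- U) G e = \sum_(e <- T) G e + \sum_(e <- (U `\` T)%fset) G e.
Proof.
move=> TU; rewrite -big_cat; apply: perm_big; apply: uniq_perm; first exact: fset_uniq.
  rewrite cat_uniq !fset_uniq andbT; apply/hasPn => e; rewrite inE => /andP[]//.
move=> e; rewrite mem_cat inE; case eT: (e \in T) => //=.
by rewrite (fsubsetP TU).
Qed.

Variable S : {fset edge E}.

(** The class of [v] minus its edges in [S]. A generator [q_S] exists only for an infinite emitter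
    and a nonempty set; with no edge in [S] the class is that of [v], and at a regular vertex the
    edges left over are counted. *)
Definition rem_cls v : ME E :=
  match pselect (emitter_subset v (stage_out S v)) with
  | left h => ME_q h
  | right _ => if stage_out S v == fset0 then ME_vertex v
               else sum_rng (fset_set (out v) `\` stage_out S v)%fset
  end.

Definition stage_cls (t : stage_typ S) : ME E :=
  match t with inl v => ME_vertex v | inr u => rem_cls (val u) end.

Lemma stage_out_infinite v : stage_out S v != fset0 -> ~ emitter_subset v (stage_out S v) ->
  regular v /\ (stage_out S v `<=` fset_set (out v))%fset.
Proof.
move=> s0 ne; have fv : finite_set (out v).
  apply: contrapT => iv; apply: ne; split=> // e; exact: stage_out_src.
split; last first.
  apply/fsubsetP => e /stage_out_src ev; rewrite in_fset_set//; exact/asboolP.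
by split=> //; have /fset0Pn[e /stage_out_src ev] := s0; exists e.
Qed.

Lemma stage_cls_outs (t : stage_typ S) : stage_outs t != [::] ->
  stage_cls t = \sum_(a <- stage_outs t) stage_cls (stage_rng a).
Proof.
case: t => [v _|//]; rewrite sum_stage_outs /= -/(sum_rng _).
case: insubP => [u _ <-|/asboolPn/contrapT ex] /=; last first.
  by have [rv ->] := exhausted_stage_out ex; rewrite big_nil addr0; exact: ME_vertex_regular.
rewrite big_seq1 /= /rem_cls; case: pselect => [h|ne]; first exact: ME_vertex_infinite.
case: eqVneq => [->|s0]; first by rewrite /sum_rng big_seq_fset0 add0r.
have [rv sub] := stage_out_infinite s0 ne.
by rewrite (ME_vertex_regular rv); apply: big_fsetD.
Qed.

End StageClass.

Section EdgeProjections.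
Variables (R : comPzRingType) (E : digraph).
Implicit Types (e : edge E) (v : vertex E) (T U : {fset edge E}).

Lemma edge_ghost_orth e f : e != f ->
  (Ledge e ** Lghost e) ** (Ledge f ** Lghost f) = 0 :> lpa R E.
Proof.
by move=> ef; rewrite numulA -(numulA (Ledge e)) ghost_edge (negbTE ef) numulr0 numul0r.
Qed.

Lemma edge_ghost_idem e :
  (Ledge e ** Lghost e) ** (Ledge e ** Lghost e) = Ledge e ** Lghost e :> lpa R E.
Proof. by rewrite numulA -(numulA (Ledge e)) ghost_edge eqxx Ledge_rng. Qed.

Lemma vert_minus_regular v T : regular v -> (T `<=` fset_set (out v))%fset ->
  vert_minus R v T = \sum_(e <- (fset_set (out v) `\` T)%fset) Ledge e ** Lghost e.
Proof.
move=> rv Tv; rewrite /vert_minus (Lvert_CK2 R rv) (big_fsetD _ Tv).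
by rewrite addrAC subrr add0r.
Qed.

Lemma vert_minus_sub v T U : (T `<=` U)%fset ->
  vert_minus R v T = vert_minus R v U + \sum_(e <- (U `\` T)%fset) Ledge e ** Lghost e.
Proof. by move=> TU; rewrite /vert_minus (big_fsetD _ TU) opprD -addrA addrNK. Qed.

End EdgeProjections.

(** * Bijectivity of the map from M_E to V(L_k(E)) *)

Section Gamma.
Variables (k : fieldType) (E : digraph).
Notation A := (finmx (lpa k E)).
Variable gam : {additive ME E -> V (lpa k E)}.
Hypothesis gam_vertex : forall v, V_rel (corner (Lvert v : lpa k E)) (gam (ME_vertex v)).
Hypothesis gam_q : forall w T (h : emitter_subset w T),
  V_rel (corner (vert_minus k w T)) (gam (ME_q h)).
Implicit Types (e : edge E) (v w : vertex E) (T U S : {fset edge E}).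

Lemma V_rel_edge e : V_rel (corner (Ledge e ** Lghost e : lpa k E)) (gam (ME_vertex (rng e))).
Proof.
apply: (V_rel_sim (gam_vertex (rng e)) (u := corner (Ledge e)) (v := corner (Lghost e)));
  by rewrite cornerM ?edge_ghost_idem// ghost_edge eqxx.
Qed.

Lemma V_rel_edges T :
  V_rel (corner (\sum_(e <- T) Ledge e ** Lghost e : lpa k E)) (gam (sum_rng T)).
Proof.
rewrite /corner tens_sum raddf_sum; apply: V_rel_sum => [|e _|e f _ _ ef].
- exact: fset_uniq.
- exact: V_rel_edge.
- by rewrite tensM edge_ghost_orth// tens0.
Qed.

Lemma V_rel_eps S (t : stage_typ S) : V_rel (corner (Leps k t)) (gam (stage_cls t)).
Proof.
case: t => [v|u] /=; first exact: gam_vertex.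
rewrite /vrest /rem_cls; case: pselect => [h|ne]; first exact: gam_q.
case: eqVneq => [->|s0]; first by rewrite /vert_minus big_seq_fset0 subr0; apply: gam_vertex.
have [rv sub] := stage_out_infinite s0 ne.
by rewrite vert_minus_regular//; apply: V_rel_edges.
Qed.

Lemma V_rel_frame S (p : A) n (t : 'I_n -> typ (stage k S)) x y :
  frame p t x y -> V_rel p (gam (\sum_j stage_cls (t j))).
Proof.
move=> [fx fy fo <-]; rewrite raddf_sum.
rewrite [X in V_rel X _](_ : _ = \sum_(j <- enum 'I_n) x j ** y j); last by rewrite big_enum.
rewrite [X in V_rel _ X](_ : _ = \sum_(j <- enum 'I_n) gam (stage_cls (t j)));
  last by rewrite big_enum.
apply: V_rel_sum => [|j _|i j _ _ ij].
- exact: enum_uniq.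
- apply: (V_rel_sim (V_rel_eps (t j)) (u := x j) (v := y j)) => //.
    by rewrite numulA -(numulA (x j)) fo eqxx fx.
  by rewrite fo eqxx.
- by rewrite numulA -(numulA (x i)) fo (negbTE ij) numulr0 numul0r.
Qed.

Lemma gam_surj (c : V (lpa k E)) : exists m, gam m = c.
Proof.
suff H (p : idem (lpa k E)) : exists m, gam m = V_class p by move: c; apply: quotW.
have [S pS] := mx_supported_ex (idem_mx p).
have [n [W [pn pW]]] := mx_right_unit (idem_mx p).
(* The pairs index the diagonal local unit of [p], which presents [p] as a sum of products of the
   columns [p ** v \otimes e_(i, 0)] with the rows [v \otimes e_(0, i)]. *)
pose r := [seq (i, v) | i <- iota 0 n, v <- (W : seq _)].
pose iv (l : 'I_(size r)) := tnth (in_tuple r) l.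
have [] := @frame_of_eventual_generators _ _ _ (stage_basis k S) (columns k S) p (idemP p)
   (size r) (fun l => inl (iv l).2)
   (fun l => idem_mx p ** (Lvert (iv l).2 \otimes e_((iv l).1, 0)))
   (fun l => Lvert (iv l).2 \otimes e_(0, (iv l).1)).
- move=> l; apply: evfspan_mul => //; apply: evfspan_fspan.
  exact: (@fspan_columns k E S _ (iv l).2 [::] (inl (iv l).2) (eqxx _)).
- by move=> l; rewrite -numulA /= /corner tensM Lvert_idem.
- by move=> l; rewrite numulA (idemP p).
- by move=> l; rewrite /= /corner tensM Lvert_idem.
- move=> l u z zQ; rewrite -(Lvert_idem k (iv l).2) -(tensM _ _ 0 0) -numulA.
  apply: (@evspan_mul k E S (inl (iv l).2)); last exact: evfspan_fspan.
  by apply: mx_supported_tens; apply: supported_vert.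
- under eq_bigr do rewrite -numulA tensM Lvert_idem.
  rewrite -numul_sumr -[RHS]pW; congr (_ ** _).
  rewrite -[LHS](big_tnth _ _ r predT (fun a => Lvert a.2 \otimes e_(a.1, a.1))).
  rewrite big_allpairs_dep /=.
  rewrite -(big_mkord predT (fun i => \sum_(v <- W) Lvert v \otimes e_(i, i))).
  by rewrite /index_iota subn0.
- move=> m [t [x [y fr]]]; exists (\sum_j stage_cls (t j)).
  exact: V_rel_uniq (V_rel_frame fr) (V_rel_class p).
Qed.

(** Polynomial columns and rows supported in [S] are what makes a product row, supported matrix,
    column of two such frames eventually polynomial. *)
Definition stage_frame S (p : A) (c : ME E) : Prop :=
  exists n (t : 'I_n -> typ (stage k S)) x y,
  [/\ frame p t x y, forall j, fspan (columns k S) (t j) (x j),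
      forall j, mx_supported S (y j) & \sum_j stage_cls (t j) = c].

Lemma stage_frame0 S : stage_frame S 0 0.
Proof.
exists 0%N, (fun i : 'I_0 => False_rect _ (notF (ltn_ord i))), (fun _ => 0), (fun _ => 0).
by split; rewrite ?big_ord0//; [split; rewrite ?big_ord0// => -[]|case|case].
Qed.

Lemma stage_frameD S p q c d : stage_frame S p c -> stage_frame S q d ->
  p ** q = 0 -> q ** p = 0 -> stage_frame S (p + q) (c + d).
Proof.
move=> [n [t [x [y [fr xQ yS <-]]]]] [n' [t' [x' [y' [fr' xQ' yS' <-]]]]] pq qp.
exists (n + n')%N, (pairf t t'), (pairf x x'), (pairf y y'); split.
- exact: frame_add.
- by apply: pairf_ind => j; rewrite !(pairf_l, pairf_r).
- by apply: pairf_ind => j; rewrite !(pairf_l, pairf_r).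
- by rewrite big_split_ord; congr (_ + _); apply: eq_bigr => j _; rewrite !(pairf_l, pairf_r).
Qed.

Lemma stage_frame1 S (t : stage_typ S) (x y : lpa k E) i :
  x ** Leps k t = x -> Leps k t ** y = y -> y ** x = Leps k t ->
  fspan (columns k S) t (x \otimes e_(i, 0)) -> supported S y ->
  stage_frame S ((x ** y) \otimes e_(i, i)) (stage_cls t).
Proof.
move=> xt ty yx xQ yS.
exists 1%N, (fun _ => t), (fun _ => x \otimes e_(i, 0)), (fun _ => y \otimes e_(0, i)).
split; rewrite ?big_ord1//; last by move=> _; apply: mx_supported_tens.
split; rewrite ?big_ord1//.
- by move=> _; rewrite /= /corner tensM xt.
- by move=> _; rewrite /= /corner tensM ty.
- by move=> j l; rewrite tensM yx [j]ord1 [l]ord1 eqxx.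
- by rewrite tensM.
Qed.

Lemma stage_frame_vertex S v i : stage_frame S (Lvert v \otimes e_(i, i)) (ME_vertex v).
Proof.
rewrite -(Lvert_idem k v); apply: (@stage_frame1 S (inl v)) => /=; rewrite ?Lvert_idem//.
  exact: (@fspan_columns k E S i v [::] (inl v) (eqxx _)).
exact: supported_vert.
Qed.

Lemma stage_frame_edge S e i : e \in S ->
  stage_frame S ((Ledge e ** Lghost e) \otimes e_(i, i)) (ME_vertex (rng e)).
Proof.
move=> eS; apply: (@stage_frame1 S (inl (rng e))) => /=.
- exact: Ledge_rng.
- exact: Lrng_ghost.
- by rewrite ghost_edge eqxx.
- have := @fspan_columns k E S i (src e) [:: inl e] (inl (rng e)).
  by rewrite /= Ledge_rng; apply; rewrite mem_stage_outs_edge eS !eqxx.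
- exact: supported_ghost.
Qed.

(** The stage has a sink only for the complement of all edges of [S] at [v]. The edges of [S] at [v]
    outside [T] contribute edge projections, in parallel with relation (iii) of M_E. *)
Lemma stage_frame_q S v T (h : emitter_subset v T) i : (T `<=` S)%fset ->
  stage_frame S (vert_minus k v T \otimes e_(i, i)) (ME_q h).
Proof.
move=> TS; have [iv T0 Tv] := h.
have TSv : (T `<=` stage_out S v)%fset.
  apply/fsubsetP => e eT; rewrite stage_outP (fsubsetP TS _ eT) /=; apply/eqP.
  exact: Tv.
have hS : emitter_subset v (stage_out S v).
  split=> //; last by move=> e /stage_out_src.
  by have /fset0Pn[e /(fsubsetP TSv) ?] := T0; apply/fset0Pn; exists e.
rewrite (ME_q_sub h hS TSv).
rewrite (vert_minus_sub k v TSv) -/(vrest S k v).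
have sub e : e \in (stage_out S v `\` T)%fset -> e \in S /\ src e = v.
  by rewrite inE => /andP[_]; rewrite stage_outP => /andP[-> /eqP].
rewrite tensD tens_sum; apply: stage_frameD.
- have nex : `[< ~ exhausted S v >].
    by apply/asboolP => /exhausted_stage_out[[]].
  pose u : remainder S := exist _ v nex.
  have -> : ME_q hS = stage_cls (inr u).
    rewrite /= /rem_cls; case: pselect => // h'.
    by congr (ME_q _); apply: Prop_irrelevance.
  rewrite -[vrest S k v](@Leps_idem E S k (inr u)); apply: stage_frame1; rewrite ?Leps_idem//.
    have := @fspan_columns k E S i v [:: inr u] (inr u).
    rewrite /= (@Leps_idem E S k (inr u)); apply.
    by rewrite mem_stage_outs_rem !eqxx.
  apply: supported_vert_minus; apply/fsubsetP => e.
  by rewrite stage_outP => /andP[].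
- apply: (orthogonal_sum_rel (stage_frame0 S) (@stage_frameD S)) => [|e /sub[eS _]|e f _ _ ef].
  + exact: fset_uniq.
  + exact: stage_frame_edge.
  + by rewrite tensM edge_ghost_orth// tens0.
- rewrite numul_sumr big_seq big1// => e /[dup] eD /sub[eS ev]; rewrite tensM numulA.
  by rewrite vert_minus_edge// stage_outP eS ev eqxx numul0r tens0.
- rewrite numul_suml big_seq big1// => e /[dup] eD /sub[eS ev]; rewrite tensM -numulA.
  by rewrite ghost_vert_minus// stage_outP eS ev eqxx numulr0 tens0.
Qed.

Definition gen_proj (g : ME_gen E) : lpa k E :=
  match g with GVertex v => Lvert v | @GEmitter _ w T _ => vert_minus k w T end.
Definition gen_edges (g : ME_gen E) : {fset edge E} :=
  match g with GVertex v => fset0 | @GEmitter _ w T _ => T end.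

Fixpoint word_proj i (s : seq (ME_gen E)) : A :=
  if s is g :: s' then gen_proj g \otimes e_(i, i) + word_proj i.+1 s' else 0.
Fixpoint word_edges (s : seq (ME_gen E)) : {fset edge E} :=
  if s is g :: s' then (gen_edges g `|` word_edges s')%fset else fset0.

Lemma tens_word_proj (x : lpa k E) l j i s : (j < i)%N -> x \otimes e_(l, j) ** word_proj i s = 0.
Proof.
elim: s i => [|g s IH] i ji /=; first exact: numulr0.
rewrite numulDr IH ?leqW// addr0 tensM_neq//; by move=> e; rewrite e ltnn in ji.
Qed.

Lemma word_proj_tens (x : lpa k E) l j i s : (j < i)%N -> word_proj i s ** x \otimes e_(j, l) = 0.
Proof.
elim: s i => [|g s IH] i ji /=; first exact: numul0r.
rewrite numulDl IH ?leqW// addr0 tensM_neq//; by move=> e; rewrite e ltnn in ji.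
Qed.

Lemma word_proj_rel (P : A -> ME E -> Prop) : P 0 0 ->
  (forall p q c d, P p c -> P q d -> p ** q = 0 -> q ** p = 0 -> P (p + q) (c + d)) ->
  forall i s, (forall g j, g \in (s : seq {classic _}) ->
    P (gen_proj g \otimes e_(j, j)) (ME_class [:: g])) ->
  P (word_proj i s) (ME_class s).
Proof.
move=> P0 PD i s; elim: s i => [|g s IH] i Ps //=.
rewrite -[g :: s]cat1s ME_class_cat; apply: PD.
- by apply: Ps; rewrite mem_head.
- by apply: IH => h j hs; apply: Ps; rewrite inE hs orbT.
- exact: tens_word_proj.
- exact: word_proj_tens.
Qed.

Lemma gen_edges_sub g s : g \in (s : seq {classic _}) -> (gen_edges g `<=` word_edges s)%fset.
Proof.
elim: s => [//|h s IH]; rewrite inE => /orP[/eqP ->|/IH gs] /=; first exact: fsubsetUl.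
exact: fsubset_trans gs (fsubsetUr _ _).
Qed.

Lemma gen_proj_idem g : gen_proj g ** gen_proj g = gen_proj g.
Proof.
by case: g => [v|w T [_ _ Tw]] /=; [apply: Lvert_idem|apply: vert_minus_idem => e /Tw].
Qed.

Lemma V_rel_word s : V_rel (word_proj 0 s) (gam (ME_class s)).
Proof.
apply: (word_proj_rel (P := fun p c => V_rel p (gam c))).
- by rewrite raddf0; apply: V_rel0.
- by move=> p q c d pc qd pq qp; rewrite raddfD; apply: V_relD.
move=> g j _; have : V_rel (corner (gen_proj g)) (gam (ME_class [:: g])).
  by case: g => [v|w T h]; [apply: gam_vertex|apply: gam_q].
move=> /V_rel_sim; apply; first by rewrite tensM gen_proj_idem.
  by rewrite -[in LHS](gen_proj_idem g) -(tensM _ _ j 0).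
by rewrite tensM gen_proj_idem.
Qed.

Lemma stage_frame_word S s : (word_edges s `<=` S)%fset ->
  stage_frame S (word_proj 0 s) (ME_class s).
Proof.
move=> sS; apply: word_proj_rel => [||g j gs].
- exact: stage_frame0.
- exact: stage_frameD.
have gS := fsubset_trans (gen_edges_sub gs) sS.
by case: g {gs} gS => [v _|w T h] /=; [apply: stage_frame_vertex|apply: stage_frame_q].
Qed.

Lemma evspan_frame_mul S p n (t : 'I_n -> typ (stage k S)) x y i M t' z :
  frame p t x y -> mx_supported S (y i) -> mx_supported S M ->
  fspan (columns k S) t' z -> evspan (stage_basis k S) (t i) t' (y i ** (M ** z)).
Proof.
move=> fr yS MS zQ; rewrite -(frame_y fr) -numulA; apply: evspan_mul => //.
by apply: evfspan_mul => //; apply: evfspan_fspan.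
Qed.

Lemma gam_inj : injective gam.
Proof.
suff H s s' : gam (ME_class s) = gam (ME_class s') -> ME_class s = ME_class s'.
  by apply: quotW => s; apply: quotW => s'; apply: H.
move=> e.
have ps := V_rel_word s; have ps' := V_rel_word s'; rewrite -e in ps'.
have [u [v [puv qvu]]] := V_rel_simP ps ps'.
have [Su uS] := mx_supported_ex u; have [Sv vS] := mx_supported_ex v.
(* The stage must see the edges of the equivalence [u], [v], which enters the change of basis, as
   well as those of both words. *)
pose S := (Su `|` Sv `|` (word_edges s `|` word_edges s'))%fset.
have {}uS : mx_supported S u by apply: mx_supportedW uS; rewrite /S -fsetUA fsubsetUl.
have {}vS : mx_supported S v.
  by apply: mx_supportedW vS; rewrite /S -fsetUA fsetUCA fsubsetUl.
have [|n [t [x [y [fr xQ yS <-]]]]] := @stage_frame_word S s.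
  by rewrite /S fsetUCA fsubsetUl.
have [|n' [t' [x' [y' [fr' xQ' yS' <-]]]]] := @stage_frame_word S s'.
  by rewrite /S !fsetUA fsubsetUr.
have pp : word_proj 0 s ** word_proj 0 s = word_proj 0 s by case: ps.
have fr2 := frame_equiv pp puv qvu fr'.
apply: (frame_class_uniq (B := stage_basis k S) (@stage_cls_outs E S) fr fr2) => i j.
  exact: (evspan_frame_mul fr).
by rewrite -numulA; apply: (evspan_frame_mul fr').
Qed.

End Gamma.

(** * Diagonal projections *)

Lemma tens_mul_tens (B : nonUnitalRingType) (M : finmx B) (x y : B) i j l r :
  x \otimes e_(i, j) ** M ** y \otimes e_(l, r) = (x ** M j l ** y) \otimes e_(i, r).
Proof.
have [n Mn] := finmxP M.
have {}Mn : bounded_by (maxn n (maxn j l).+1) M by apply: bounded_byW Mn; rewrite leq_maxl.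
have jm : (j < maxn n (maxn j l).+1)%N by rewrite leq_max ltnS leq_maxl orbT.
have lm : (l < maxn n (maxn j l).+1)%N by rewrite leq_max ltnS leq_maxr orbT.
move: (maxn _ _) Mn jm lm => m Mn jm lm.
rewrite {1}(finmx_tens_sum Mn) numul_sumr numul_suml.
rewrite (bigD1 (Ordinal jm))//= [X in _ + X]big1 ?addr0; last first.
  move=> a aj; rewrite numul_sumr big1 ?numul0r// => b _; rewrite tensM_neq//.
  by move=> ja; rewrite -val_eqE /= ja eqxx in aj.
rewrite numul_sumr numul_suml (bigD1 (Ordinal lm))//= [X in _ + X]big1 ?addr0; last first.
  move=> b bl; rewrite tensM tensM_neq//.
  by move=> lb; rewrite -val_eqE /= lb eqxx in bl.
by rewrite !tensM.
Qed.

Section Diagonal.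
Variables (R : comPzRingType) (E : digraph).
Notation L := (lpa R E).
Notation D := (lpa_diag R E).
Implicit Types (e : edge E) (v : vertex E) (x y z : L).

Lemma diag_selfadjoint x : D x -> star x = x.
Proof.
move=> [s ->]; rewrite star_sum; apply: eq_bigr => cm _.
by rewrite star_scale starM starK.
Qed.

Lemma vert_Lword v e s : Lvert v ** Lword R e s = if v == src e then Lword R e s else 0.
Proof.
have := vert_edge R v e; case: s => [//|f s] /= h; rewrite numulA h.
by case: eqP => _; rewrite ?numul0r.
Qed.

Lemma diag_conj (z : L) : (forall mu, D (z ** (Lpath R mu ** star (Lpath R mu)) ** star z)) ->
  forall d, D d -> D (z ** d ** star z).
Proof.
move=> h d [s ->]; rewrite numul_sumr numul_suml; apply: diag_sum => -[c mu] /=.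
by rewrite -lpa_scaleAr -lpa_scaleAl; apply: diagZ; apply: h.
Qed.

Lemma diag_zero : D 0. Proof. exact: ssub0. Qed.

Lemma diag_conj_edge e d : D d -> D (Ledge e ** d ** Lghost e).
Proof.
rewrite -star_Ledge; apply: diag_conj => mu; rewrite numulA -numulA -starM.
case: mu => [v|f s p].
  rewrite /= edge_vert; case: eqP => _; last by rewrite numul0r; apply: diag_zero.
  exact: (@diag_path R E (@PEdges E e [::] isT)).
have [ef|ef] := eqVneq (rng e) (src f).
  have p' : path (@composable E) e (f :: s) by rewrite /= /composable ef eqxx.
  exact: (@diag_path R E (PEdges p')).
rewrite /= (_ : Ledge e ** Lword R f s = 0) ?numul0r; first exact: diag_zero.
by rewrite -(Ledge_rng R e) -numulA vert_Lword (negbTE ef) numulr0.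
Qed.

Lemma diag_conj_ghost e d : D d -> D (Lghost e ** d ** Ledge e).
Proof.
rewrite -star_Lghost; apply: diag_conj => mu; rewrite numulA -numulA -starM.
case: mu => [v|f s p] /=.
  rewrite ghost_vert; case: eqP => _; last by rewrite numul0r; apply: diag_zero.
  by rewrite star_Lghost ghost_edge eqxx; apply: diag_vert.
case: s p => [_|g s /= /andP[/eqP fg p]] /=; last rewrite numulA; rewrite ghost_edge;
  case: eqP => _; rewrite ?numul0r; try exact: diag_zero.
  by rewrite star_Lvert Lvert_idem; apply: diag_vert.
rewrite vert_Lword; case: eqP => _; last by rewrite numul0r; apply: diag_zero.
exact: (@diag_path R E (PEdges p)).
Qed.

(** All elements involved are self-adjoint, including the product, and the involution reverses
    products. *)
Lemma diagD_comm (a b : finmx L) : diagD D a -> diagD D b -> a ** b = b ** a.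
Proof.
move=> Da Db; have sa (c : finmx L) : diagD D c -> star c = c.
  move=> [c0 Dc]; apply: finmx_eq => i j /=; have [->|ij] := eqVneq i j.
    exact: diag_selfadjoint.
  by rewrite !c0 ?star0// eq_sym.
rewrite -[LHS]sa; last exact: ssubM.
by rewrite starM !sa.
Qed.

Definition Vs_rel (p : finmx L) (c : Vstar D) : Prop :=
  exists2 q : dproj D, dproj_mx q = p & Vstar_class q = c.

Lemma Vs_rel_class (p : dproj D) : Vs_rel p (Vstar_class p). Proof. by exists p. Qed.

Lemma Vs_rel_uniq p c d : Vs_rel p c -> Vs_rel p d -> c = d.
Proof. by move=> [q <- <-] [r rq <-]; congr Vstar_class; apply: dproj_eq. Qed.

Lemma Vs_rel0 : Vs_rel 0 0.
Proof. exact: (Vs_rel_class (dproj0 D)). Qed.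

(** The partial isometry [p + shr m q] normalizes the diagonal: by commutativity [p ** d ** q]
    equals [d ** (p ** q)], so orthogonality removes the cross terms. *)
Lemma Vs_relD p q c c' : Vs_rel p c -> Vs_rel q c' -> p ** q = 0 -> q ** p = 0 ->
  Vs_rel (p + q) (c + c').
Proof.
move=> [P <- <-] [Q <- <-]; case: P Q => [{}p Dp [sp pp]] [{}q Dq [sq qq]] /= pq qp.
have Dpq : diagD D (p + q) by apply: ssubD.
have Ppq : is_projection (p + q).
  by split; rewrite ?starD ?sp ?sq// numulDl !numulDr pq qp pp qq addr0 add0r.
exists (DProj Dpq Ppq) => //; have [m pm] := finmxP p.
rewrite (@Vstar_classD _ _ m (DProj Dp (conj sp pp)) (DProj Dq (conj sq qq)) pm).
apply/qclassP; have sv : star (p + shr m q) = p + shc m q by rewrite starD star_shr sp sq.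
exists (p + shr m q); rewrite sv /=; split.
- move=> d Dd; rewrite !(numulDl, numulDr) !shr_mul !mul_shc.
  have -> : p ** d ** q = 0 by rewrite (diagD_comm Dp Dd) -numulA pq numulr0.
  have -> : q ** d ** p = 0 by rewrite (diagD_comm Dq Dd) -numulA qp numulr0.
  rewrite shc_0 shr_0 addr0 add0r; apply: (@ssubD _ (diagD D)).
    exact: (ssubM (ssubM Dp Dd) Dp).
  by rewrite -?shrc; apply: (@diagD_sh _ D m); exact: (ssubM (ssubM Dq Dd) Dq).
- move=> d Dd; rewrite !(numulDl, numulDr) !shc_mul !mul_shr.
  have -> : uc m (p ** d) = 0 by rewrite (diagD_comm Dp Dd) uc_mul (bounded_uc pm) numulr0.
  have -> : q ** ur m d ** p = 0.
    by rewrite -numulA -ur_mul (diagD_comm Dd Dp) ur_mul (bounded_ur pm) numul0r numulr0.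
  rewrite numul0r addr0 add0r; apply: (@ssubD _ (diagD D)); first exact: (ssubM (ssubM Dp Dd) Dp).
  by rewrite uc_mul; exact: (ssubM (ssubM Dq (diagD_u m Dd)) Dq).
- rewrite !(numulDl, numulDr) mul_shr (bounded_uc pm) numul0r addr0 pp.
  by rewrite !shc_mul (bounded_ur pm) numulr0 add0r ur_shr qq.
- by rewrite !(numulDl, numulDr) !shr_mul !mul_shc pq qp pp qq shc_0 shr_0 addr0 add0r.
Qed.

Lemma tens_diag x i : D x -> diagD D (x \otimes e_(i, i)).
Proof.
move=> Dx; split=> [r s rs|r] /=; last by case: ifP => // _; apply: diag_zero.
by case: ifP => // /andP[/eqP ri /eqP si]; rewrite ri si eqxx in rs.
Qed.

(** A normalizing [z] gives an equivalence of [star z ** z] with [z ** star z] and at the same time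
    moves it from position [i] to position [j]. *)
Lemma Vs_rel_tens z i j c : is_projection (z ** star z) -> D (z ** star z) ->
  (forall d, D d -> D (z ** d ** star z)) -> (forall d, D d -> D (star z ** d ** z)) ->
  Vs_rel ((star z ** z) \otimes e_(i, i)) c -> Vs_rel ((z ** star z) \otimes e_(j, j)) c.
Proof.
move=> [sz zz] Dz zD Dz' [q qE <-].
have pz : is_projection ((z ** star z) \otimes e_(j, j)).
  by split; rewrite ?star_tens ?sz// tensM zz.
exists (DProj (tens_diag j Dz) pz) => //; apply/qclassP; rewrite /=.
exists (star z \otimes e_(i, j)); rewrite star_tens starK; split.
- by move=> d [d0 Dd]; rewrite tens_mul_tens; apply: tens_diag; apply: Dz'.
- by move=> d [d0 Dd]; rewrite tens_mul_tens; apply: tens_diag; apply: zD.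
- by rewrite tensM.
- by rewrite tensM qE.
Qed.

End Diagonal.

(** * The map from M_E to V^*, and normal forms of diagonal elements *)

Section Alpha.
Variables (E : digraph).
Notation L := (lpa int E).
Notation D := (lpa_diag int E).
Implicit Types (e : edge E) (v w : vertex E) (x y z : L) (T U : {fset edge E}).

Lemma Vs_rel_corner z c : is_projection (z ** star z) -> D (z ** star z) ->
  (forall d, D d -> D (z ** d ** star z)) -> (forall d, D d -> D (star z ** d ** z)) ->
  Vs_rel (corner (star z ** z)) c -> Vs_rel (corner (z ** star z)) c.
Proof. exact: Vs_rel_tens. Qed.

Lemma Vs_rel_vertex v : Vs_rel (corner (Lvert v : L)) (Vstar_class (vertex_dproj v)).
Proof. by exists (vertex_dproj v). Qed.

Lemma Vs_rel_emitter v T (h : emitter_subset v T) :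
  Vs_rel (corner (vert_minus int v T)) (Vstar_class (emitter_dproj h)).
Proof. by exists (emitter_dproj h). Qed.

Lemma Vs_rel_edge e :
  Vs_rel (corner (Ledge e ** Lghost e : L)) (Vstar_class (vertex_dproj (rng e))).
Proof.
have := @Vs_rel_corner (Ledge e); rewrite star_Ledge ghost_edge eqxx; apply.
- by split; rewrite ?starM ?star_Ledge ?star_Lghost ?edge_ghost_idem.
- exact: diag_edge.
- exact: diag_conj_edge.
- exact: diag_conj_ghost.
- exact: Vs_rel_vertex.
Qed.

Definition sum_rng_class T : Vstar D := \sum_(e <- T) Vstar_class (vertex_dproj (rng e)).

Lemma Vs_rel_edges T :
  Vs_rel (corner (\sum_(e <- T) Ledge e ** Lghost e : L)) (sum_rng_class T).
Proof.
rewrite /corner tens_sum.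
apply: (orthogonal_sum_rel (@Vs_rel0 int E) (@Vs_relD int E)) => [|e _|e f _ _ ef].
- exact: fset_uniq.
- exact: Vs_rel_edge.
- by rewrite tensM edge_ghost_orth// tens0.
Qed.

Lemma vert_minus_edges_orth v T U : (forall e, e \in U -> e \in T /\ src e = v) ->
  vert_minus int v T ** (\sum_(e <- U) Ledge e ** Lghost e) = 0 /\
  (\sum_(e <- U) Ledge e ** Lghost e) ** vert_minus int v T = 0.
Proof.
move=> UT; rewrite numul_sumr numul_suml !big_seq !big1// => e /UT[eT ev].
  by rewrite -numulA ghost_vert_minus// eT numulr0.
by rewrite numulA vert_minus_edge// eT numul0r.
Qed.

Lemma Vs_rel_minus_edges v T U c : (forall e, e \in U -> e \in T /\ src e = v) ->
  Vs_rel (corner (vert_minus int v T)) c ->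
  Vs_rel (corner (vert_minus int v T + \sum_(e <- U) Ledge e ** Lghost e))
    (c + sum_rng_class U).
Proof.
move=> /vert_minus_edges_orth[h1 h2] hc; rewrite /corner tensD; apply: Vs_relD => //.
- exact: Vs_rel_edges.
- by rewrite tensM h1 tens0.
- by rewrite tensM h2 tens0.
Qed.

Definition gen_class (g : ME_gen E) : Vstar D :=
  match g with
  | GVertex v => Vstar_class (vertex_dproj v)
  | @GEmitter _ w T h => Vstar_class (emitter_dproj h)
  end.

Lemma sum_rng_classE T :
  \sum_(g <- [seq GVertex (rng e) | e <- T]) gen_class g = sum_rng_class T.
Proof. by rewrite big_map. Qed.

(** Each defining relation of M_E comes from an orthogonal decomposition of one projection, whose
    class is then computed in two ways. *)
Lemma gen_class_eq s t : ME_eq s t ->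
  \sum_(g <- s) gen_class g = \sum_(g <- t) gen_class g.
Proof.
elim=> {s t} [//|s t _ -> //|s t u _ -> _ -> //|s s' t t' _ e _ e'|s t|v rv|w T h|w T U h h' TU].
- by rewrite !big_cat /= e e'.
- by rewrite !big_cat /= addrC.
- rewrite big_seq1 sum_rng_classE /=; apply: Vs_rel_uniq (Vs_rel_vertex v) _.
  by rewrite (Lvert_CK2 int rv); apply: Vs_rel_edges.
- rewrite big_cat /= !big_seq1 sum_rng_classE /= addrC; apply: Vs_rel_uniq (Vs_rel_vertex w) _.
  have -> : Lvert w = vert_minus int w T + \sum_(e <- T) Ledge e ** Lghost e.
    by rewrite /vert_minus addrNK.
  apply: Vs_rel_minus_edges; last exact: Vs_rel_emitter.
  by case: h => _ _ Tw e eT; split=> //; apply: Tw.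
- rewrite big_seq1 big_cons sum_rng_classE /=; apply: Vs_rel_uniq (Vs_rel_emitter h) _.
  rewrite (vert_minus_sub int w TU); apply: Vs_rel_minus_edges; last exact: Vs_rel_emitter.
  move=> e; rewrite inE => /andP[_ eU]; split=> //.
  by case: h' => _ _; apply.
Qed.

Definition alpha (m : ME E) : Vstar D := \sum_(g <- qrepr m) gen_class g.

Lemma alphaE s : alpha (ME_class s) = \sum_(g <- s) gen_class g.
Proof. by apply: gen_class_eq; apply: (qrepr_class (ME_equiv E)). Qed.

Lemma alpha_nmod_morphism : nmod_morphism alpha.
Proof.
split; first by rewrite [0]/(ME_class [::]) alphaE big_nil.
move=> x y; suff H s t : alpha (ME_class s + ME_class t) = alpha (ME_class s) + alpha (ME_class t).
  by move: x y; apply: quotW => s; apply: quotW => t; apply: H.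
by rewrite -ME_class_cat !alphaE big_cat.
Qed.

HB.instance Definition _ :=
  GRing.isNmodMorphism.Build (ME E) (Vstar D) alpha alpha_nmod_morphism.

Lemma alpha_vertex v : alpha (ME_vertex v) = Vstar_class (vertex_dproj v).
Proof. by rewrite alphaE big_seq1. Qed.

Lemma alpha_q w T (h : emitter_subset w T) : alpha (ME_q h) = Vstar_class (emitter_dproj h).
Proof. by rewrite alphaE big_seq1. Qed.

(* [x] lies in the span of the [mu mu^*], [mu] of source [v] and length at most [n],
   written along the first edges of the paths involved. *)
Fixpoint diag_tree n v x : Prop :=
  if n is n'.+1 then exists (c : int) T (z : edge E -> L),
    (forall e, e \in T -> src e = v /\ diag_tree n' (rng e) (z e)) /\
    x = c *: vert_minus int v T + \sum_(e <- T) Ledge e ** z e ** Lghost e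
  else exists c : int, x = c *: Lvert v.

Lemma diag_tree_vert n v (c : int) : diag_tree n v (c *: Lvert v).
Proof.
case: n => [|n] /=; first by exists c.
exists c, fset0, (fun=> 0); split=> //.
by rewrite /vert_minus !big_seq_fset0 subr0 addr0.
Qed.

Lemma diag_tree0 n v : diag_tree n v 0.
Proof. by rewrite -(scale0r (Lvert v)); apply: diag_tree_vert. Qed.

Lemma diag_treeW n v x : diag_tree n v x -> diag_tree n.+1 v x.
Proof.
elim: n v x => [|n IH] v x; first by move=> [c ->]; apply: diag_tree_vert.
move=> [c [T [z [zP ->]]]]; exists c, T, z; split=> // e /zP[ev ze].
by split=> //; apply: IH.
Qed.

Lemma diag_tree_weak m n v x : (m <= n)%N -> diag_tree m v x -> diag_tree n v x.
Proof.
move=> /subnKC <-; elim: (n - m)%N => [|l IH] h; first by rewrite addn0.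
by rewrite addnS; apply/diag_treeW/IH.
Qed.

(** On a new edge [e] the scalar part restricts to [c] times [e e^*]. Refinement brings two elements
    to a common set of edges so that they can be added. *)
Lemma diag_tree_refine v (c : int) T U (z : edge E -> L) : (T `<=` U)%fset ->
  c *: vert_minus int v T + \sum_(e <- T) Ledge e ** z e ** Lghost e =
  c *: vert_minus int v U +
  \sum_(e <- U) Ledge e ** (if e \in T then z e else c *: Lvert (rng e)) ** Lghost e.
Proof.
move=> TU; rewrite (vert_minus_sub int v TU) scalerDr -addrA; congr (_ + _).
rewrite [RHS](big_fsetD _ TU) addrC; congr (_ + _).
  by rewrite big_seq [RHS]big_seq; apply: eq_bigr => e ->.
rewrite scaler_sumr big_seq [RHS]big_seq; apply: eq_bigr => e.
rewrite inE => /andP[/negbTE -> _].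
by rewrite -lpa_scaleAr -lpa_scaleAl Ledge_rng.
Qed.

Lemma diag_treeD n v x y : diag_tree n v x -> diag_tree n v y -> diag_tree n v (x + y).
Proof.
elim: n v x y => [|n IH] v x y /=.
  by move=> [c ->] [d ->]; exists (c + d); rewrite scalerDl.
move=> [c [T [z [zP ->]]]] [d [U [z' [zP' ->]]]].
exists (c + d), (T `|` U)%fset, (fun e => (if e \in T then z e else c *: Lvert (rng e)) +
  (if e \in U then z' e else d *: Lvert (rng e))); split.
  move=> e; rewrite inE => eTU; split; last first.
    apply: IH; [case: ifP => [/zP[]//|_]|case: ifP => [/zP'[]//|_]]; exact: diag_tree_vert.
  by case/orP: eTU => [/zP[]|/zP'[]].
rewrite (diag_tree_refine v c z (fsubsetUl T U)) (diag_tree_refine v d z' (fsubsetUr T U)).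
rewrite addrACA -scalerDl -big_split; congr (_ + _); apply: eq_bigr => e _ /=.
by rewrite numulDr numulDl.
Qed.

Lemma diag_tree_diag n v x : diag_tree n v x -> D x.
Proof.
elim: n v x => [|n IH] v x /=; first by move=> [c ->]; apply: diagZ; apply: diag_vert.
move=> [c [T [z [zP ->]]]]; apply: (@ssubD _ D); first exact/diagZ/vert_minus_diag.
rewrite big_seq; apply: (big_ind D); [exact: ssub0|exact: ssubD|].
by move=> e /zP[_ /IH ze]; apply: diag_conj_edge.
Qed.

Lemma diag_tree_word e s (c : int) : path (@composable E) e s ->
  diag_tree (size s).+1 (src e) (c *: (Lword int e s ** star (Lword int e s))).
Proof.
elim: s e => [|f s IH] e.
  move=> _; exists 0, [fset e]%fset, (fun=> c *: Lvert (rng e)); split.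
    by move=> f; rewrite inE => /eqP ->; split=> //; apply: diag_tree_vert.
  rewrite scale0r add0r big_seq_fset1 -lpa_scaleAr -lpa_scaleAl Ledge_rng.
  by rewrite /= star_Ledge.
move=> /andP[/eqP ef p].
exists 0, [fset e]%fset, (fun=> c *: (Lword int f s ** star (Lword int f s))); split.
  by move=> g; rewrite inE => /eqP ->; split=> //; rewrite ef; apply: IH.
rewrite scale0r add0r big_seq_fset1 -lpa_scaleAr -lpa_scaleAl /=.
by rewrite starM star_Ledge !numulA.
Qed.

Lemma diag_decomposition x : D x -> exists n (W : {fset vertex E}) (f : vertex E -> L),
  [/\ forall v, diag_tree n v (f v), forall v, v \notin W -> f v = 0 & x = \sum_(v <- W) f v].
Proof.
move=> [s ->]; elim: s => [|[c mu] s [n [W [f [fP f0 e]]]]].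
  exists 0%N, fset0, (fun=> 0); split=> // [v|]; first exact: diag_tree0.
  by rewrite big_nil big_seq_fset0.
have [m [v]] : exists m v, diag_tree m v (c *: (Lpath int mu ** star (Lpath int mu))).
  case: mu => [v|g t p]; last by eexists; eexists; apply: diag_tree_word.
  by exists 0%N, v; rewrite /= star_Lvert Lvert_idem; exists c.
rewrite big_cons e /=; move: (c *: _) => y yP.
exists (maxn m n), (v |` W)%fset, (fun u => (if u == v then y else 0) + f u); split.
- move=> u; apply: diag_treeD; last exact: diag_tree_weak (leq_maxr _ _) (fP u).
  case: eqP => [->|_]; last exact: diag_tree0.
  exact: diag_tree_weak (leq_maxl _ _) yP.
- by move=> u; rewrite !inE negb_or => /andP[/negbTE -> /f0 ->]; rewrite addr0.
- rewrite big_split /=; congr (_ + _).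
    rewrite (big_fsetD1 v) /=; last by rewrite !inE eqxx.
    rewrite eqxx big1_fset ?addr0// => u; rewrite !inE => /andP[/negbTE ->//].
  rewrite (big_fsetD _ (fsubsetUr [fset v]%fset W)) [X in _ = _ + X]big1_fset ?addr0// => u.
  by rewrite inE => /andP[/f0].
Qed.

Lemma Lvert_torsion v (c : int) : c *: (Lvert v : L) = 0 -> c = 0.
Proof.
pose b : point E := (v, (0%N, [::]), 0).
move/(congr1 (fun x => Lrep x (indicator int b) b)).
by rewrite LrepZ Lrep_vert /= eqxx Lrep0 /indicator eqxx mulr1.
Qed.

(** An edge [e] outside [T] compresses the relation to a multiple of the vertex [rng e]. Without
    such an edge, [T] is either empty, leaving [v] itself, or the whole of [out v], where CK2 makes
    the projection zero. *)
Lemma vert_minus_torsion v T (c : int) : (forall e, e \in T -> src e = v) ->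
  c *: vert_minus int v T = 0 -> c = 0 \/ vert_minus int v T = 0.
Proof.
move=> Tv c0; have [[e ev eT]|/forall2NP noe] := pselect (exists2 e, src e = v & e \notin T).
  left; apply: (@Lvert_torsion (rng e)).
  have qe : vert_minus int v T ** Ledge e = Ledge e by rewrite vert_minus_edge// (negbTE eT).
  rewrite -(Lghost_edge int e) lpa_scaleAr (_ : c *: Ledge e = 0) ?numulr0//.
  by rewrite -qe lpa_scaleAl c0 numul0r.
have {noe} outT e : src e = v -> e \in T by move=> ev; case: (noe e) => [//|/negP/negPn].
have [T0|T0] := eqVneq T fset0.
  by left; apply: (@Lvert_torsion v); rewrite -[RHS]c0 /vert_minus T0 big_seq_fset0 subr0.
right; have [|rv Te] := @exhausted_stage_out E T v.
  by have /fset0Pn[e eT] := T0; split=> //; exists e; apply: Tv.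
have Tout : T = fset_set (out v).
  rewrite -Te; apply/fsetP => e; rewrite stage_outP.
  by case eT: (e \in T) => //=; apply/esym/eqP/Tv.
by rewrite /vert_minus (Lvert_CK2 int rv) -Tout subrr.
Qed.

End Alpha.

(** * Every diagonal projection has its class in the image of M_E *)

Section AlphaSurjective.
Variables (E : digraph).
Notation L := (lpa int E).
Notation D := (lpa_diag int E).
Implicit Types (e : edge E) (v w : vertex E) (x y z : L) (T U : {fset edge E}).

Definition in_alpha (p : finmx L) : Prop := exists m, Vs_rel p (alpha (E := E) m).

Lemma in_alpha0 : in_alpha 0.
Proof. by exists 0; rewrite raddf0; apply: Vs_rel0. Qed.

Lemma in_alphaD p q : in_alpha p -> in_alpha q -> p ** q = 0 -> q ** p = 0 -> in_alpha (p + q).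
Proof. by move=> [m pm] [n qn] pq qp; exists (m + n); rewrite raddfD; apply: Vs_relD. Qed.

Lemma in_alpha_sum (I : eqType) (r : seq I) (G : I -> finmx L) : uniq r ->
  (forall i, i \in r -> in_alpha (G i)) ->
  (forall i j, i \in r -> j \in r -> i != j -> G i ** G j = 0) ->
  in_alpha (\sum_(i <- r) G i).
Proof.
exact: (@orthogonal_sum_rel _ nat (fun p _ => in_alpha p) in_alpha0
  (fun p q _ _ => @in_alphaD p q) I r G (fun=> 0)).
Qed.

Lemma in_alpha_vertex v : in_alpha (corner (Lvert v)).
Proof. by exists (ME_vertex v); rewrite alpha_vertex; apply: Vs_rel_vertex. Qed.

Lemma in_alpha_edges T : in_alpha (corner (\sum_(e <- T) Ledge e ** Lghost e)).
Proof.
exists (sum_rng T); rewrite raddf_sum.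
rewrite (eq_bigr _ (fun e _ => alpha_vertex (rng e))); exact: Vs_rel_edges.
Qed.

Lemma in_alpha_vert_minus v T : (forall e, e \in T -> src e = v) ->
  in_alpha (corner (vert_minus int v T)).
Proof.
move=> Tv; have [->|T0] := eqVneq T fset0.
  by rewrite /vert_minus big_seq_fset0 subr0; apply: in_alpha_vertex.
have [h|ne] := pselect (emitter_subset v T).
  by exists (ME_q h); rewrite alpha_q; apply: Vs_rel_emitter.
have TE : stage_out T v = T.
  by apply/fsetP => e; rewrite stage_outP; case eT: (e \in T) => //=; apply/eqP/Tv.
have [rv Tout] : regular v /\ (T `<=` fset_set (out v))%fset.
  by move: (@stage_out_infinite E T v); rewrite TE; apply.
by rewrite vert_minus_regular//; apply: in_alpha_edges.
Qed.

Lemma vert_diag_tree n v x : diag_tree n v x -> Lvert v ** x = x.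
Proof.
case: n => [[c ->]|n [c [T [z [zP ->]]]]].
  by rewrite -lpa_scaleAr Lvert_idem.
rewrite numulDr -lpa_scaleAr vert_mul_minus; last by move=> e /zP[].
rewrite numul_sumr big_seq [in RHS]big_seq; congr (_ + _); apply: eq_bigr => e /zP[ev _].
by rewrite !numulA vert_edge ev eqxx.
Qed.

Lemma diag_tree_vertr n v x : diag_tree n v x -> x ** Lvert v = x.
Proof.
move=> xP; have Dx := diag_selfadjoint (diag_tree_diag xP).
by rewrite -[LHS]starK starM star_Lvert Dx (vert_diag_tree xP) Dx.
Qed.

(** Compressing the idempotent by [vert_minus int v T] gives an idempotent scalar, up to torsion;
    compressing it by an edge [e] shows that [z e] is idempotent, so that induction applies. The
    partial isometry [Ledge e ** z e] transports the class of [z e] back. *)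
Lemma in_alpha_tree n v x : diag_tree n v x -> x ** x = x -> in_alpha (corner x).
Proof.
elim: n v x => [|n IH] v x.
  move=> [c ->]; rewrite -lpa_scaleAl -lpa_scaleAr Lvert_idem => cc.
  have : (c * c - c) *: (Lvert v : L) = 0 by rewrite scalerBl -scalerA cc subrr.
  move/Lvert_torsion => c01.
  have /orP[/eqP ->|/eqP ->] : (c == 0) || (c == 1).
  - by rewrite -[_ == 1]subr_eq0 -mulf_eq0 mulrBr mulr1 c01.
  - by rewrite scale0r /corner tens0; apply: in_alpha0.
  - by rewrite scale1r; apply: in_alpha_vertex.
move=> [c [T [z [zP xE]]]] xx.
have Tv e : e \in T -> src e = v by case/zP.
have zv e : e \in T -> z e ** Lvert (rng e) = z e /\ Lvert (rng e) ** z e = z e.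
  by case/zP=> _ h; split; [apply: diag_tree_vertr h|apply: vert_diag_tree h].
pose q := vert_minus int v T.
have qT e : e \in T -> Lghost e ** q = 0 /\ q ** Ledge e = 0.
  by move=> eT; rewrite ghost_vert_minus ?vert_minus_edge ?eT//; apply: Tv.
have qq : q ** q = q by apply: vert_minus_idem.
have xq : x ** q = c *: q.
  rewrite xE numulDl -lpa_scaleAl qq numul_suml big_seq big1 ?addr0// => e /qT[eq _].
  by rewrite -numulA eq numulr0.
have ccq : (c * c - c) *: q = 0.
  have := congr1 (fun y => y ** q) xx; rewrite -numulA !xq -lpa_scaleAr xq scalerA => cc.
  by rewrite scalerBl cc subrr.
have xe e : e \in T -> x ** Ledge e = Ledge e ** z e.
  move=> eT; have [_ qe] := qT e eT; have [zr _] := zv e eT.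
  rewrite xE numulDl -lpa_scaleAl qe scaler0 add0r numul_suml (big_fsetD1 e)//=.
  rewrite -numulA ghost_edge eqxx -numulA zr big1_fset ?addr0// => f.
  by rewrite !inE => /andP[/negbTE fe _] _; rewrite -numulA ghost_edge fe numulr0.
have zz e : e \in T -> z e ** z e = z e.
  move=> eT; have [_ rz] := zv e eT.
  transitivity (Lghost e ** (x ** x ** Ledge e)).
    rewrite -(numulA x x) xe// [x ** _]numulA xe// -numulA numulA ghost_edge eqxx.
    by rewrite numulA rz.
  by rewrite xx xe// numulA ghost_edge eqxx rz.
have Dz e : e \in T -> D (z e) by move=> /zP[_ /diag_tree_diag].
have in_z e : e \in T -> in_alpha (corner (Ledge e ** z e ** Lghost e)).
  move=> eT; have [m zm] := IH _ _ (zP e eT).2 (zz e eT); exists m.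
  have sz : star (z e) = z e by apply: diag_selfadjoint; apply: Dz.
  have [zr rz] := zv e eT.
  have := @Vs_rel_corner E (Ledge e ** z e); rewrite starM star_Ledge sz.
  have -> : Ledge e ** z e ** (z e ** Lghost e) = Ledge e ** z e ** Lghost e.
    by rewrite !numulA -(numulA (Ledge e) (z e) (z e)) zz.
  have -> : z e ** Lghost e ** (Ledge e ** z e) = z e.
    by rewrite numulA -(numulA (z e)) ghost_edge eqxx zr zz.
  apply=> //.
  - split; first by rewrite !starM star_Ledge star_Lghost sz numulA.
    rewrite !numulA -(numulA (Ledge e ** z e)) ghost_edge eqxx.
    rewrite -(numulA (Ledge e) (z e) (Lvert _)) zr.
    by rewrite -(numulA (Ledge e) (z e) (z e)) zz.
  - exact/diag_conj_edge/Dz.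
  - move=> d Dd; have := diag_conj_edge e (ssubM (ssubM (Dz e eT) Dd) (Dz e eT)).
    by rewrite !numulA.
  - move=> d Dd; have := ssubM (ssubM (Dz e eT) (diag_conj_ghost e Dd)) (Dz e eT).
    by rewrite !numulA.
have orth e f : e != f ->
    (Ledge e ** z e ** Lghost e) ** (Ledge f ** z f ** Lghost f) = 0.
  move=> ef; rewrite !numulA -(numulA (Ledge e ** z e)) ghost_edge (negbTE ef).
  by rewrite numulr0 !numul0r.
have in_cq : in_alpha (corner (c *: q)).
  have [c0|q0] := vert_minus_torsion Tv ccq; last first.
    by rewrite /q q0 scaler0 /corner tens0; apply: in_alpha0.
  have /orP[/eqP ->|/eqP ->] : (c == 0) || (c == 1).
  - by rewrite -[_ == 1]subr_eq0 -mulf_eq0 mulrBr mulr1 c0.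
  - by rewrite scale0r /corner tens0; apply: in_alpha0.
  - by rewrite scale1r; apply: in_alpha_vert_minus.
rewrite xE /corner tensD; apply: in_alphaD => //.
- rewrite tens_sum; apply: in_alpha_sum => [|e|e f _ _ ef]; first exact: fset_uniq.
    exact: in_z.
  by rewrite tensM orth// tens0.
- rewrite tensM -lpa_scaleAl numul_sumr big_seq big1 ?scaler0 ?tens0// => e /qT[_ qe].
  by rewrite !numulA qe !numul0r.
- rewrite tensM -lpa_scaleAr numul_suml big_seq big1 ?scaler0 ?tens0// => e /qT[eq _].
  by rewrite -(numulA (Ledge e ** z e)) eq numulr0.
Qed.

Lemma in_alpha_proj x : D x -> x ** x = x -> in_alpha (corner x).
Proof.
move=> Dx xx; have [n [W [f [fP f0 xE]]]] := diag_decomposition Dx.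
have orth v w : v != w -> f v ** f w = 0.
  move=> vw; rewrite -(diag_tree_vertr (fP v)) -(vert_diag_tree (fP w)).
  by rewrite numulA -(numulA (f v)) vert_vert (negbTE vw) numulr0 numul0r.
have fx v : x ** f v = f v ** f v.
  have [vW|vW] := boolP (v \in W); last by rewrite f0// !numulr0.
  rewrite xE numul_suml (big_fsetD1 v)//= big1_fset ?addr0// => w.
  by rewrite !inE => /andP[wv _] _; apply: orth.
have fE v : v \in W -> f v ** f v = f v.
  move=> vW; have xv : x ** Lvert v = f v.
    rewrite xE numul_suml (big_fsetD1 v)//= (diag_tree_vertr (fP v)).
    rewrite big1_fset ?addr0// => w; rewrite !inE => /andP[wv _] _.
    by rewrite -(diag_tree_vertr (fP w)) -numulA vert_vert (negbTE wv) numulr0.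
  by rewrite -fx -{1}xv numulA xx xv.
rewrite xE /corner tens_sum; apply: in_alpha_sum => [|v vW|v w _ _ vw]; first exact: fset_uniq.
  exact: in_alpha_tree (fP v) (fE v vW).
by rewrite tensM orth// tens0.
Qed.

Lemma alpha_surj (c : Vstar D) : exists m, alpha m = c.
Proof.
suff H (p : dproj D) : exists m, alpha m = Vstar_class p by move: c; apply: quotW.
suff [m pm] : in_alpha (dproj_mx p) by exists m; apply: Vs_rel_uniq pm (Vs_rel_class p).
case: p => p [p0 Dp] [sp pp] /=; have [n pn] := finmxP p.
have pii i : p i i ** p i i = p i i by rewrite -{3}pp (diag_mulE _ _ _ p0).
rewrite [p](_ : p = \sum_(i <- enum 'I_n) p i i \otimes e_(i, i)); last first.
  rewrite big_enum [LHS](finmx_tens_sum pn); apply: eq_bigr => i _ /=.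
  rewrite (bigD1 i)//= big1 ?addr0// => j ji.
  by rewrite p0 ?tens0// eq_sym.
apply: in_alpha_sum => [|i _|i j _ _ ij].
- exact: enum_uniq.
- have [m pm] := in_alpha_proj (Dp i) (pii i); exists m.
  have sD : star (p i i) = p i i by apply: diag_selfadjoint.
  (* The diagonal entry serves as its own partial isometry from position 0 to position [i]. *)
  have := @Vs_rel_tens int E (p i i) 0 i (alpha m); rewrite sD pii; apply=> //.
  + by move=> d Dd; apply: ssubM => //; apply: ssubM.
  + by move=> d Dd; apply: ssubM => //; apply: ssubM.
- by rewrite tensM_neq// => /val_inj e; rewrite e eqxx in ij.
Qed.

End AlphaSurjective.

(** * The map from V^* to V(L_k(E)) and its composition with [alpha] *)

Section Beta.
Variables (k : fieldType) (E : digraph).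
Notation D := (lpa_diag int E).

Lemma iota_LZM : {morph iota_LZ k E : x y / x ** y}.
Proof. exact: lpa_mapM. Qed.

Lemma iota_idem_sim (p q : dproj D) : Vstar_sim D p q -> V_sim (iota_idem k p) (iota_idem k q).
Proof.
move=> [v [_ _ pE qE]]; exists (map_finmx (iota_LZ k E) (star v)), (map_finmx (iota_LZ k E) v).
by rewrite -!(map_finmxM iota_LZM) pE qE.
Qed.

Definition beta (x : Vstar D) : V (lpa k E) := V_class (iota_idem k (qrepr x)).

Lemma beta_class (p : dproj D) : beta (Vstar_class p) = V_class (iota_idem k p).
Proof. by apply/qclassP; apply: iota_idem_sim; apply: (qrepr_class (Vstar_sim_equiv D)). Qed.

Lemma map_finmx_osum m (a b : finmx (lpa int E)) :
  map_finmx (iota_LZ k E) (osum m a b) =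
  osum m (map_finmx (iota_LZ k E) a) (map_finmx (iota_LZ k E) b).
Proof.
apply: finmx_eq => i j; rewrite /osum /block_sum finmxDE /= raddfD; congr (_ + _).
by case: ifP => // _; rewrite ?raddf0//; case: ifP => // _; rewrite raddf0.
Qed.

Lemma beta_nmod_morphism : nmod_morphism beta.
Proof.
split.
  rewrite [0](_ : _ = Vstar_class (dproj0 D)) // beta_class; apply: V_rel_uniq (V_rel0 _).
  have := V_rel_class (iota_idem k (dproj0 D)); rewrite [idem_mx _](_ : _ = 0) //.
  by apply: finmx_eq => i j; rewrite /= raddf0.
suff H p q : beta (Vstar_class p + Vstar_class q) = beta (Vstar_class p) + beta (Vstar_class q).
  by move=> x y; move: x y; apply: quotW => p; apply: quotW => q; apply: H.
have [m pm] := finmxP (dproj_mx p).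
have pm' : bounded_by m (iota_idem k p).
  by move=> i j ij; rewrite /= pm// raddf0.
rewrite (Vstar_classD q pm) !beta_class (V_classD _ pm'); congr V_class; apply: idem_eq.
exact: map_finmx_osum.
Qed.

HB.instance Definition _ :=
  GRing.isNmodMorphism.Build (Vstar D) (V (lpa k E)) beta beta_nmod_morphism.

Definition gamma : ME E -> V (lpa k E) := beta \o @alpha E.
HB.instance Definition _ := GRing.Additive.on gamma.

Lemma iota_corner x : map_finmx (iota_LZ k E) (corner x) = corner (iota_LZ k E x).
Proof. by apply: finmx_eq => i j /=; case: ifP => // _; rewrite raddf0. Qed.

Lemma gamma_vertex v : V_rel (corner (Lvert v : lpa k E)) (gamma (ME_vertex v)).
Proof.
rewrite /gamma /= alpha_vertex beta_class.
have := V_rel_class (iota_idem k (vertex_dproj v)).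
by rewrite /= iota_corner [iota_LZ _ _ _]lpa_map_vert.
Qed.

Lemma gamma_q w T (h : emitter_subset w T) :
  V_rel (corner (vert_minus k w T)) (gamma (ME_q h)).
Proof.
rewrite /gamma /= alpha_q beta_class.
have := V_rel_class (iota_idem k (emitter_dproj h)).
rewrite /= iota_corner /vert_minus raddfB raddf_sum /= [lpa_map _ (Lvert w)]lpa_map_vert.
by under eq_bigr do rewrite lpa_mapM lpa_map_edge lpa_map_ghost.
Qed.

End Beta.

Theorem theorem2p8 (E : digraph) :
  (exists alpha : {additive ME E -> Vstar (lpa_diag int E)},
    [/\ forall v : vertex E, alpha (ME_vertex v) = Vstar_class (vertex_dproj v),
        forall (w : vertex E) (S : {fset edge E}) (wS : emitter_subset w S),
          alpha (ME_q wS) = Vstar_class (emitter_dproj wS)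
      & bijective alpha])
  /\ (forall k : fieldType,
       exists beta : {additive Vstar (lpa_diag int E) -> V (lpa k E)},
         (forall p : dproj (lpa_diag int E),
            beta (Vstar_class p) = V_class (iota_idem k p))
         /\ bijective beta).
Proof.
have gamma_inj k : injective (gamma k (E := E)).
  exact: (gam_inj (@gamma_vertex k E) (@gamma_q k E)).
have [alpha' alpha'K] := choice (@alpha_surj E).
have alphaK : cancel (@alpha E) alpha'.
  (* Injectivity of [alpha] involves no field and follows from that of [gamma] over any single
     one. *)
  by move=> m; apply: (@gamma_inj rat); rewrite /gamma /= alpha'K.
split.
  exists (@alpha E : {additive _ -> _}); split; [exact: alpha_vertex|exact: alpha_q|].
  by exists alpha'.
move=> k; exists (@beta k E : {additive _ -> _}); split; first exact: beta_class.
have [gamma' gamma'K] := choice (gam_surj (@gamma_vertex k E) (@gamma_q k E)).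
(* As [gamma] is [beta] after [alpha], the inverse of [beta] is [alpha] after a section of
   [gamma]. *)
exists (fun c => alpha (gamma' c)) => c; last exact: gamma'K.
rewrite -[c in RHS]alpha'K; congr alpha; apply: (@gamma_inj k).
by rewrite gamma'K /gamma /= alpha'K.
Qed.
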